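(* Let $\mathcal{S}$ be a surface in $\mathrm{Nil}$ of constant mean curvature $H\neq 0$, and let $p\in\mathcal{S}$ be a non-umbilic point. Assume that in a neighborhood of $p$ the unit normal vector $n$ satisfies $n\neq \pm E_3$ and $\frac{\partial}{\partial z}\langle n,E_3\rangle\neq 0$ at every point. Then in some neighborhood of $p$ there is a conformal parameter $z=x+iy$ on $\mathcal{S}$, normalized so that $B=\frac{2H+i}{2H-i}$, such that, for the potential $U$ associated with $z$ and a smooth function $v=\rho+i\varphi$ (with $\rho=\operatorname{Re}(v)$, $\varphi=\operatorname{Im}(v)$) with $e^{v}=U$, the function $v$ is a solution of the system $$ \begin{cases} \Delta v+8\sinh 2v=0,\\[4pt] \dfrac{\varphi_x^2}{\cosh^2\rho}+\dfrac{\varphi_y^2}{\sinh^2\rho}=8\left(\cos 2\varphi-\operatorname{Re}\left(\dfrac{2H+i}{2H-i}\right)\right), \end{cases} $$ where the second equation is understood at the points where $\rho\neq 0$.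
   Context: $\mathrm{Nil}$ is the three-dimensional Heisenberg group of real matrices $$\begin{pmatrix}1&x_1&x_3\\0&1&x_2\\0&0&1\end{pmatrix}$$ with matrix multiplication and the left-invariant metric $ds^2=dx_1^2+dx_2^2+(dx_3-x_1dx_2)^2$. Let $e_1=\partial/\partial x_1$, $e_2=\partial/\partial x_2$, $e_3=\partial/\partial x_3$ be the orthonormal basis of its Lie algebra at the identity. $E_3$ is the left-invariant vector field generated by $e_3$, and $\langle\cdot,\cdot\rangle$ is the metric. A surface $\mathcal{S}$ in $\mathrm{Nil}$ is represented locally by a (smooth) conformal immersion $f:\Sigma\to\mathrm{Nil}$ from an open domain $\Sigma\subset\mathbb{C}$; the coordinate $z=x+iy\in\Sigma$ is a conformal parameter. Write $\partial=\frac{\partial}{\partial z}=\frac12(\partial_x-i\partial_y)$, $\overline{\partial}=\frac{\partial}{\partial\overline z}=\frac12(\partial_x+i\partial_y)$, $\Delta=\partial_x^2+\partial_y^2=4\partial\overline{\partial}$. The unit normal $n$ is oriented so that $(f_x,f_y,n)$ is positively oriented with respect to the orientation in which the left-invariant frame generated by $(e_1,e_2,e_3)$ is positive, and the mean curvature $H$ is half of the trace of the second fundamental form with respect to $n$. Weierstrass representation (known): locally there are smooth complex-valued functions $\psi_1(z),\psi_2(z)$, not vanishing simultaneously and unique up to a common sign, such that $$f^{-1}\frac{\partial f}{\partial z}=\frac{i}{2}\big(\overline{\psi}_2^2+\psi_1^2\big)e_1+\frac12\big(\overline{\psi}_2^2-\psi_1^2\big)e_2+\psi_1\overline{\psi_2}\,e_3,$$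 and they satisfy the Dirac equation $\partial\psi_2+U\psi_1=0$, $-\overline{\partial}\psi_1+U\psi_2=0$ with potential $$U=\frac{H}{2}\big(|\psi_1|^2+|\psi_2|^2\big)+\frac{i}{4}\big(|\psi_2|^2-|\psi_1|^2\big).$$ Set $$\widetilde A=\overline{\psi_2}\,\partial\psi_1-\psi_1\,\partial\overline{\psi_2}+\frac{2Hi}{2H+i}\psi_1^2\,\overline{\psi}_2^2,\qquad B=\frac14(2H+i)\widetilde A.$$ The quadratic differential $B\,dz^2$ is the Abresch–Rosenberg quadratic differential; it is holomorphic on constant mean curvature surfaces (known). A point of the surface is called umbilic if $\widetilde A=0$ at that point, and non-umbilic otherwise. *)

(* Defs.v *)
From Stdlib Require Import Reals Lra.
From Coquelicot Require Import Coquelicot.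
Open Scope R_scope.

(* The parameter z = x + iy is the pair (x, y). *)
Definition dx (u : C -> R) (z : C) : R := Derive (fun t => u (t, Im z)) (Re z).
Definition dy (u : C -> R) (z : C) : R := Derive (fun t => u (Re z, t)) (Im z).

(* [Derive] is total, so differentiability is recorded separately. *)
Definition ex_dx (u : C -> R) (z : C) : Prop :=
  ex_derive (fun t => u (t, Im z)) (Re z).
Definition ex_dy (u : C -> R) (z : C) : Prop :=
  ex_derive (fun t => u (Re z, t)) (Im z).

Fixpoint Ck (k : nat) (D : C -> Prop) (u : C -> R) : Prop :=
  match k with
  | O => forall z, D z -> continuous u z
  | S k' => (forall z, D z -> ex_dx u z /\ ex_dy u z)
            /\ Ck k' D (dx u) /\ Ck k' D (dy u)
  end.

(* Only used for open [D]. *)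
Definition smooth (D : C -> Prop) (u : C -> R) : Prop := forall k, Ck k D u.

Definition smoothC (D : C -> Prop) (u : C -> C) : Prop :=
  smooth D (fun z => Re (u z)) /\ smooth D (fun z => Im (u z)).

Definition dxC (u : C -> C) (z : C) : C :=
  (dx (fun w => Re (u w)) z, dx (fun w => Im (u w)) z).
Definition dyC (u : C -> C) (z : C) : C :=
  (dy (fun w => Re (u w)) z, dy (fun w => Im (u w)) z).

Definition dz (u : C -> C) (z : C) : C :=
  (/ 2 * (dxC u z - Ci * dyC u z))%C.

Definition laplacian (u : C -> C) (z : C) : C :=
  (dxC (dxC u) z + dyC (dyC u) z)%C.

Definition Cexp (z : C) : C :=
  (exp (Re z) * cos (Im z), exp (Re z) * sin (Im z)).
Definition Csinh (z : C) : C := ((Cexp z - Cexp (- z)) / 2)%C.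

Definition connected_set (D : C -> Prop) : Prop :=
  forall A B : C -> Prop, open A -> open B ->
    (forall z, D z -> A z \/ B z) ->
    (exists z, D z /\ A z) -> (exists z, D z /\ B z) ->
    exists z, D z /\ A z /\ B z.

Definition plane_domain (D : C -> Prop) : Prop := open D /\ connected_set D.

Definition diffeomorphism (D V : C -> Prop) (h : C -> C) : Prop :=
  smoothC D h /\ (forall w, D w -> V (h w)) /\
  exists k : C -> C,
    smoothC V k /\ (forall z, V z -> D (k z)) /\
    (forall w, D w -> k (h w) = w) /\ (forall z, V z -> h (k z) = z).

(* Points of Nil, and tangent vectors in the basis d/dx1, d/dx2, d/dx3. *)
Definition R3 : Type := (R * R * R)%type.
Definition x1 (p : R3) : R := fst (fst p).
Definition x2 (p : R3) : R := snd (fst p).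
Definition x3 (p : R3) : R := snd p.

Definition nil_matrix (p : R3) : @matrix R 3 3 :=
  mk_matrix 3 3 (fun i j =>
    match i, j with
    | 0%nat, 1%nat => x1 p
    | 1%nat, 2%nat => x2 p
    | 0%nat, 2%nat => x3 p
    | _, _ => if Nat.eqb i j then 1 else 0
    end).

Definition nil_mul (p q : R3) : R3 :=
  (x1 p + x1 q, x2 p + x2 q, x3 p + x3 q + x1 p * x2 q).
Definition nil_inv (p : R3) : R3 := (- x1 p, - x2 p, x1 p * x2 p - x3 p).

Lemma nil_mulE (p q : R3) :
  nil_matrix (nil_mul p q) = @Mmult R_Ring 3 3 3 (nil_matrix p) (nil_matrix q).
Proof.
apply mk_matrix_ext; intros i j Hi Hj.
destruct i as [|[|[|i]]]; destruct j as [|[|[|j]]];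
  try (exfalso; apply (Nat.lt_irrefl 3); eapply Nat.le_lt_trans; [|eassumption];
       do 3 apply le_n_S; apply Nat.le_0_l);
  cbv -[Rplus Rmult R0 R1]; ring.
Qed.

Lemma nil_mulVp (p : R3) : nil_mul (nil_inv p) p = (0, 0, 0).
Proof. unfold nil_mul, nil_inv, x1, x2, x3; simpl; repeat f_equal; ring. Qed.

(* ds^2 = dx1^2 + dx2^2 + (dx3 - x1 dx2)^2, polarized. *)
Definition metric (p u v : R3) : R :=
  x1 u * x1 v + x2 u * x2 v + (x3 u - x1 p * x2 u) * (x3 v - x1 p * x2 v).

Definition e1 : R3 := (1, 0, 0).
Definition e2 : R3 := (0, 1, 0).
Definition e3 : R3 := (0, 0, 1).

(* The left-invariant field generated by [a]: the image of [a] under the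
   differential of q |-> p q at the identity. *)
Definition left_field (a p : R3) : R3 :=
  let c (t : R) : R3 := nil_mul p (scal t a) in
  (Derive (fun t => x1 (c t)) 0, Derive (fun t => x2 (c t)) 0,
   Derive (fun t => x3 (c t)) 0).

(* Derivative at p, in the direction u, of g(v, w) for constant coordinate
   fields v and w. *)
Definition dmetric (p u v w : R3) : R :=
  Derive (fun t => metric (plus p (scal t u)) v w) 0.

(* Christoffel symbols of the first kind of the Levi-Civita connection: the
   inner product of (nabla_u v) with w for constant coordinate fields, by the
   Koszul formula. *)
Definition christoffel (p u v w : R3) : R :=
  (dmetric p u v w + dmetric p v u w - dmetric p w u v) / 2.

Definition smooth3 (D : C -> Prop) (f : C -> R3) : Prop :=
  smooth D (fun z => x1 (f z)) /\ smooth D (fun z => x2 (f z)) /\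
  smooth D (fun z => x3 (f z)).

Definition dx3 (f : C -> R3) (z : C) : R3 :=
  (dx (fun w => x1 (f w)) z, dx (fun w => x2 (f w)) z, dx (fun w => x3 (f w)) z).
Definition dy3 (f : C -> R3) (z : C) : R3 :=
  (dy (fun w => x1 (f w)) z, dy (fun w => x2 (f w)) z, dy (fun w => x3 (f w)) z).

Definition immersion (D : C -> Prop) (f : C -> R3) : Prop :=
  forall z, D z -> forall a b : R,
    plus (scal a (dx3 f z)) (scal b (dy3 f z)) = zero -> a = 0 /\ b = 0.

Definition conformal (D : C -> Prop) (f : C -> R3) : Prop :=
  forall z, D z ->
    metric (f z) (dx3 f z) (dx3 f z) = metric (f z) (dy3 f z) (dy3 f z) /\
    metric (f z) (dx3 f z) (dy3 f z) = 0.

(* Determinant of (u, v, w) with respect to the orthonormal left-invariant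
   frame generated by (e1, e2, e3). *)
Definition frame_det (p u v w : R3) : R :=
  let c (a b : R3) := metric p a (left_field b p) in
  c u e1 * (c v e2 * c w e3 - c v e3 * c w e2)
  - c u e2 * (c v e1 * c w e3 - c v e3 * c w e1)
  + c u e3 * (c v e1 * c w e2 - c v e2 * c w e1).

Definition unit_normal (D : C -> Prop) (f n : C -> R3) : Prop :=
  forall z, D z ->
    metric (f z) (n z) (n z) = 1 /\
    metric (f z) (n z) (dx3 f z) = 0 /\
    metric (f z) (n z) (dy3 f z) = 0 /\
    0 < frame_det (f z) (dx3 f z) (dy3 f z) (n z).

(* The inner product with n of the covariant derivative of f_b along the
   coordinate a; [fa], [fb], [fab] are the partial derivatives of f. *)
Definition second_form (p n fa fb fab : R3) : R :=
  metric p fab n + christoffel p fa fb n.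

Definition mean_curvature (f n : C -> R3) (z : C) : R :=
  let p := f z in
  let fx := dx3 f z in
  let fy := dy3 f z in
  let E := metric p fx fx in
  let F := metric p fx fy in
  let G := metric p fy fy in
  let L := second_form p (n z) fx fx (dx3 (dx3 f) z) in
  let M := second_form p (n z) fx fy (dx3 (dy3 f) z) in
  let N := second_form p (n z) fy fy (dy3 (dy3 f) z) in
  / 2 * ((E * N - 2 * F * M + G * L) / (E * G - F * F)).

(* [f] is a conformal representation, with oriented unit normal [n], of a
   surface of constant mean curvature [H]. *)
Definition cmc_surface (H : R) (D : C -> Prop) (f n : C -> R3) : Prop :=
  smooth3 D f /\ immersion D f /\ conformal D f /\ unit_normal D f n /\
  (forall z, D z -> mean_curvature f n z = H).

Definition angle (f n : C -> R3) (z : C) : R :=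
  metric (f z) (n z) (left_field e3 (f z)).

(* A component, selected by [x] among x1, x2, x3, of f^{-1} df/dz in the
   complexified Lie algebra: f is translated so that f(z) goes to the identity,
   where e1, e2, e3 are the coordinate vectors. *)
Definition left_dz (x : R3 -> R) (f : C -> R3) (z : C) : C :=
  dz (fun w => RtoC (x (nil_mul (nil_inv (f z)) (f w)))) z.

Definition weierstrass (D : C -> Prop) (f : C -> R3) (psi1 psi2 : C -> C) : Prop :=
  smoothC D psi1 /\ smoothC D psi2 /\
  forall z, D z ->
    ~ (psi1 z = 0 /\ psi2 z = 0) /\
    (left_dz x1 f z = Ci / 2 * (Cconj (psi2 z) ^ 2 + psi1 z ^ 2) /\
     left_dz x2 f z = 1 / 2 * (Cconj (psi2 z) ^ 2 - psi1 z ^ 2) /\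
     left_dz x3 f z = psi1 z * Cconj (psi2 z))%C.

Definition potential (H : R) (psi1 psi2 : C -> C) (z : C) : C :=
  (RtoC (H / 2 * (Cmod (psi1 z) ^ 2 + Cmod (psi2 z) ^ 2))
   + Ci / 4 * RtoC (Cmod (psi2 z) ^ 2 - Cmod (psi1 z) ^ 2))%C.

Definition Atilde (H : R) (psi1 psi2 : C -> C) (z : C) : C :=
  (Cconj (psi2 z) * dz psi1 z - psi1 z * dz (fun w => Cconj (psi2 w)) z
   + 2 * H * Ci / (2 * H + Ci) * psi1 z ^ 2 * Cconj (psi2 z) ^ 2)%C.

Definition AR_coeff (H : R) (psi1 psi2 : C -> C) (z : C) : C :=
  (1 / 4 * (2 * H + Ci) * Atilde H psi1 psi2 z)%C.

(* The spinors exist near every point and are unique up to a common sign, under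
   which [Atilde] is invariant. *)
Definition umbilic (H : R) (f : C -> R3) (z : C) : Prop :=
  exists (D : C -> Prop) (psi1 psi2 : C -> C),
    open D /\ D z /\ weierstrass D f psi1 psi2 /\ Atilde H psi1 psi2 z = 0.

Definition log_potential (H : R) (D : C -> Prop) (psi1 psi2 v : C -> C) : Prop :=
  smoothC D v /\ forall z, D z -> Cexp (v z) = potential H psi1 psi2 z.

Definition solves_system (H : R) (D : C -> Prop) (v : C -> C) : Prop :=
  let rho := fun z => Re (v z) in
  let phi := fun z => Im (v z) in
  forall z, D z ->
    (laplacian v z + 8 * Csinh (2 * v z) = 0)%C /\
    (rho z <> 0 ->
     dx phi z ^ 2 / cosh (rho z) ^ 2 + dy phi z ^ 2 / sinh (rho z) ^ 2
     = 8 * (cos (2 * phi z) - Re ((2 * H + Ci) / (2 * H - Ci))%C)).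

(* Main.v *)
Require Import Defs.
From Stdlib Require Import Reals Lra Classical ClassicalEpsilon.
From Coquelicot Require Import Coquelicot.
Open Scope R_scope.

(** Write psi for psi1, q for the conjugate of psi2, and a = 2H + i.  For
    a conformal immersion, the structure equations of Nil and the value H of the
    mean curvature say together that
      dbar psi = U conj q,   dbar q = - conj U conj psi,
      4 U = conj a |psi|^2 + a |q|^2
    ([dirac]).  Everything else is a consequence of this first-order system
    with constant H.

    With p = d psi and s = d q as new unknowns, the commutation of d and dbar
    gives dbar p = d (U conj q) and dbar s = - d (conj U conj psi), so that every
    derivative below becomes a polynomial in psi, q, p, s and their conjugates.
    In these variables three facts are polynomial identities: B is holomorphic
    ([ar_holomorphic]); U ddbar U - dU dbar U + U^4 = |B|^2, which divided by
    U^2 reads ddbar (log U) = |B|^2 U^{-2} - U^2 ([pot_sinh_gordon]); and the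
    derivative of the phase of U is a real-linear expression in psi q
    ([pot_phase]).  When |B| = 1 the second fact is the sinh-Gordon equation.
    When B = a / conj a the third one becomes
      d phi = - (om + |U|^{-2} conj om),   om = H psi q / a,
    whose real and imaginary parts carry the factors cosh rho and sinh rho; the
    left-hand side of the second equation of the system is then 16 |om|^2 / |U|^2,
    and the right-hand side is equal to it because U is an explicit function of
    |psi|^2 and |q|^2 ([log_phase_equation]).

    It remains to find a parameter in which B = a / conj a.  Near p the spinors
    are square roots of the components of the null vector f^{-1} df/dz
    ([local_spinors]), and B(p) is nonzero because p is not umbilic.  Under a
    change of parameter z = h(w) the spinors are multiplied by a square root of
    h' and B by h'^2 ([weierstrass_reparam], [ar_coeff_reparam]), so h' must be
    1 / G with G^2 = B conj a / a.  Such an h is the local inverse of a primitive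
    of G ([holo_primitive], [holo_local_inverse]), and h' has a square root
    because G has one.  The composite f o h is again a conformal immersion with
    mean curvature H ([cmc_surface_reparam]), so the Dirac system, and with it
    the three identities, hold for it as well. *)

(** * Smooth functions of two real variables *)

Definition has_partials (u : C -> R) (z : C) (a b : R) : Prop :=
  is_derive (fun t => u (t, Im z)) (Re z) a /\
  is_derive (fun t => u (Re z, t)) (Im z) b.

Lemma open_locally_x (D : C -> Prop) (z : C) :
  open D -> D z -> locally (Re z) (fun t => D (t, Im z)).
Proof.
intros HD Hz; destruct (HD z Hz) as [e He]; exists e; intros t Ht.
apply He; split; [exact Ht | apply ball_center].
Qed.

Lemma open_locally_y (D : C -> Prop) (z : C) :
  open D -> D z -> locally (Im z) (fun t => D (Re z, t)).
Proof.
intros HD Hz; destruct (HD z Hz) as [e He]; exists e; intros t Ht.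
apply He; split; [apply ball_center | exact Ht].
Qed.

Lemma has_partials_unique u z a b :
  has_partials u z a b -> dx u z = a /\ dy u z = b.
Proof. intros [Ha Hb]; split; apply is_derive_unique; assumption. Qed.

Lemma has_partials_ext_loc (D : C -> Prop) u v z a b :
  open D -> D z -> (forall w, D w -> u w = v w) ->
  has_partials u z a b -> has_partials v z a b.
Proof.
intros HD Hz Huv [Ha Hb]; split.
- apply is_derive_ext_loc with (2 := Ha).
  apply filter_imp with (2 := open_locally_x D z HD Hz); auto.
- apply is_derive_ext_loc with (2 := Hb).
  apply filter_imp with (2 := open_locally_y D z HD Hz); auto.
Qed.

Lemma ex_partials u z :
  ex_dx u z -> ex_dy u z -> has_partials u z (dx u z) (dy u z).
Proof. intros Hx Hy; split; apply Derive_correct; assumption. Qed.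

Lemma Ck_ext k : forall (D : C -> Prop) u v, open D ->
  (forall z, D z -> u z = v z) -> Ck k D u -> Ck k D v.
Proof.
induction k as [|k IH]; intros D u v HD Huv; simpl.
- intros Hu z Hz; apply continuous_ext_loc with (2 := Hu z Hz).
  apply filter_imp with (2 := HD z Hz); auto.
- intros (Hd & Hx & Hy).
  assert (Hp : forall z, D z -> has_partials v z (dx u z) (dy u z)).
  { intros z Hz; apply has_partials_ext_loc with (D := D) (u := u); auto.
    destruct (Hd z Hz); apply ex_partials; auto. }
  split; [|split].
  + intros z Hz; destruct (Hp z Hz); split; eexists; eassumption.
  + apply IH with (dx u); auto.
    intros z Hz; symmetry; exact (proj1 (has_partials_unique _ _ _ _ (Hp z Hz))).
  + apply IH with (dy u); auto.
    intros z Hz; symmetry; exact (proj2 (has_partials_unique _ _ _ _ (Hp z Hz))).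
Qed.

Lemma Ck_intro k (D : C -> Prop) u ux uy : open D ->
  (forall z, D z -> has_partials u z (ux z) (uy z)) ->
  Ck k D ux -> Ck k D uy -> Ck (S k) D u.
Proof.
intros HD Hp Hx Hy; simpl; split; [|split].
- intros z Hz; destruct (Hp z Hz); split; eexists; eassumption.
- apply Ck_ext with ux; auto.
  intros z Hz; symmetry; exact (proj1 (has_partials_unique _ _ _ _ (Hp z Hz))).
- apply Ck_ext with uy; auto.
  intros z Hz; symmetry; exact (proj2 (has_partials_unique _ _ _ _ (Hp z Hz))).
Qed.

Lemma Ck_partials k (D : C -> Prop) u z : Ck (S k) D u -> D z ->
  has_partials u z (dx u z) (dy u z).
Proof. intros (Hd & _) Hz; destruct (Hd z Hz); apply ex_partials; auto. Qed.

Lemma Ck_mono k : forall (D D' : C -> Prop) u,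
  (forall z, D' z -> D z) -> Ck k D u -> Ck k D' u.
Proof.
induction k as [|k IH]; intros D D' u HD; simpl; [auto|].
intros (Hd & Hx & Hy); repeat split; eauto; apply Hd; auto.
Qed.

(** [Ck] only knows the derivatives along the two axes; the chain rule needs the
    total derivative, which exists because the partial derivatives are continuous. *)
Lemma C1_differentiable (D : C -> Prop) u z : open D ->
  (forall w, D w -> has_partials u w (dx u w) (dy u w)) ->
  (forall w, D w -> continuous (dx u) w) -> D z ->
  differentiable_pt_lim (fun s t => u (s, t)) (Re z) (Im z) (dx u z) (dy u z).
Proof.
intros HD Hp Hc Hz; destruct z as [x y]; simpl.
apply filterdiff_differentiable_pt_lim.
apply (is_derive_filterdiff (fun s t => u (s, t)) x y (fun s t => dx u (s, t))).
- apply filter_imp with (2 := HD (x, y) Hz); intros [s t] Hst.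
  exact (proj1 (Hp (s, t) Hst)).
- exact (proj2 (Hp (x, y) Hz)).
- apply continuous_ext with (dx u); [intros [s t]; reflexivity|].
  apply Hc; auto.
Qed.

Lemma differentiable_pt_lim_continuous u z a b :
  differentiable_pt_lim (fun s t => u (s, t)) (Re z) (Im z) a b ->
  continuous u z.
Proof.
intros Hd.
assert (Hc : continuity_2d_pt (fun s t => u (s, t)) (Re z) (Im z))
  by (apply differentiable_continuity_pt; exists a, b; exact Hd).
apply continuity_2d_pt_filterlim in Hc; destruct z as [x y]; simpl in Hc.
apply continuous_ext with (fun w : C => u (fst w, snd w)); [intros []; auto|].
exact Hc.
Qed.

Lemma C1_continuous (D : C -> Prop) u : open D ->
  (forall w, D w -> has_partials u w (dx u w) (dy u w)) ->
  (forall w, D w -> continuous (dx u) w) -> forall z, D z -> continuous u z.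
Proof.
intros HD Hp Hc z Hz.
apply differentiable_pt_lim_continuous with (dx u z) (dy u z).
apply C1_differentiable with D; auto.
Qed.

(** The definition of [Ck] asks for continuity of the derivatives of top order
    only, so that lower regularity has to be derived. *)
Lemma Ck_S k : forall (D : C -> Prop) u, open D -> Ck (S k) D u -> Ck k D u.
Proof.
induction k as [|k IH]; intros D u HD Hu.
- intros z Hz; apply C1_continuous with D; auto.
  + intros w Hw; apply Ck_partials with 0%nat D; auto.
  + apply Hu.
- destruct Hu as (Hd & Hx & Hy); split; [exact Hd|].
  split; apply IH; auto.
Qed.

Lemma Ck_continuous k (D : C -> Prop) u z :
  open D -> Ck k D u -> D z -> continuous u z.
Proof.
intros HD; induction k as [|k IH]; intros Hu Hz; [auto|].
apply IH; auto; apply Ck_S; auto.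
Qed.

Lemma Ck_differentiable k (D : C -> Prop) u z : open D -> Ck (S k) D u -> D z ->
  differentiable_pt_lim (fun s t => u (s, t)) (Re z) (Im z) (dx u z) (dy u z).
Proof.
intros HD Hu Hz; apply C1_differentiable with D; auto.
- intros; apply Ck_partials with k D; auto.
- destruct Hu as (_ & Hx & _); intros; apply Ck_continuous with k D; auto.
Qed.

Lemma Ck_const k : forall (D : C -> Prop) c, open D -> Ck k D (fun _ => c).
Proof.
induction k as [|k IH]; intros D c HD.
- intros z _; apply continuous_const.
- apply Ck_intro with (fun _ => 0) (fun _ => 0); auto.
  intros z _; split; apply @is_derive_const.
Qed.

Lemma has_partials_plus u v z a b c d :
  has_partials u z a b -> has_partials v z c d ->
  has_partials (fun w => u w + v w) z (a + c) (b + d).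
Proof. intros [] []; split; apply @is_derive_plus; assumption. Qed.

Lemma has_partials_mult u v z a b c d :
  has_partials u z a b -> has_partials v z c d ->
  has_partials (fun w => u w * v w) z (a * v z + u z * c) (b * v z + u z * d).
Proof.
destruct z as [x y]; intros [] []; split.
- apply (is_derive_mult (fun t => u (t, y)) (fun t => v (t, y)) x a c); auto.
  intros; apply Rmult_comm.
- apply (is_derive_mult (fun t => u (x, t)) (fun t => v (x, t)) y b d); auto.
  intros; apply Rmult_comm.
Qed.

Lemma Ck_plus k : forall (D : C -> Prop) u v, open D ->
  Ck k D u -> Ck k D v -> Ck k D (fun z => u z + v z).
Proof.
induction k as [|k IH]; intros D u v HD Hu Hv.
- intros z Hz; apply (continuous_plus u v); auto.
- apply Ck_intro with (fun z => dx u z + dx v z) (fun z => dy u z + dy v z); auto.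
  + intros; apply has_partials_plus; eapply Ck_partials; eauto.
  + apply IH; auto; [apply Hu | apply Hv].
  + apply IH; auto; [apply Hu | apply Hv].
Qed.

Lemma Ck_mult k : forall (D : C -> Prop) u v, open D ->
  Ck k D u -> Ck k D v -> Ck k D (fun z => u z * v z).
Proof.
induction k as [|k IH]; intros D u v HD Hu Hv.
- intros z Hz; apply (continuous_mult u v); auto.
- apply Ck_intro with (fun z => dx u z * v z + u z * dx v z)
    (fun z => dy u z * v z + u z * dy v z); auto.
  + intros; apply has_partials_mult; eapply Ck_partials; eauto.
  + apply Ck_plus; auto; apply IH; auto; try (apply Ck_S; auto; fail);
      [apply Hu | apply Hv].
  + apply Ck_plus; auto; apply IH; auto; try (apply Ck_S; auto; fail);
      [apply Hu | apply Hv].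
Qed.

Lemma has_partials_comp1 (g : R -> R) u z a b g' :
  is_derive g (u z) g' -> has_partials u z a b ->
  has_partials (fun w => g (u w)) z (a * g') (b * g').
Proof.
intros Hg []; split.
- apply (is_derive_comp g (fun t => u (t, Im z))); auto; destruct z; exact Hg.
- apply (is_derive_comp g (fun t => u (Re z, t))); auto; destruct z; exact Hg.
Qed.

(** The recursive step for composition with a function of one variable: only the
    derivative g' of g has to be composed with u at the lower order, which closes
    the inductions for the inverse and the square root below. *)
Lemma Ck_comp1 k (D : C -> Prop) (g g' : R -> R) u : open D ->
  (forall z, D z -> is_derive g (u z) (g' (u z))) ->
  Ck (S k) D u -> Ck k D (fun z => g' (u z)) -> Ck (S k) D (fun z => g (u z)).
Proof.
intros HD Hg Hu Hg'.
apply Ck_intro with (fun z => dx u z * g' (u z)) (fun z => dy u z * g' (u z)); auto.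
- intros; apply has_partials_comp1; auto; eapply Ck_partials; eauto.
- apply Ck_mult; auto; apply Hu.
- apply Ck_mult; auto; apply Hu.
Qed.

Lemma Ck_comp1_0 (D : C -> Prop) (g g' : R -> R) u : 
  (forall z, D z -> is_derive g (u z) (g' (u z))) ->
  Ck 0 D u -> Ck 0 D (fun z => g (u z)).
Proof.
intros Hg Hu z Hz; apply (continuous_comp u g); [auto|].
apply (ex_derive_continuous g); eexists; apply Hg; auto.
Qed.

Lemma smooth_partials (D : C -> Prop) u z :
  smooth D u -> D z -> has_partials u z (dx u z) (dy u z).
Proof. intros Hu; apply Ck_partials with 0%nat; auto. Qed.

Lemma smooth_dx (D : C -> Prop) u : smooth D u -> smooth D (dx u).
Proof. intros Hu k; apply (Hu (S k)). Qed.

Lemma smooth_dy (D : C -> Prop) u : smooth D u -> smooth D (dy u).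
Proof. intros Hu k; apply (Hu (S k)). Qed.

Lemma smooth_ext (D : C -> Prop) u v : open D ->
  (forall z, D z -> u z = v z) -> smooth D u -> smooth D v.
Proof. intros HD Huv Hu k; apply Ck_ext with u; auto. Qed.

Lemma smooth_mono (D D' : C -> Prop) u :
  (forall z, D' z -> D z) -> smooth D u -> smooth D' u.
Proof. intros HD Hu k; apply Ck_mono with D; auto. Qed.

Lemma smooth_continuous (D : C -> Prop) u z :
  open D -> smooth D u -> D z -> continuous u z.
Proof. intros HD Hu; apply Ck_continuous with 0%nat; auto. Qed.

Lemma smooth_intro (D : C -> Prop) u ux uy : open D ->
  (forall z, D z -> has_partials u z (ux z) (uy z)) ->
  smooth D ux -> smooth D uy -> smooth D u.
Proof.
intros HD Hp Hx Hy [|k]; [apply Ck_S; auto|]; apply Ck_intro with ux uy; auto.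
Qed.

Lemma smooth_const (D : C -> Prop) c : open D -> smooth D (fun _ => c).
Proof. intros HD k; apply Ck_const; auto. Qed.

Lemma smooth_plus (D : C -> Prop) u v : open D ->
  smooth D u -> smooth D v -> smooth D (fun z => u z + v z).
Proof. intros HD Hu Hv k; apply Ck_plus; auto. Qed.

Lemma smooth_mult (D : C -> Prop) u v : open D ->
  smooth D u -> smooth D v -> smooth D (fun z => u z * v z).
Proof. intros HD Hu Hv k; apply Ck_mult; auto. Qed.

Lemma smooth_opp (D : C -> Prop) u : open D ->
  smooth D u -> smooth D (fun z => - u z).
Proof.
intros HD Hu; apply smooth_ext with (fun z => (-1) * u z); auto.
- intros; ring.
- apply smooth_mult; auto; apply smooth_const; auto.
Qed.

Lemma smooth_minus (D : C -> Prop) u v : open D ->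
  smooth D u -> smooth D v -> smooth D (fun z => u z - v z).
Proof. intros HD Hu Hv; apply smooth_plus; auto; apply smooth_opp; auto. Qed.

Lemma smooth_inv (D : C -> Prop) u : open D ->
  (forall z, D z -> u z <> 0) -> smooth D u -> smooth D (fun z => / u z).
Proof.
intros HD Hu0 Hu k.
assert (Hd : forall z, D z -> is_derive Rinv (u z) ((fun t => - (/ t * / t)) (u z))).
{ intros z Hz; auto_derive; [apply Hu0; auto | field; apply Hu0; auto]. }
induction k as [|k IH].
- apply Ck_comp1_0 with (fun t => - (/ t * / t)); auto.
- apply Ck_comp1 with (fun t => - (/ t * / t)); auto.
  apply Ck_ext with (fun z => (-1) * (/ u z * / u z)); auto; [intros; ring|].
  repeat apply Ck_mult; auto; apply Ck_const; auto.
Qed.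

Lemma smooth_sqrt (D : C -> Prop) u : open D ->
  (forall z, D z -> 0 < u z) -> smooth D u -> smooth D (fun z => sqrt (u z)).
Proof.
intros HD Hu0 Hu k.
assert (Hd : forall z, D z -> is_derive sqrt (u z) ((fun t => sqrt t * (/ 2 * / t)) (u z))).
{ intros z Hz; pose proof (Hu0 z Hz); auto_derive; [lra|].
  pose proof (sqrt_lt_R0 _ H).
  rewrite <- (sqrt_sqrt (u z)) at 3 by lra; field; lra. }
induction k as [|k IH].
- apply Ck_comp1_0 with (fun t => sqrt t * (/ 2 * / t)); auto.
- apply Ck_comp1 with (fun t => sqrt t * (/ 2 * / t)); auto.
  repeat apply Ck_mult; auto; [apply Ck_const; auto|].
  apply smooth_inv; auto; intros z Hz; pose proof (Hu0 z Hz); lra.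
Qed.

Lemma smooth_ln (D : C -> Prop) u : open D ->
  (forall z, D z -> 0 < u z) -> smooth D u -> smooth D (fun z => ln (u z)).
Proof.
intros HD Hu0 Hu k.
assert (Hd : forall z, D z -> is_derive ln (u z) (Rinv (u z))).
{ intros z Hz; pose proof (Hu0 z Hz); auto_derive; [lra | field; lra]. }
destruct k as [|k]; [apply Ck_comp1_0 with Rinv | apply Ck_comp1 with Rinv]; auto.
apply smooth_inv; auto; intros z Hz; pose proof (Hu0 z Hz); lra.
Qed.

Lemma smooth_atan (D : C -> Prop) u : open D ->
  smooth D u -> smooth D (fun z => atan (u z)).
Proof.
intros HD Hu k.
assert (Hd : forall z, D z -> is_derive atan (u z) (/ (1 + u z * u z))).
{ intros z _; apply is_derive_Reals.
  replace (u z * u z) with (u z ^ 2) by ring; apply derivable_pt_lim_atan. }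
destruct k as [|k];
  [apply Ck_comp1_0 with (fun t => / (1 + t * t))
  |apply Ck_comp1 with (fun t => / (1 + t * t))]; auto.
apply (smooth_inv D (fun z => 1 + u z * u z)); auto.
- intros z _; nra.
- apply smooth_plus; [| apply smooth_const | apply smooth_mult]; auto.
Qed.

Lemma has_partials_comp u h1 h2 z p q a1 b1 a2 b2 :
  differentiable_pt_lim (fun s t => u (s, t)) (h1 z) (h2 z) p q ->
  has_partials h1 z a1 b1 -> has_partials h2 z a2 b2 ->
  has_partials (fun w => u (h1 w, h2 w)) z (p * a1 + q * a2) (p * b1 + q * b2).
Proof.
destruct z as [x y]; intros Hd [] []; split; apply is_derive_Reals.
- apply (derivable_pt_lim_comp_2d (fun s t => u (s, t)) (fun t => h1 (t, y))
    (fun t => h2 (t, y)) x); try (apply is_derive_Reals; assumption); exact Hd.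
- apply (derivable_pt_lim_comp_2d (fun s t => u (s, t)) (fun t => h1 (x, t))
    (fun t => h2 (x, t)) y); try (apply is_derive_Reals; assumption); exact Hd.
Qed.

(** By induction on k: the partial derivatives of the composite are sums of
    products of functions that are covered at the previous order. *)
Lemma Ck_comp k : forall (D V : C -> Prop) u h1 h2, open D -> open V ->
  (forall z, D z -> V (h1 z, h2 z)) -> Ck k V u -> Ck k D h1 -> Ck k D h2 ->
  Ck k D (fun z => u (h1 z, h2 z)).
Proof.
induction k as [|k IH]; intros D V u h1 h2 HD HV Hh Hu H1 H2.
- intros z Hz; apply (continuous_comp_2 h1 h2 (fun s t => u (s, t))); auto.
  apply continuous_ext with u; [intros []; auto|]; apply Hu; auto.
- apply Ck_intro with
    (fun z => dx u (h1 z, h2 z) * dx h1 z + dy u (h1 z, h2 z) * dx h2 z)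
    (fun z => dx u (h1 z, h2 z) * dy h1 z + dy u (h1 z, h2 z) * dy h2 z); auto.
  + intros z Hz; apply has_partials_comp; try (eapply Ck_partials; eauto).
    apply (Ck_differentiable _ _ _ _ HV Hu (Hh z Hz)).
  + assert (Hux := proj1 (proj2 Hu)); assert (Huy := proj2 (proj2 Hu)).
    assert (Ck k D h1) by (apply Ck_S; auto); assert (Ck k D h2) by (apply Ck_S; auto).
    apply Ck_plus; auto; apply Ck_mult; auto; try (eapply IH; eauto; fail);
      [apply H1 | apply H2].
  + assert (Hux := proj1 (proj2 Hu)); assert (Huy := proj2 (proj2 Hu)).
    assert (Ck k D h1) by (apply Ck_S; auto); assert (Ck k D h2) by (apply Ck_S; auto).
    apply Ck_plus; auto; apply Ck_mult; auto; try (eapply IH; eauto; fail);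
      [apply H1 | apply H2].
Qed.

Lemma smooth_schwarz (D : C -> Prop) u z : open D -> smooth D u -> D z ->
  dx (dy u) z = dy (dx u) z.
Proof.
intros HD Hu Hz; destruct z as [x y].
apply (Schwarz (fun s t => u (s, t)) x y).
- apply locally_2d_locally; apply filter_imp with (2 := HD (x, y) Hz).
  intros [s t] Hst; simpl.
  destruct (smooth_partials D u (s, t) Hu Hst).
  destruct (smooth_partials D _ (s, t) (smooth_dy _ _ Hu) Hst).
  destruct (smooth_partials D _ (s, t) (smooth_dx _ _ Hu) Hst).
  repeat split; eexists; eassumption.
- apply continuity_2d_pt_filterlim.
  apply continuous_ext with (dx (dy u)); [intros []; auto|].
  apply smooth_continuous with D; auto; apply smooth_dx, smooth_dy; auto.
- apply continuity_2d_pt_filterlim.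
  apply continuous_ext with (dy (dx u)); [intros []; auto|].
  apply smooth_continuous with D; auto; apply smooth_dy, smooth_dx; auto.
Qed.

(** * Wirtinger calculus *)

Definition dzb (u : C -> C) (z : C) : C := (/ 2 * (dxC u z + Ci * dyC u z))%C.

(** [a] and [b] are the derivatives of u with respect to z and its conjugate; in
    terms of them u_x = a + b and u_y = i (a - b).  As a relation, it carries the
    differentiability of u along with the values of the derivatives. *)
Definition wirt (u : C -> C) (z a b : C) : Prop :=
  has_partials (fun w => Re (u w)) z (Re (a + b)) (Re (Ci * (a - b))) /\
  has_partials (fun w => Im (u w)) z (Im (a + b)) (Im (Ci * (a - b))).

Lemma C_eq (z w : C) : Re z = Re w -> Im z = Im w -> z = w.
Proof. apply injective_projections. Qed.

Lemma Cmult_cancel_l (u a b : C) : u <> 0 -> (u * a = u * b)%C -> a = b.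
Proof.
intros Hu E; replace a with (/ u * (u * a))%C by (field; auto).
rewrite E; field; auto.
Qed.

Lemma has_partials_eq u z a b a' b' :
  has_partials u z a b -> a = a' -> b = b' -> has_partials u z a' b'.
Proof. intros; subst; assumption. Qed.

Lemma wirt_unique u z a b : wirt u z a b -> dz u z = a /\ dzb u z = b.
Proof.
intros [H1 H2]; apply has_partials_unique in H1, H2.
destruct H1 as [E1 E2], H2 as [E3 E4]; unfold dz, dzb, dxC, dyC.
rewrite E1, E2, E3, E4; split; apply C_eq; unfold Re, Im; simpl; field.
Qed.

Lemma smoothC_wirt D u z : smoothC D u -> D z -> wirt u z (dz u z) (dzb u z).
Proof.
intros [H1 H2] Hz; split.
- eapply has_partials_eq; [exact (smooth_partials _ _ _ H1 Hz) | |];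
    unfold dz, dzb, dxC, dyC; unfold Re, Im; simpl; field.
- eapply has_partials_eq; [exact (smooth_partials _ _ _ H2 Hz) | |];
    unfold dz, dzb, dxC, dyC; unfold Re, Im; simpl; field.
Qed.

Lemma wirt_ext_loc (D : C -> Prop) u v z a b : open D -> D z ->
  (forall w, D w -> u w = v w) -> wirt u z a b -> wirt v z a b.
Proof.
intros HD Hz Huv [H1 H2]; split.
- apply has_partials_ext_loc with (4 := H1) (D := D); auto.
  intros w Hw; rewrite Huv; auto.
- apply has_partials_ext_loc with (4 := H2) (D := D); auto.
  intros w Hw; rewrite Huv; auto.
Qed.

Lemma wirt_const c z : wirt (fun _ => c) z 0 0.
Proof.
split; (eapply has_partials_eq;
  [split; apply @is_derive_const | |]); simpl; unfold zero; unfold Re, Im; simpl; ring.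
Qed.

Lemma has_partials_Re z : has_partials (fun w => Re w) z 1 0.
Proof.
split; [exact (is_derive_id (K := R_AbsRing) (Re z))|].
exact (is_derive_const (K := R_AbsRing) (V := R_NormedModule) (Re z) (Im z)).
Qed.

Lemma has_partials_Im z : has_partials (fun w => Im w) z 0 1.
Proof.
split; [|exact (is_derive_id (K := R_AbsRing) (Im z))].
exact (is_derive_const (K := R_AbsRing) (V := R_NormedModule) (Im z) (Re z)).
Qed.

Lemma wirt_id z : wirt (fun w => w) z 1 0.
Proof.
split; eapply has_partials_eq;
  [apply has_partials_Re | | | apply has_partials_Im | |];
  unfold Re, Im; simpl; ring.
Qed.

Lemma wirt_plus u v z a b c d : wirt u z a b -> wirt v z c d ->
  wirt (fun w => u w + v w)%C z (a + c) (b + d).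
Proof.
intros [H1 H2] [H3 H4]; split.
- eapply has_partials_eq; [exact (has_partials_plus _ _ _ _ _ _ _ H1 H3)| |];
    unfold Re, Im; simpl; ring.
- eapply has_partials_eq; [exact (has_partials_plus _ _ _ _ _ _ _ H2 H4)| |];
    unfold Re, Im; simpl; ring.
Qed.

Lemma has_partials_scal c u z a b : has_partials u z a b ->
  has_partials (fun w => c * u w) z (c * a) (c * b).
Proof.
intros []; split.
- apply (is_derive_scal (fun t => u (t, Im z))); auto.
- apply (is_derive_scal (fun t => u (Re z, t))); auto.
Qed.

Lemma wirt_mult u v z a b c d : wirt u z a b -> wirt v z c d ->
  wirt (fun w => u w * v w)%C z (a * v z + u z * c) (b * v z + u z * d).
Proof.
intros [H1 H2] [H3 H4].
pose proof (has_partials_mult _ _ _ _ _ _ _ H1 H3) as Hrr.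
pose proof (has_partials_mult _ _ _ _ _ _ _ H2 H4) as Hii.
pose proof (has_partials_mult _ _ _ _ _ _ _ H1 H4) as Hri.
pose proof (has_partials_mult _ _ _ _ _ _ _ H2 H3) as Hir.
split.
- apply (has_partials_scal (-1)) in Hii.
  eapply has_partials_eq.
  + eapply has_partials_ext_loc; [apply open_true | exact I | |
      exact (has_partials_plus _ _ _ _ _ _ _ Hrr Hii)].
    intros w _; unfold Re, Im; simpl; ring.
  + unfold Re, Im; simpl; ring.
  + unfold Re, Im; simpl; ring.
- eapply has_partials_eq; [exact (has_partials_plus _ _ _ _ _ _ _ Hri Hir)| |];
    unfold Re, Im; simpl; ring.
Qed.

Lemma wirt_conj u z a b : wirt u z a b ->
  wirt (fun w => Cconj (u w)) z (Cconj b) (Cconj a).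
Proof.
intros [H1 H2]; split.
- eapply has_partials_eq; [exact H1| |]; unfold Re, Im; simpl; ring.
- apply (has_partials_scal (-1)) in H2.
  eapply has_partials_eq.
  + eapply has_partials_ext_loc; [apply open_true | exact I | | exact H2].
    intros w _; unfold Re, Im; simpl; ring.
  + unfold Re, Im; simpl; ring.
  + unfold Re, Im; simpl; ring.
Qed.

Lemma wirt_eq u z a b a' b' : wirt u z a b -> a = a' -> b = b' -> wirt u z a' b'.
Proof. intros; subst; assumption. Qed.

Lemma wirt_scal c u z a b : wirt u z a b -> wirt (fun w => c * u w)%C z (c * a) (c * b).
Proof.
intros H; eapply wirt_eq; [apply (wirt_mult _ _ _ _ _ _ _ (wirt_const c z) H)| |]; ring.
Qed.

Lemma wirt_opp u z a b : wirt u z a b -> wirt (fun w => - u w)%C z (- a) (- b).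
Proof.
intros H; apply (wirt_scal (-1)%C) in H.
eapply wirt_eq; [eapply wirt_ext_loc; [apply open_true | exact I | | exact H]| |];
  intros; simpl; ring.
Qed.

Lemma wirt_minus u v z a b c d : wirt u z a b -> wirt v z c d ->
  wirt (fun w => u w - v w)%C z (a - c) (b - d).
Proof.
intros H1 H2; apply (wirt_scal (-1)%C) in H2.
eapply wirt_eq; [eapply wirt_ext_loc; [apply open_true | exact I | |
  exact (wirt_plus _ _ _ _ _ _ _ H1 H2)]| |]; intros; unfold Re, Im; simpl; ring.
Qed.

Lemma wirt_sqr u z a b : wirt u z a b ->
  wirt (fun w => u w ^ 2)%C z (2 * u z * a) (2 * u z * b).
Proof.
intros H; eapply wirt_eq; [eapply wirt_ext_loc; [apply open_true | exact I | |
  exact (wirt_mult _ _ _ _ _ _ _ H H)]| |]; intros; unfold Re, Im; simpl; ring.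
Qed.

Lemma smoothC_ext (D : C -> Prop) u v : open D ->
  (forall z, D z -> u z = v z) -> smoothC D u -> smoothC D v.
Proof.
intros HD Huv [H1 H2]; split.
- apply smooth_ext with (fun z => Re (u z)); auto; intros z Hz; rewrite Huv; auto.
- apply smooth_ext with (fun z => Im (u z)); auto; intros z Hz; rewrite Huv; auto.
Qed.

Lemma smoothC_mono (D D' : C -> Prop) u :
  (forall z, D' z -> D z) -> smoothC D u -> smoothC D' u.
Proof. intros HD []; split; eapply smooth_mono; eauto. Qed.

Lemma smoothC_const (D : C -> Prop) c : open D -> smoothC D (fun _ => c).
Proof. intros HD; split; apply smooth_const; auto. Qed.

Lemma smoothC_RtoC (D : C -> Prop) u : open D ->
  smooth D u -> smoothC D (fun z => RtoC (u z)).
Proof. intros HD; split; auto; apply (smooth_const D 0); auto. Qed.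

Lemma smoothC_plus (D : C -> Prop) u v : open D ->
  smoothC D u -> smoothC D v -> smoothC D (fun z => u z + v z)%C.
Proof.
intros HD [] []; split.
- apply (smooth_plus D (fun z => Re (u z)) (fun z => Re (v z))); auto.
- apply (smooth_plus D (fun z => Im (u z)) (fun z => Im (v z))); auto.
Qed.

Lemma smoothC_opp (D : C -> Prop) u : open D ->
  smoothC D u -> smoothC D (fun z => - u z)%C.
Proof.
intros HD []; split.
- apply (smooth_opp D (fun z => Re (u z))); auto.
- apply (smooth_opp D (fun z => Im (u z))); auto.
Qed.

Lemma smoothC_minus (D : C -> Prop) u v : open D ->
  smoothC D u -> smoothC D v -> smoothC D (fun z => u z - v z)%C.
Proof. intros; apply smoothC_plus; auto; apply smoothC_opp; auto. Qed.

Lemma smoothC_conj (D : C -> Prop) u : open D ->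
  smoothC D u -> smoothC D (fun z => Cconj (u z)).
Proof.
intros HD []; split; auto.
apply (smooth_opp D (fun z => Im (u z))); auto.
Qed.

Lemma smoothC_mult (D : C -> Prop) u v : open D ->
  smoothC D u -> smoothC D v -> smoothC D (fun z => u z * v z)%C.
Proof.
intros HD [] []; split.
- apply (smooth_minus D (fun z => Re (u z) * Re (v z)) (fun z => Im (u z) * Im (v z)));
    auto; apply smooth_mult; auto.
- apply (smooth_plus D (fun z => Re (u z) * Im (v z)) (fun z => Im (u z) * Re (v z)));
    auto; apply smooth_mult; auto.
Qed.

Lemma smoothC_sqr (D : C -> Prop) u : open D ->
  smoothC D u -> smoothC D (fun z => u z ^ 2)%C.
Proof.
intros HD Hu; apply smoothC_ext with (fun z => u z * u z)%C; auto.
- intros; ring.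
- apply smoothC_mult; auto.
Qed.

Lemma C_norm2_pos (z : C) : z <> RtoC 0 -> 0 < Re z * Re z + Im z * Im z.
Proof.
intros Hz; destruct z as [x y]; simpl.
destruct (Req_dec x 0) as [->|]; [destruct (Req_dec y 0) as [->|]|]; try nra.
now elim Hz.
Qed.

Lemma smoothC_inv (D : C -> Prop) (u : C -> C) : open D ->
  (forall z, D z -> u z <> RtoC 0) -> smoothC D u -> smoothC D (fun z => / u z)%C.
Proof.
intros HD Hu0 [H1 H2].
assert (Hi : smooth D (fun z => / (Re (u z) * Re (u z) + Im (u z) * Im (u z)))).
{ apply smooth_inv; auto.
  - intros z Hz; pose proof (C_norm2_pos _ (Hu0 z Hz)); lra.
  - apply smooth_plus; auto; apply smooth_mult; auto. }
split.
- apply smooth_ext with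
    (fun z => Re (u z) * / (Re (u z) * Re (u z) + Im (u z) * Im (u z))); auto.
  + intros z Hz; pose proof (C_norm2_pos _ (Hu0 z Hz)); unfold Re, Im in *; simpl; field; lra.
  + apply smooth_mult; auto.
- apply smooth_ext with
    (fun z => - Im (u z) * / (Re (u z) * Re (u z) + Im (u z) * Im (u z))); auto.
  + intros z Hz; pose proof (C_norm2_pos _ (Hu0 z Hz)); unfold Re, Im in *; simpl; field; lra.
  + apply smooth_mult; auto; apply smooth_opp; auto.
Qed.

Lemma smoothC_dz (D : C -> Prop) u : open D -> smoothC D u -> smoothC D (dz u).
Proof.
intros HD [H1 H2]; apply smoothC_mult; auto; [apply smoothC_const; auto|].
apply smoothC_minus; auto; [split; apply smooth_dx; auto|].
apply smoothC_mult; auto; [apply smoothC_const; auto | split; apply smooth_dy; auto].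
Qed.

Lemma smoothC_comp (D V : C -> Prop) u h : open D -> open V ->
  (forall z, D z -> V (h z)) -> smoothC V u -> smoothC D h ->
  smoothC D (fun z => u (h z)).
Proof.
intros HD HV Hh [H1 H2] [H3 H4].
assert (E : forall z, h z = (Re (h z), Im (h z))) by (intros; destruct (h z); auto).
split.
- apply smooth_ext with (fun z => Re (u (Re (h z), Im (h z)))); auto.
  + intros; rewrite <- E; auto.
  + intros k; apply (Ck_comp k D V (fun w => Re (u w))); auto.
    intros; rewrite <- E; auto.
- apply smooth_ext with (fun z => Im (u (Re (h z), Im (h z)))); auto.
  + intros; rewrite <- E; auto.
  + intros k; apply (Ck_comp k D V (fun w => Im (u w))); auto.
    intros; rewrite <- E; auto.
Qed.

(** The inner map h is holomorphic, so no mixed terms appear. *)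
Lemma wirt_comp (V : C -> Prop) u h z c : open V -> V (h z) -> smoothC V u ->
  wirt h z c 0 ->
  wirt (fun w => u (h w)) z (dz u (h z) * c) (dzb u (h z) * Cconj c).
Proof.
intros HV Hh [H1 H2] [H3 H4].
assert (E : forall w, u (h w) = u (Re (h w), Im (h w)))
  by (intros w; destruct (h w); auto).
pose proof (Ck_differentiable _ _ _ _ HV (H1 1%nat) Hh) as D1.
pose proof (Ck_differentiable _ _ _ _ HV (H2 1%nat) Hh) as D2.
assert (P1 := has_partials_comp (fun w => Re (u w)) _ _ z _ _ _ _ _ _ D1 H3 H4).
assert (P2 := has_partials_comp (fun w => Im (u w)) _ _ z _ _ _ _ _ _ D2 H3 H4).
split.
- eapply has_partials_eq; [eapply has_partials_ext_loc;
    [apply open_true | exact I | | exact P1]| |].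
  + intros w _; simpl; now rewrite E.
  + unfold dz, dzb, dxC, dyC; unfold Re, Im; simpl; field.
  + unfold dz, dzb, dxC, dyC; unfold Re, Im; simpl; field.
- eapply has_partials_eq; [eapply has_partials_ext_loc;
    [apply open_true | exact I | | exact P2]| |].
  + intros w _; simpl; now rewrite E.
  + unfold dz, dzb, dxC, dyC; unfold Re, Im; simpl; field.
  + unfold dz, dzb, dxC, dyC; unfold Re, Im; simpl; field.
Qed.

Lemma dxC_wirt u z a b : wirt u z a b -> dxC u z = (a + b)%C /\ dyC u z = (Ci * (a - b))%C.
Proof.
intros [H1 H2]; apply has_partials_unique in H1, H2; unfold dxC, dyC.
destruct H1 as [-> ->], H2 as [-> ->]; split; apply C_eq; reflexivity.
Qed.

Lemma dzb_dz_comm (D : C -> Prop) u z : open D -> smoothC D u -> D z ->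
  dzb (dz u) z = dz (dzb u) z.
Proof.
intros HD [H1 H2] Hz.
assert (Sx : smoothC D (dxC u)) by (split; apply smooth_dx; auto).
assert (Sy : smoothC D (dyC u)) by (split; apply smooth_dy; auto).
assert (E : dyC (dxC u) z = dxC (dyC u) z).
{ apply C_eq; symmetry; apply smooth_schwarz with D; auto. }
pose proof (smoothC_wirt _ _ _ Sx Hz) as Wx.
pose proof (smoothC_wirt _ _ _ Sy Hz) as Wy.
assert (Wd : wirt (dz u) z (/ 2 * (dz (dxC u) z - Ci * dz (dyC u) z))
                           (/ 2 * (dzb (dxC u) z - Ci * dzb (dyC u) z))).
{ apply wirt_scal, wirt_minus, wirt_scal; auto. }
assert (Wb : wirt (dzb u) z (/ 2 * (dz (dxC u) z + Ci * dz (dyC u) z))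
                           (/ 2 * (dzb (dxC u) z + Ci * dzb (dyC u) z))).
{ apply wirt_scal, wirt_plus, wirt_scal; auto. }
apply wirt_unique in Wd, Wb; destruct Wd as [_ ->], Wb as [-> _].
unfold dz, dzb; rewrite E; field.
Qed.

Lemma laplacian_wirt (D : C -> Prop) u z : open D -> smoothC D u -> D z ->
  laplacian u z = (4 * dzb (dz u) z)%C.
Proof.
intros HD [H1 H2] Hz.
assert (Sx : smoothC D (dxC u)) by (split; apply smooth_dx; auto).
assert (Sy : smoothC D (dyC u)) by (split; apply smooth_dy; auto).
assert (E : dyC (dxC u) z = dxC (dyC u) z).
{ apply C_eq; symmetry; apply smooth_schwarz with D; auto. }
pose proof (smoothC_wirt _ _ _ Sx Hz) as Wx.
pose proof (smoothC_wirt _ _ _ Sy Hz) as Wy.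
assert (Wd : wirt (dz u) z (/ 2 * (dz (dxC u) z - Ci * dz (dyC u) z))
                           (/ 2 * (dzb (dxC u) z - Ci * dzb (dyC u) z))).
{ apply wirt_scal, wirt_minus, wirt_scal; auto. }
apply wirt_unique in Wd; destruct Wd as [_ ->].
unfold dzb, laplacian; rewrite E.
apply C_eq; unfold Re, Im; simpl; field.
Qed.

(** * The maximum norm on the plane *)

(** The balls of the plane, as a product of two lines, are squares; the maximum
    norm is the one that they define. *)
Definition nrm (z : C) : R := Rmax (Rabs (Re z)) (Rabs (Im z)).

Lemma nrm_lt z e : nrm z < e <-> Rabs (Re z) < e /\ Rabs (Im z) < e.
Proof.
unfold nrm; split; [intros H | intros []; apply Rmax_lub_lt; auto].
pose proof (Rmax_l (Rabs (Re z)) (Rabs (Im z))).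
pose proof (Rmax_r (Rabs (Re z)) (Rabs (Im z))); lra.
Qed.

Lemma nrm_le z e : nrm z <= e <-> Rabs (Re z) <= e /\ Rabs (Im z) <= e.
Proof.
unfold nrm; split; [intros H | intros []; apply Rmax_lub; auto].
pose proof (Rmax_l (Rabs (Re z)) (Rabs (Im z))).
pose proof (Rmax_r (Rabs (Re z)) (Rabs (Im z))); lra.
Qed.

Lemma nrm_Re z : Rabs (Re z) <= nrm z. Proof. apply Rmax_l. Qed.
Lemma nrm_Im z : Rabs (Im z) <= nrm z. Proof. apply Rmax_r. Qed.

Lemma nrm_ge0 z : 0 <= nrm z.
Proof. pose proof (nrm_Re z); pose proof (Rabs_pos (Re z)); lra. Qed.

Lemma nrm_triang z w : nrm (z + w)%C <= nrm z + nrm w.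
Proof.
pose proof (nrm_Re z); pose proof (nrm_Re w).
pose proof (nrm_Im z); pose proof (nrm_Im w).
apply nrm_le; simpl; split;
  (eapply Rle_trans; [apply Rabs_triang | unfold Re, Im in *; lra]).
Qed.

Lemma nrm_opp z : nrm (- z)%C = nrm z.
Proof. unfold nrm; simpl; rewrite !Rabs_Ropp; reflexivity. Qed.

Lemma nrm_sym z w : nrm (z - w)%C = nrm (w - z)%C.
Proof. rewrite <- nrm_opp; f_equal; ring. Qed.

Lemma nrm_mult z w : nrm (z * w)%C <= 2 * nrm z * nrm w.
Proof.
pose proof (nrm_Re z); pose proof (nrm_Re w).
pose proof (nrm_Im z); pose proof (nrm_Im w).
assert (Hm : forall a b, Rabs a <= nrm z -> Rabs b <= nrm w ->
  Rabs (a * b) <= nrm z * nrm w).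
{ intros a b Ha Hb; rewrite Rabs_mult.
  apply Rmult_le_compat; auto; apply Rabs_pos. }
apply nrm_le; simpl; split.
- unfold Rminus; eapply Rle_trans; [apply Rabs_triang|]; rewrite Rabs_Ropp.
  pose proof (Hm _ _ H H0); pose proof (Hm _ _ H1 H2); unfold Re, Im in *; lra.
- eapply Rle_trans; [apply Rabs_triang|].
  pose proof (Hm _ _ H H2); pose proof (Hm _ _ H1 H0); unfold Re, Im in *; lra.
Qed.

Lemma nrm_0 z : nrm z <= 0 -> z = 0.
Proof.
intros H; pose proof (nrm_Re z); pose proof (nrm_Im z).
apply C_eq; simpl; apply Rabs_eq_0;
  pose proof (Rabs_pos (Re z)); pose proof (Rabs_pos (Im z)); lra.
Qed.

Lemma ball_nrm (z w : C) (e : posreal) : ball z e w <-> nrm (w - z)%C < e.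
Proof. rewrite nrm_lt; reflexivity. Qed.

Lemma open_nrm (D : C -> Prop) z : open D -> D z ->
  exists e, 0 < e /\ forall w, nrm (w - z)%C < e -> D w.
Proof.
intros HD Hz; destruct (HD z Hz) as [e He]; exists e; split; [apply cond_pos|].
intros w Hw; apply He, ball_nrm; auto.
Qed.

Lemma locally_nrm (P : C -> Prop) z e : 0 < e ->
  (forall w, nrm (w - z)%C < e -> P w) -> locally z P.
Proof.
intros He HP; exists (mkposreal e He); intros w Hw; apply HP.
exact (proj1 (ball_nrm z w (mkposreal e He)) Hw).
Qed.

Definition square (p : C) (e : R) : C -> Prop := fun z => nrm (z - p)%C < e.

Lemma open_square p e : open (square p e).
Proof.
intros z Hz; apply locally_nrm with (e - nrm (z - p)%C); unfold square in *; [lra|].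
intros w Hw; replace (w - p)%C with ((w - z) + (z - p))%C by ring.
pose proof (nrm_triang (w - z)%C (z - p)%C); lra.
Qed.

Lemma square_center p e : 0 < e -> square p e p.
Proof.
intros He; unfold square; apply nrm_lt; simpl; rewrite !Rplus_opp_r, Rabs_R0; auto.
Qed.

Lemma continuous_nrm (u : C -> R) z e : continuous u z -> 0 < e ->
  exists d, 0 < d /\ forall w, nrm (w - z)%C < d -> Rabs (u w - u z) < e.
Proof.
intros Hu He; specialize (Hu _ (locally_ball (u z) (mkposreal e He))).
destruct Hu as [d Hd]; exists d; split; [apply cond_pos|].
intros w Hw; apply Hd, ball_nrm; auto.
Qed.

Lemma smoothC_nrm (D : C -> Prop) u z e : open D -> smoothC D u -> D z -> 0 < e ->
  exists d, 0 < d /\ forall w, nrm (w - z)%C < d -> D w /\ nrm (u w - u z)%C < e.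
Proof.
intros HD [H1 H2] Hz He.
destruct (continuous_nrm _ _ _ (smooth_continuous _ _ _ HD H1 Hz) He) as (d1 & Hd1 & C1).
destruct (continuous_nrm _ _ _ (smooth_continuous _ _ _ HD H2 Hz) He) as (d2 & Hd2 & C2).
destruct (open_nrm _ _ HD Hz) as (d3 & Hd3 & C3).
exists (Rmin d1 (Rmin d2 d3)); split; [repeat apply Rmin_pos; auto|].
intros w Hw; pose proof (Rmin_l d1 (Rmin d2 d3)); pose proof (Rmin_r d1 (Rmin d2 d3)).
pose proof (Rmin_l d2 d3); pose proof (Rmin_r d2 d3).
split; [apply C3; lra|]; apply nrm_lt; split; [apply C1 | apply C2]; lra.
Qed.

(** * Square roots of nonvanishing functions *)

Lemma C_sqrt_ex (c : C) : exists r : C, (r ^ 2)%C = c.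
Proof.
destruct c as [x y].
set (m := sqrt (x * x + y * y)).
assert (Hm : m * m = x * x + y * y) by (apply sqrt_sqrt; nra).
assert (Hm0 : 0 <= m) by apply sqrt_pos.
assert (Hx : Rabs x <= m) by (apply Rsqr_incr_0_var; auto; rewrite <- Rsqr_abs; unfold Rsqr; nra).
apply Rabs_le_between in Hx.
set (a := sqrt ((m + x) / 2)); set (b := sqrt ((m - x) / 2)).
assert (Ha : a * a = (m + x) / 2) by (apply sqrt_sqrt; lra).
assert (Hb : b * b = (m - x) / 2) by (apply sqrt_sqrt; lra).
assert (Ha0 : 0 <= a) by apply sqrt_pos.
assert (Hb0 : 0 <= b) by apply sqrt_pos.
assert (Hab : (2 * a * b) * (2 * a * b) = y * y).
{ replace (2 * a * b * (2 * a * b)) with (4 * (a * a) * (b * b)) by ring.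
  rewrite Ha, Hb; lra. }
assert (Hab0 : 0 <= 2 * a * b) by (apply Rmult_le_pos; [lra|auto]).
destruct (Rle_dec 0 y).
- exists (a, b); apply C_eq; simpl; [lra|].
  assert (2 * a * b = y) by (apply Rsqr_inj; auto); lra.
- exists (a, - b); apply C_eq; simpl; [lra|].
  assert (2 * a * b = - y) by (apply Rsqr_inj; auto; unfold Rsqr; lra); lra.
Qed.

(** The principal root s + i t of u + i v is given by s^2 = (|u + i v| + u) / 2
    and t = v / (2 s), with s > 0 in the right half plane. *)
Lemma smooth_sqrt_halfplane (D : C -> Prop) (G : C -> C) : open D -> smoothC D G ->
  (forall z, D z -> 0 < Re (G z)) ->
  exists r, smoothC D r /\ forall z, D z -> (r z ^ 2)%C = G z.
Proof.
intros HD [H1 H2] HG.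
set (m z := sqrt (Re (G z) * Re (G z) + Im (G z) * Im (G z))).
set (s z := sqrt (/ 2 * (m z + Re (G z)))).
assert (Hm0 : forall z, 0 <= m z) by (intros; apply sqrt_pos).
assert (Sm : smooth D m).
{ apply smooth_sqrt; auto.
  - intros z Hz; pose proof (HG z Hz); pose proof (Rle_0_sqr (Im (G z))); unfold Rsqr in *; nra.
  - apply smooth_plus; auto; apply smooth_mult; auto. }
assert (Ss : smooth D s).
{ apply smooth_sqrt; auto.
  - intros z Hz; pose proof (HG z Hz); pose proof (Hm0 z); lra.
  - apply smooth_mult; auto; [apply smooth_const; auto | apply smooth_plus; auto]. }
assert (Hs : forall z, D z -> 0 < s z).
{ intros z Hz; apply sqrt_lt_R0; pose proof (HG z Hz); pose proof (Hm0 z); lra. }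
exists (fun z => (s z, Im (G z) * / (2 * s z))); split.
- split; simpl; auto; apply smooth_mult; auto; apply smooth_inv; auto.
  + intros z Hz; pose proof (Hs z Hz); lra.
  + apply smooth_mult; auto; apply smooth_const; auto.
- intros z Hz; pose proof (HG z Hz) as Hu; pose proof (Hs z Hz) as Hs'.
  assert (Hmm : m z * m z = Re (G z) * Re (G z) + Im (G z) * Im (G z))
    by (apply sqrt_sqrt; nra).
  assert (Hss : s z * s z = / 2 * (m z + Re (G z)))
    by (apply sqrt_sqrt; pose proof (Hm0 z); lra).
  pose proof (Hm0 z).
  apply C_eq; simpl.
  + replace (_ - _) with (s z * s z - Im (G z) * Im (G z) / (4 * (s z * s z)))
      by (field; lra).
    replace (Im (G z) * Im (G z)) with (m z * m z - Re (G z) * Re (G z)) by lra.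
    rewrite Hss; field; lra.
  + field; lra.
Qed.

(** F / F(p) is close to 1, hence in the right half plane, near p. *)
Lemma smooth_sqrt_local (D : C -> Prop) (F : C -> C) p : open D -> D p ->
  smoothC D F -> F p <> 0 ->
  exists e r, 0 < e /\ (forall z, square p e z -> D z) /\
    smoothC (square p e) r /\ forall z, square p e z -> (r z ^ 2)%C = F z.
Proof.
intros HD Hp HF HFp.
set (G := fun z => (/ F p * F z)%C).
assert (HG : smoothC D G) by (apply smoothC_mult; auto; apply smoothC_const; auto).
assert (Gp : G p = 1) by (unfold G; field; auto).
destruct (smoothC_nrm D G p 1 HD HG Hp ltac:(lra)) as (e & He & H).
assert (HDe : forall z, square p e z -> D z) by (intros z Hz; apply H; auto).
destruct (smooth_sqrt_halfplane (square p e) G) as (r & Hr & Er).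
- apply open_square.
- apply smoothC_mono with D; auto.
- intros z Hz; destruct (H z Hz) as [_ Hn]; rewrite Gp in Hn.
  apply nrm_lt in Hn; destruct Hn as [Hn _]; apply Rabs_lt_between in Hn.
  change (- (1) < Re (G z) - 1 < 1) in Hn; lra.
- destruct (C_sqrt_ex (F p)) as [c Hc].
  exists e, (fun z => (c * r z)%C); repeat split; auto.
  + apply (smoothC_mult (square p e) (fun _ => c) r); auto using open_square, smoothC_const.
  + apply (smoothC_mult (square p e) (fun _ => c) r); auto using open_square, smoothC_const.
  + intros z Hz; replace ((c * r z) ^ 2)%C with (c ^ 2 * r z ^ 2)%C by ring.
    rewrite Hc, Er by auto; unfold G; field; auto.
Qed.

(** * Connectedness of squares *)

(** Join a point of A to a point of B by a segment; at the supremum of the times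
    spent in A both open sets are met. *)
Lemma square_connected p e : connected_set (square p e).
Proof.
intros A B HA HB Hcov (a & Ha & Aa) (b & Hb & Bb).
apply NNPP; intros Hno.
set (g := fun t : R => ((1 - t) * a + t * b)%C).
assert (Hg : forall t, 0 <= t <= 1 -> square p e (g t)).
{ intros t Ht; unfold square, g in *; apply nrm_lt in Ha, Hb; apply nrm_lt.
  destruct Ha as [Ha1 Ha2], Hb as [Hb1 Hb2].
  assert (Hconv : forall u v, Rabs u < e -> Rabs v < e ->
    Rabs ((1 - t) * u + t * v) < e).
  { intros u v Hu Hv; apply Rabs_def2 in Hu, Hv.
    destruct (Req_dec t 0) as [-> | Ht0]; [apply Rabs_def1; lra|].
    assert (0 < t) by lra.
    assert (t * v < t * e) by (apply Rmult_lt_compat_l; lra).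
    assert (t * (- e) < t * v) by (apply Rmult_lt_compat_l; lra).
    assert ((1 - t) * u <= (1 - t) * e) by (apply Rmult_le_compat_l; lra).
    assert ((1 - t) * (- e) <= (1 - t) * u) by (apply Rmult_le_compat_l; lra).
    apply Rabs_def1; lra. }
  split; [pose proof (Hconv _ _ Ha1 Hb1) as Hc | pose proof (Hconv _ _ Ha2 Hb2) as Hc];
    eapply Rle_lt_trans; [|exact Hc| |exact Hc]; right; f_equal;
    unfold Re, Im; simpl; ring. }
assert (Hcont : forall t d, 0 < d ->
  exists d', 0 < d' /\ forall s, Rabs (s - t) < d' -> nrm (g s - g t)%C < d).
{ intros t d Hd; set (M := 1 + nrm (b - a)%C).
  assert (HM : 0 < M) by (pose proof (nrm_ge0 (b - a)%C); unfold M; lra).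
  exists (d / (2 * M)); split; [apply Rdiv_lt_0_compat; lra|].
  intros s Hs; replace (g s - g t)%C with (RtoC (s - t) * (b - a))%C
    by (unfold g; apply C_eq; unfold Re, Im; simpl; ring).
  eapply Rle_lt_trans; [apply nrm_mult|].
  assert (E : nrm (RtoC (s - t)) = Rabs (s - t)).
  { unfold nrm; simpl; rewrite Rabs_R0; apply Rmax_left, Rabs_pos. }
  rewrite E.
  assert (Rabs (s - t) * (2 * M) < d).
  { apply Rmult_lt_reg_r with (/ (2 * M)); [apply Rinv_0_lt_compat; lra|].
    rewrite Rmult_assoc, Rinv_r by lra; lra. }
  pose proof (Rabs_pos (s - t)); unfold M in *; nra. }
set (E := fun t => 0 <= t <= 1 /\ A (g t)).
destruct (completeness E) as [s [Hub Hlub]].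
- exists 1; intros t [Ht _]; lra.
- exists 0; split; [lra|].
  replace (g 0) with a; auto; unfold g; apply C_eq; unfold Re, Im; simpl; ring.
- assert (E0 : E 0).
  { split; [lra|]; replace (g 0) with a; auto; unfold g; apply C_eq; unfold Re, Im; simpl; ring. }
  assert (Hs : 0 <= s <= 1).
  { split; [apply Hub; auto|]; apply Hlub; intros t [Ht _]; lra. }
  destruct (Hcov (g s) (Hg s Hs)) as [As | Bs].
  + destruct (Req_dec s 1) as [-> | Hs1].
    * apply Hno; exists b; repeat split; auto.
      replace b with (g 1); auto; unfold g; apply C_eq; unfold Re, Im; simpl; ring.
    * destruct (open_nrm _ _ HA As) as (d & Hd & HAd).
      destruct (Hcont s d Hd) as (d' & Hd' & Hc).
      set (t := s + Rmin (d' / 2) (1 - s)).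
      pose proof (Rmin_l (d' / 2) (1 - s)); pose proof (Rmin_r (d' / 2) (1 - s)).
      assert (0 < Rmin (d' / 2) (1 - s)) by (apply Rmin_pos; lra).
      assert (t <= s); [apply Hub | unfold t in *; lra].
      split; [unfold t; lra|]; apply HAd, Hc.
      replace (t - s) with (Rmin (d' / 2) (1 - s)) by (unfold t; ring).
      rewrite Rabs_pos_eq; lra.
  + destruct (open_nrm _ _ HB Bs) as (d & Hd & HBd).
    destruct (Hcont s d Hd) as (d' & Hd' & Hc).
    assert (Hex : exists t, E t /\ s - d' < t).
    { apply NNPP; intros Hn.
      assert (s <= s - d'); [apply Hlub | lra].
      intros t Et; apply Rnot_lt_le; intros Hlt; apply Hn; exists t; auto. }
    destruct Hex as (t & Et & Hst); pose proof (Hub t Et) as Hts; destruct Et as [Ht At].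
    apply Hno; exists (g t); repeat split; auto.
    apply HBd, Hc; rewrite Rabs_left1; lra.
Qed.

(** * Local inversion of holomorphic functions *)

(** The sequence is the sum of an absolutely convergent telescoping series. *)
Lemma cauchy_geometric_lim (u : nat -> R) r :
  (forall n, Rabs (u (S n) - u n) <= r * (/ 2) ^ n) ->
  exists l : R, is_lim_seq u l.
Proof.
intros Hu.
assert (Hex : ex_series (fun n => u (S n) - u n)).
{ apply (ex_series_le (K := R_AbsRing) (V := R_CompleteNormedModule))
    with (fun n => r * (/ 2) ^ n); [exact Hu|].
  apply (ex_series_scal_l r (fun n => (/ 2) ^ n)), ex_series_geom.
  rewrite Rabs_pos_eq; lra. }
exists (Series (fun n => u (S n) - u n) + u 0%nat).
apply is_lim_seq_incr_1.
apply is_lim_seq_ext with (fun n => sum_n (fun n => u (S n) - u n) n + u 0%nat).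
- intros n; induction n as [|n IH].
  + rewrite sum_O; ring.
  + rewrite sum_Sn; unfold plus; simpl; lra.
- apply (is_lim_seq_plus' _ _ _ _); [|apply is_lim_seq_const].
  exact (Series_correct _ Hex).
Qed.

(** Picard iteration from the centre. *)
Lemma contraction_fixed_point (T : C -> C) p r :
  (forall z, nrm (z - p)%C <= r -> nrm (T z - p)%C <= r) ->
  (forall z w, nrm (z - p)%C <= r -> nrm (w - p)%C <= r ->
     nrm (T z - T w)%C <= / 2 * nrm (z - w)%C) ->
  0 <= r -> exists z, nrm (z - p)%C <= r /\ T z = z.
Proof.
intros HT HL Hr.
set (u := fun n => Nat.iter n T p).
assert (Hin : forall n, nrm (u n - p)%C <= r).
{ induction n as [|n IH]; [|apply HT, IH].
  apply nrm_le; simpl; rewrite !Rplus_opp_r, Rabs_R0; lra. }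
assert (Hst : forall n, nrm (u (S n) - u n)%C <= r * (/ 2) ^ n).
{ induction n as [|n IH]; [simpl; rewrite Rmult_1_r; apply HT, (Hin 0%nat)|].
  change (u (S (S n))) with (T (u (S n))); change (u (S n)) with (T (u n)) at 2.
  eapply Rle_trans; [apply HL; apply Hin|]; change (T (u n)) with (u (S n)); simpl pow; lra. }
destruct (cauchy_geometric_lim (fun n => Re (u n)) r) as [lx Hx].
{ intros n; eapply Rle_trans; [|apply Hst]; apply (nrm_Re (u (S n) - u n)%C). }
destruct (cauchy_geometric_lim (fun n => Im (u n)) r) as [ly Hy].
{ intros n; eapply Rle_trans; [|apply Hst]; apply (nrm_Im (u (S n) - u n)%C). }
set (l := (lx, ly) : C).
assert (Hlim : forall e, 0 < e -> exists N, forall n, (N <= n)%nat -> nrm (u n - l)%C < e).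
{ intros e He.
  apply is_lim_seq_spec in Hx; destruct (Hx (mkposreal e He)) as [N1 HN1].
  apply is_lim_seq_spec in Hy; destruct (Hy (mkposreal e He)) as [N2 HN2].
  exists (max N1 N2); intros n Hn; apply nrm_lt; split.
  - apply HN1; apply Nat.le_trans with (2 := Hn), Nat.le_max_l.
  - apply HN2; apply Nat.le_trans with (2 := Hn), Nat.le_max_r. }
assert (Hl : nrm (l - p)%C <= r).
{ apply le_epsilon; intros e He; destruct (Hlim e He) as [N HN].
  pose proof (HN N (Nat.le_refl N)) as H1; rewrite nrm_sym in H1.
  replace (l - p)%C with ((l - u N) + (u N - p))%C by ring.
  pose proof (nrm_triang (l - u N)%C (u N - p)%C); pose proof (Hin N); lra. }
exists l; split; auto.
assert (H0 : nrm (T l - l)%C <= 0).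
{ apply le_epsilon; intros e He; destruct (Hlim (e / 2) ltac:(lra)) as [N HN].
  pose proof (HN N (Nat.le_refl N)) as H1; rewrite nrm_sym in H1.
  pose proof (HN (S N) (Nat.le_succ_diag_r N)) as H2.
  replace (T l - l)%C with ((T l - T (u N)) + (u (S N) - l))%C by (simpl; ring).
  pose proof (nrm_triang (T l - T (u N))%C (u (S N) - l)%C).
  pose proof (HL l (u N) Hl (Hin N)); lra. }
apply nrm_0 in H0.
replace (T l) with ((T l - l) + l)%C by ring; rewrite H0; ring.
Qed.

Lemma between_close a b c t e : Rabs (a - c) < e -> Rabs (b - c) < e ->
  Rmin a b <= t <= Rmax a b -> Rabs (t - c) < e.
Proof.
intros Ha Hb [H1 H2]; apply Rabs_def2 in Ha, Hb; apply Rabs_def1.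
- apply Rle_lt_trans with (Rmax a b - c); [lra|].
  unfold Rmax; destruct Rle_dec; lra.
- apply Rlt_le_trans with (Rmin a b - c); [|lra].
  unfold Rmin; destruct Rle_dec; lra.
Qed.

Lemma square_pair p e x y : square p e (x, y) <->
  Rabs (x - Re p) < e /\ Rabs (y - Im p) < e.
Proof. unfold square; rewrite nrm_lt; reflexivity. Qed.

(** Two points of a square are joined by a path along the axes inside it, so that
    the mean value theorem in one variable is sufficient. *)
Lemma square_lipschitz p e K (u a b : C -> R) : 
  (forall z, square p e z -> has_partials u z (a z) (b z)) ->
  (forall z, square p e z -> Rabs (a z) <= K /\ Rabs (b z) <= K) ->
  forall z w, square p e z -> square p e w -> Rabs (u z - u w) <= 2 * K * nrm (z - w)%C.
Proof.
intros Hu HK [x y] [x' y'] Hz Hw.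
apply square_pair in Hz, Hw; destruct Hz as [Hx Hy], Hw as [Hx' Hy'].
destruct (MVT_gen (fun t => u (t, y)) x' x (fun t => a (t, y))) as (t1 & Ht1 & E1).
{ intros t Ht; apply (Hu (t, y)), square_pair; split; auto.
  apply between_close with x' x; auto; lra. }
{ intros t Ht; apply derivable_continuous_pt; exists (a (t, y)); apply is_derive_Reals.
  apply (Hu (t, y)), square_pair; split; auto; apply between_close with x' x; auto. }
destruct (MVT_gen (fun t => u (x', t)) y' y (fun t => b (x', t))) as (t2 & Ht2 & E2).
{ intros t Ht; apply (Hu (x', t)), square_pair; split; auto.
  apply between_close with y' y; auto; lra. }
{ intros t Ht; apply derivable_continuous_pt; exists (b (x', t)); apply is_derive_Reals.
  apply (Hu (x', t)), square_pair; split; auto; apply between_close with y' y; auto. }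
destruct (HK (t1, y)) as [K1 _].
{ apply square_pair; split; auto; apply between_close with x' x; auto. }
destruct (HK (x', t2)) as [_ K2].
{ apply square_pair; split; auto; apply between_close with y' y; auto. }
replace (u (x, y) - u (x', y')) with
  (a (t1, y) * (x - x') + b (x', t2) * (y - y')) by lra.
eapply Rle_trans; [apply Rabs_triang|]; rewrite !Rabs_mult.
pose proof (nrm_Re ((x, y) - (x', y'))%C) as N1.
pose proof (nrm_Im ((x, y) - (x', y'))%C) as N2.
change (Rabs (x - x') <= nrm ((x, y) - (x', y'))%C) in N1.
change (Rabs (y - y') <= nrm ((x, y) - (x', y'))%C) in N2.
assert (Rabs (a (t1, y)) * Rabs (x - x') <= K * nrm ((x, y) - (x', y'))%C)
  by (apply Rmult_le_compat; auto using Rabs_pos).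
assert (Rabs (b (x', t2)) * Rabs (y - y') <= K * nrm ((x, y) - (x', y'))%C)
  by (apply Rmult_le_compat; auto using Rabs_pos).
lra.
Qed.

Lemma holo_square_lipschitz p e K (F f : C -> C) :
  (forall z, square p e z -> wirt F z (f z) 0) ->
  (forall z, square p e z -> nrm (f z) <= K) ->
  forall z w, square p e z -> square p e w -> nrm (F z - F w)%C <= 2 * K * nrm (z - w)%C.
Proof.
intros HF HK z w Hz Hw; apply nrm_le; split.
- apply (square_lipschitz p e K (fun z => Re (F z)) (fun z => Re (f z)) (fun z => - Im (f z)));
    auto; intros t Ht.
  + destruct (HF t Ht) as [H1 _]; eapply has_partials_eq; [exact H1| |];
      unfold Re, Im; simpl; ring.
  + rewrite Rabs_Ropp; apply nrm_le; auto.
- apply (square_lipschitz p e K (fun z => Im (F z)) (fun z => Im (f z)) (fun z => Re (f z)));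
    auto; intros t Ht.
  + destruct (HF t Ht) as [_ H1]; eapply has_partials_eq; [exact H1| |];
      unfold Re, Im; simpl; ring.
  + split; apply nrm_le; auto.
Qed.

Lemma differentiable_has_partials (u : C -> R) z a b :
  differentiable_pt_lim (fun s t => u (s, t)) (Re z) (Im z) a b ->
  has_partials u z a b.
Proof.
intros Hd.
assert (P : has_partials (fun w => u (Re w, Im w)) z (a * 1 + b * 0) (a * 0 + b * 1)).
{ apply has_partials_comp; auto using has_partials_Re, has_partials_Im. }
eapply has_partials_eq; [eapply has_partials_ext_loc;
  [apply open_true | exact I | | exact P]| |]; try ring.
intros [] _; reflexivity.
Qed.

(** The derivative 1 / (g o h) of h is as regular as h itself, which raises the
    regularity of h from continuity to all orders. *)
Lemma smooth_inverse_map (D S : C -> Prop) (g h : C -> C) :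
  open D -> open S -> smoothC D g -> (forall z, D z -> g z <> 0) ->
  (forall w, S w -> D (h w)) ->
  (forall w, S w -> wirt h w (/ g (h w)) 0) ->
  (forall w, S w -> continuous (fun w => Re (h w)) w /\ continuous (fun w => Im (h w)) w) ->
  smoothC S h.
Proof.
intros HD HS Hg Hg0 Hh Hw Hc.
destruct (smoothC_inv D g HD Hg0 Hg) as [I1 I2].
assert (H : forall k, Ck k S (fun w => Re (h w)) /\ Ck k S (fun w => Im (h w))).
2: { split; intros k; apply H. }
assert (E : forall w, h w = (Re (h w), Im (h w))) by (intros w; destruct (h w); auto).
induction k as [|k [IH1 IH2]]; [split; intros w Hw'; apply Hc; auto|].
assert (J1 : Ck k S (fun w => Re (/ g (h w))%C)).
{ apply Ck_ext with (fun w => Re (/ g (Re (h w), Im (h w)))%C); auto.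
  - intros; rewrite <- E; auto.
  - apply (Ck_comp k S D (fun z => Re (/ g z)%C)); auto; intros; rewrite <- E; auto. }
assert (J2 : Ck k S (fun w => Im (/ g (h w))%C)).
{ apply Ck_ext with (fun w => Im (/ g (Re (h w), Im (h w)))%C); auto.
  - intros; rewrite <- E; auto.
  - apply (Ck_comp k S D (fun z => Im (/ g z)%C)); auto; intros; rewrite <- E; auto. }
assert (J3 : Ck k S (fun w => (-1) * Im (/ g (h w))%C))
  by (apply Ck_mult; auto; apply Ck_const; auto).
split.
- apply Ck_intro with (fun w => Re (/ g (h w))%C) (fun w => (-1) * Im (/ g (h w))%C); auto.
  intros w Hw'; destruct (Hw w Hw') as [P _]; eapply has_partials_eq; [exact P| |];
    unfold Re, Im; simpl; ring.
- apply Ck_intro with (fun w => Im (/ g (h w))%C) (fun w => Re (/ g (h w))%C); auto.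
  intros w Hw'; destruct (Hw w Hw') as [_ P]; eapply has_partials_eq; [exact P| |];
    unfold Re, Im; simpl; ring.
Qed.

Lemma holo_differentiable (D : C -> Prop) (W g : C -> C) z e : open D -> smoothC D W ->
  wirt W z (g z) 0 -> D z -> 0 < e ->
  exists d, 0 < d /\ forall w, nrm (w - z)%C < d ->
    nrm (W w - W z - g z * (w - z))%C <= e * nrm (w - z)%C.
Proof.
intros HD [S1 S2] HW Hz He.
pose proof (dxC_wirt _ _ _ _ HW) as [Ex Ey].
pose proof (Ck_differentiable _ _ _ _ HD (S1 1%nat) Hz (mkposreal e He)) as [d1 H1].
pose proof (Ck_differentiable _ _ _ _ HD (S2 1%nat) Hz (mkposreal e He)) as [d2 H2].
change (dx (fun w => Re (W w)) z) with (Re (dxC W z)) in H1.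
change (dy (fun w => Re (W w)) z) with (Re (dyC W z)) in H1.
change (dx (fun w => Im (W w)) z) with (Im (dxC W z)) in H2.
change (dy (fun w => Im (W w)) z) with (Im (dyC W z)) in H2.
rewrite Ex, Ey in H1, H2.
exists (Rmin d1 d2); split; [apply Rmin_pos; apply cond_pos|].
intros [s t] Hw; pose proof (Rmin_l d1 d2); pose proof (Rmin_r d1 d2).
apply nrm_lt in Hw; destruct Hw as [W1 W2].
change (Rabs (s - Re z) < Rmin d1 d2) in W1; change (Rabs (t - Im z) < Rmin d1 d2) in W2.
specialize (H1 s t ltac:(lra) ltac:(lra)); specialize (H2 s t ltac:(lra) ltac:(lra)).
destruct z as [x y]; simpl pos in *.
apply nrm_le; split.
- eapply Rle_trans; [|exact H1]; right; f_equal; unfold Re, Im; simpl; ring.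
- eapply Rle_trans; [|exact H2]; right; f_equal; unfold Re, Im; simpl; ring.
Qed.

(** Solving W z = w amounts to finding a fixed point of the Newton map
    z - (W z - w) / g(p), a contraction near p since its derivative 1 - g / g(p)
    vanishes at p. *)
Lemma holo_local_inverse (D : C -> Prop) (W g : C -> C) p : open D -> D p ->
  smoothC D W -> smoothC D g -> (forall z, D z -> g z <> 0) ->
  (forall z, D z -> wirt W z (g z) 0) ->
  exists (S V : C -> Prop) (h : C -> C),
    plane_domain S /\ open V /\ V p /\ (forall z, V z -> D z) /\
    diffeomorphism S V h /\ (forall w, S w -> wirt h w (/ g (h w)) 0).
Proof.
intros HD Hp SW Sg Hg0 HW.
set (c := (/ g p)%C).
assert (Hc : (g p * c = 1)%C) by (unfold c; field; auto).
set (nu z := (1 - c * g z)%C).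
assert (Snu : smoothC D nu).
{ apply smoothC_minus; auto; [apply smoothC_const; auto|].
  apply smoothC_mult; auto; apply smoothC_const; auto. }
assert (nup : nu p = 0) by (unfold nu; rewrite Cmult_comm, Hc; ring).
destruct (smoothC_nrm D nu p (/ 8) HD Snu Hp ltac:(lra)) as (e & He & Hnu).
set (N z := (z - c * W z)%C).
assert (SD : forall z, square p e z -> D z) by (intros z Hz; apply Hnu; auto).
assert (HN : forall z, square p e z -> wirt N z (nu z) 0).
{ intros z Hz; eapply wirt_eq; [apply wirt_minus; [|apply wirt_scal, HW; auto]| |].
  - apply wirt_id.
  - reflexivity.
  - ring. }
(* A Lipschitz constant 1/4 leaves room for the displacement c (w - W p), of size
   at most e/4, inside the half-size square. *)
assert (LN : forall z w, square p e z -> square p e w ->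
  nrm (N z - N w)%C <= / 4 * nrm (z - w)%C).
{ intros z w Hz Hw; replace (/ 4) with (2 * / 8) by field.
  apply (holo_square_lipschitz p e (/ 8) N nu); auto.
  intros t Ht; destruct (Hnu t Ht) as [_ Hn]; rewrite nup in Hn.
  replace (nu t) with (nu t - 0)%C by ring; lra. }
(* This bound gives the injectivity of W and the Lipschitz continuity of its
   inverse at the same time. *)
assert (Hinj : forall z w, square p e z -> square p e w ->
  nrm (z - w)%C <= 4 * nrm c * nrm (W z - W w)%C).
{ intros z w Hz Hw; pose proof (LN z w Hz Hw).
  pose proof (nrm_mult c (W z - W w)%C).
  pose proof (nrm_triang (N z - N w)%C (c * (W z - W w))%C) as Ht.
  replace (N z - N w + c * (W z - W w))%C with (z - w)%C in Ht by (unfold N; ring).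
  pose proof (nrm_ge0 (z - w)%C).
  pose proof (Rmult_le_pos _ _ (nrm_ge0 c) (nrm_ge0 (W z - W w)%C)).
  lra. }
assert (Hcpos : 0 < nrm c).
{ destruct (nrm_ge0 c) as [|E0]; auto; exfalso.
  assert (c = 0) by (apply nrm_0; lra).
  rewrite H, Cmult_0_r in Hc; injection Hc; lra. }
set (dl := e / (8 * nrm c)).
assert (Hdl : 0 < dl) by (apply Rdiv_lt_0_compat; lra).
set (S := square (W p) dl).
assert (Hex : forall w, exists z, S w -> nrm (z - p)%C <= e / 2 /\ W z = w).
{ intros w; destruct (excluded_middle_informative (S w)) as [Sw | nSw];
    [|exists 0; intros; contradiction].
  assert (Hin : forall z, nrm (z - p)%C <= e / 2 -> square p e z)
    by (intros z Hz; unfold square; lra).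
  destruct (contraction_fixed_point (fun z => N z + c * w)%C p (e / 2)) as (z & Hz & Ez).
  - intros z Hz.
    replace (N z + c * w - p)%C with ((N z - N p) + c * (w - W p))%C
      by (unfold N; ring).
    eapply Rle_trans; [apply nrm_triang|].
    pose proof (LN z p (Hin z Hz) (square_center p e He)).
    pose proof (nrm_mult c (w - W p)%C).
    assert (nrm c * nrm (w - W p)%C <= nrm c * dl)
      by (apply Rmult_le_compat_l; [lra | unfold S, square in Sw; lra]).
    assert (nrm c * dl = e / 8) by (unfold dl; field; lra).
    lra.
  - intros z z' Hz Hz'.
    replace (N z + c * w - (N z' + c * w))%C with (N z - N z')%C by ring.
    pose proof (LN z z' (Hin _ Hz) (Hin _ Hz')); pose proof (nrm_ge0 (z - z')%C); lra.
  - lra.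
  - exists z; intros _; split; auto.
    assert (E0 : (c * (w - W z))%C = 0).
    { replace (c * (w - W z))%C with ((N z + c * w) - z)%C by (unfold N; ring).
      rewrite Ez; ring. }
    assert (E1 : (g p * (c * (w - W z)))%C = 0) by (rewrite E0; ring).
    rewrite Cmult_assoc, Hc, Cmult_1_l in E1.
    replace w with ((w - W z) + W z)%C by ring; rewrite E1; ring. }
set (h := fun w => proj1_sig (constructive_indefinite_description _ (Hex w))).
assert (Hh : forall w, S w -> nrm (h w - p)%C <= e / 2 /\ W (h w) = w).
{ intros w Hw; unfold h; destruct constructive_indefinite_description as [z Hz]; simpl; auto. }
assert (Hhs : forall w, S w -> square p e (h w)).
{ intros w Hw; destruct (Hh w Hw); unfold square; lra. }
assert (HS : open S) by apply open_square.
assert (Wsq : smoothC (square p e) W) by (apply smoothC_mono with D; auto).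
assert (Hlip : forall w w', S w -> S w' ->
  nrm (h w - h w')%C <= 4 * nrm c * nrm (w - w')%C).
{ intros w w' Hw Hw'; destruct (Hh w Hw) as [_ E1], (Hh w' Hw') as [_ E2].
  pose proof (Hinj _ _ (Hhs w Hw) (Hhs w' Hw')) as Hi; rewrite E1, E2 in Hi; auto. }
assert (Hdiff : forall w, S w -> forall eta, 0 < eta -> exists d, 0 < d /\
  forall w', nrm (w' - w)%C < d ->
    nrm (h w' - h w - / g (h w) * (w' - w))%C <= eta * nrm (w' - w)%C).
{ intros w Hw eta Heta.
  set (k := (/ g (h w))%C).
  assert (Hk : (k * g (h w) = 1)%C) by (unfold k; field; auto).
  set (L := 4 * nrm c); assert (HL : 0 < L) by (unfold L; lra).
  pose proof (nrm_ge0 k) as Hk0.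
  assert (He' : 0 < eta / (2 * (nrm k + 1) * L)).
  { apply Rdiv_lt_0_compat; auto; apply Rmult_lt_0_compat; lra. }
  destruct (holo_differentiable D W g (h w) _ HD SW (HW _ (SD _ (Hhs w Hw)))
    (SD _ (Hhs w Hw)) He') as (d1 & Hd1 & H1).
  destruct (open_nrm _ _ HS Hw) as (d2 & Hd2 & H2).
  exists (Rmin (d1 / L) d2); split; [apply Rmin_pos; auto; apply Rdiv_lt_0_compat; auto|].
  intros w' Hw'; pose proof (Rmin_l (d1 / L) d2); pose proof (Rmin_r (d1 / L) d2).
  assert (Sw' : S w') by (apply H2; lra).
  pose proof (Hlip w' w Sw' Hw) as Hl; fold L in Hl.
  assert (Hc1 : nrm (h w' - h w)%C < d1).
  { eapply Rle_lt_trans; [exact Hl|].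
    apply Rmult_lt_reg_r with (/ L); [apply Rinv_0_lt_compat; auto|].
    replace (L * nrm (w' - w)%C * / L) with (nrm (w' - w)%C) by (field; lra).
    unfold Rdiv in *; lra. }
  specialize (H1 _ Hc1); destruct (Hh w Hw) as [_ E1], (Hh w' Sw') as [_ E2].
  rewrite E1, E2 in H1.
  replace (h w' - h w - k * (w' - w))%C with
    (k * g (h w) * (h w' - h w) - k * (w' - w))%C by (rewrite Hk; ring).
  replace (k * g (h w) * (h w' - h w) - k * (w' - w))%C with
    (- (k * (w' - w - g (h w) * (h w' - h w))))%C by ring.
  rewrite nrm_opp; eapply Rle_trans; [apply nrm_mult|].
  set (X := nrm (w' - w - g (h w) * (h w' - h w))%C) in *.
  set (Y := nrm (w' - w)%C) in *; set (Z := nrm (h w' - h w)%C) in *.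
  set (q := eta / (2 * (nrm k + 1) * L)) in *.
  assert (Eq : eta = 2 * (nrm k + 1) * (q * L)) by (unfold q; field; split; lra).
  assert (0 <= X) by apply nrm_ge0; assert (0 <= Y) by apply nrm_ge0.
  assert (HX : X <= q * L * Y).
  { eapply Rle_trans; [exact H1|]; rewrite Rmult_assoc; apply Rmult_le_compat_l; lra. }
  rewrite Eq; apply Rle_trans with (2 * nrm k * (q * L * Y)).
  - apply Rmult_le_compat_l; lra.
  - assert (0 <= q * L * Y) by lra; nra. }
assert (Hd : forall w, S w ->
  differentiable_pt_lim (fun s t => Re (h (s, t))) (Re w) (Im w)
    (Re (/ g (h w))%C) (- Im (/ g (h w))%C) /\
  differentiable_pt_lim (fun s t => Im (h (s, t))) (Re w) (Im w)
    (Im (/ g (h w))%C) (Re (/ g (h w))%C)).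
{ intros w Hw; set (k := (/ g (h w))%C); split; intros eta;
    destruct (Hdiff w Hw eta (cond_pos eta)) as (d & Hd & H);
    exists (mkposreal d Hd); intros s t Hs Ht;
    (assert (Hst : nrm ((s, t) - w)%C < d) by (apply nrm_lt; split; auto));
    specialize (H _ Hst); apply nrm_le in H; destruct H as [H1 H2]; destruct w as [x y].
  - eapply Rle_trans; [|exact H1]; right; f_equal; fold k; unfold Re, Im; simpl; ring.
  - eapply Rle_trans; [|exact H2]; right; f_equal; fold k; unfold Re, Im; simpl; ring. }
assert (Hwh : forall w, S w -> wirt h w (/ g (h w)) 0).
{ intros w Hw; destruct (Hd w Hw) as [D1 D2]; split.
  - eapply has_partials_eq; [exact (differentiable_has_partials _ _ _ _ D1)| |];
      unfold Re, Im; simpl; ring.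
  - eapply has_partials_eq; [exact (differentiable_has_partials _ _ _ _ D2)| |];
      unfold Re, Im; simpl; ring. }
exists S, (fun z => square p e z /\ S (W z)), h.
split; [split; [exact HS | apply square_connected]|].
split; [|split; [|split; [|split]]]; auto.
- intros z [Hz Sz].
  destruct (open_nrm _ _ HS Sz) as (d1 & Hd1 & H1).
  destruct (smoothC_nrm _ W z d1 (open_square p e) Wsq Hz Hd1) as (d & Hd' & H2).
  apply locally_nrm with d; auto; intros w Hw; destruct (H2 w Hw); auto.
- split; apply square_center; auto.
- intros z [Hz _]; auto.
- split; [|split].
  + apply smooth_inverse_map with D g; auto.
    intros w Hw; destruct (Hd w Hw) as [D1 D2].
    split; eapply differentiable_pt_lim_continuous; [exact D1 | exact D2].
  + intros w Hw; split; auto; destruct (Hh w Hw) as [_ ->]; auto.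
  + exists W; split; [|split; [|split]].
    * apply smoothC_mono with D; auto; intros z [Hz _]; auto.
    * intros z [_ Hz]; auto.
    * intros w Hw; apply Hh; auto.
    * intros z [Hz Sz]; destruct (Hh _ Sz) as [_ E].
      pose proof (Hinj _ _ (Hhs _ Sz) Hz) as Hi; rewrite E in Hi.
      replace (W z - W z)%C with (RtoC 0) in Hi by ring.
      assert (E0 : nrm (RtoC 0) = 0) by (unfold nrm; simpl; rewrite Rabs_R0; apply Rmax_left; lra).
      rewrite E0, Rmult_0_r in Hi; apply nrm_0 in Hi.
      replace (h (W z)) with ((h (W z) - z) + z)%C by ring; rewrite Hi; ring.
Qed.

(** * Primitives *)

(** The potential is the integral of the form along the path from the centre
    that runs first horizontally and then vertically. *)
Lemma square_poincare p e (P Q : C -> R) :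
  smooth (square p e) P -> smooth (square p e) Q ->
  (forall z, square p e z -> dy P z = dx Q z) ->
  exists u, forall z, square p e z -> has_partials u z (P z) (Q z).
Proof.
intros SP SQ Hcl; destruct p as [x0 y0].
assert (HS := open_square (x0, y0) e).
assert (Hmid : forall x y t, square (x0, y0) e (x, y) ->
  Rmin y0 y <= t <= Rmax y0 y -> square (x0, y0) e (x, t)).
{ intros x y t Hz Ht; apply square_pair in Hz; destruct Hz as [Hx Hy].
  apply square_pair; split; auto; simpl in *.
  apply between_close with y0 y; auto.
  rewrite Rminus_eq_0, Rabs_R0; apply Rle_lt_trans with (2 := Hy), Rabs_pos. }
assert (Hmid' : forall x y t, square (x0, y0) e (x, y) ->
  Rmin x0 x <= t <= Rmax x0 x -> square (x0, y0) e (t, y)).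
{ intros x y t Hz Ht; apply square_pair in Hz; destruct Hz as [Hx Hy].
  apply square_pair; split; auto; simpl in *.
  apply between_close with x0 x; auto.
  rewrite Rminus_eq_0, Rabs_R0; apply Rle_lt_trans with (2 := Hx), Rabs_pos. }
assert (Hbase : forall x y, square (x0, y0) e (x, y) -> square (x0, y0) e (x, y0)).
{ intros x y Hz; apply Hmid with y; auto.
  split; [apply Rmin_l | apply Rmax_l]. }
assert (cx : forall u x y, smooth (square (x0, y0) e) u -> square (x0, y0) e (x, y) ->
  continuous (fun t => u (t, y)) x).
{ intros u x y Su Hz; apply (ex_derive_continuous (fun t => u (t, y))).
  eexists; apply (smooth_partials _ _ (x, y) Su Hz). }
assert (cy : forall u x y, smooth (square (x0, y0) e) u -> square (x0, y0) e (x, y) ->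
  continuous (fun t => u (x, t)) y).
{ intros u x y Su Hz; apply (ex_derive_continuous (fun t => u (x, t))).
  eexists; apply (smooth_partials _ _ (x, y) Su Hz). }
assert (Ix : forall u x y, smooth (square (x0, y0) e) u -> square (x0, y0) e (x, y) ->
  ex_RInt (fun t => u (t, y)) x0 x).
{ intros u x y Su Hz; apply (ex_RInt_continuous (V := R_CompleteNormedModule)).
  intros t Ht; apply cx; auto; apply Hmid' with x; auto. }
assert (Iy : forall u x y, smooth (square (x0, y0) e) u -> square (x0, y0) e (x, y) ->
  ex_RInt (fun t => u (x, t)) y0 y).
{ intros u x y Su Hz; apply (ex_RInt_continuous (V := R_CompleteNormedModule)).
  intros t Ht; apply cy; auto; apply Hmid with y; auto. }
exists (fun z => RInt (fun t => P (t, y0)) x0 (Re z) + RInt (fun t => Q (Re z, t)) y0 (Im z)).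
intros [x y] Hz; split; simpl.
- replace (P (x, y)) with (P (x, y0) + (P (x, y) - P (x, y0))) by ring.
  apply (is_derive_plus (fun t => RInt (fun s => P (s, y0)) x0 t)
    (fun t => RInt (fun s => Q (t, s)) y0 y)).
  + apply (is_derive_RInt (fun s => P (s, y0)) _ x0 x); [|apply cx; eauto].
    apply filter_imp with (2 := open_locally_x _ (x, y) HS Hz); simpl.
    intros t Ht; apply (RInt_correct (fun s => P (s, y0))), Ix; eauto.
  + replace (P (x, y) - P (x, y0)) with
      (RInt (fun t => Derive (fun s => Q (s, t)) x) y0 y).
    * apply (is_derive_RInt_param (fun t s => Q (t, s)) y0 y x).
      -- apply filter_imp with (2 := open_locally_x _ (x, y) HS Hz); simpl.
         intros t Ht s Hs; eexists.
         apply (proj1 (smooth_partials _ _ (t, s) SQ (Hmid _ _ _ Ht Hs))).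
      -- intros t Ht; apply continuity_2d_pt_filterlim.
         apply continuous_ext with (dx Q); [intros []; auto|].
         apply smooth_continuous with (square (x0, y0) e); auto.
         ++ apply smooth_dx; auto.
         ++ apply Hmid with y; auto.
      -- apply filter_imp with (2 := open_locally_x _ (x, y) HS Hz); simpl.
         intros t Ht; apply Iy; auto.
    * rewrite <- (RInt_Derive (fun t => P (x, t)) y0 y).
      -- apply RInt_ext; intros t Ht.
         assert (Ht' : square (x0, y0) e (x, t)) by (apply Hmid with y; auto; lra).
         symmetry; exact (Hcl _ Ht').
      -- intros t Ht; eexists.
         apply (proj2 (smooth_partials _ _ (x, t) SP (Hmid _ _ _ Hz Ht))).
      -- intros t Ht; apply (cy (dy P)); [apply smooth_dy; auto|].
         apply Hmid with y; auto.
- replace (Q (x, y)) with (0 + Q (x, y)) by ring.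
  apply (is_derive_plus (fun _ => RInt (fun s => P (s, y0)) x0 x)
    (fun t => RInt (fun s => Q (x, s)) y0 t)).
  + apply (is_derive_const (K := R_AbsRing) (V := R_NormedModule)).
  + apply (is_derive_RInt (fun s => Q (x, s)) _ y0 y); [|apply cy; eauto].
    apply filter_imp with (2 := open_locally_y _ (x, y) HS Hz); simpl.
    intros t Ht; apply (RInt_correct (fun s => Q (x, s))), Iy; auto.
Qed.

(** The real and imaginary parts of g dz are closed by the Cauchy-Riemann
    equations. *)
Lemma holo_primitive p e (g : C -> C) : smoothC (square p e) g ->
  (forall z, square p e z -> dzb g z = 0) ->
  exists W, smoothC (square p e) W /\ forall z, square p e z -> wirt W z (g z) 0.
Proof.
intros Sg Hg; assert (HS := open_square p e); destruct Sg as [S1 S2].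
assert (CR : forall z, square p e z -> dyC g z = (Ci * dxC g z)%C).
{ intros z Hz; pose proof (Hg z Hz) as E; unfold dzb in E.
  apply Cmult_cancel_l with (Ci * / 2)%C.
  - intros E0; injection E0; intros; lra.
  - replace (Ci * / 2 * dyC g z)%C with (/ 2 * (dxC g z + Ci * dyC g z) - / 2 * dxC g z)%C
      by ring.
    rewrite E; apply C_eq; unfold Re, Im; simpl; field. }
destruct (square_poincare p e (fun z => Re (g z)) (fun z => - Im (g z))) as [u1 H1]; auto.
{ apply smooth_opp; auto. }
{ intros z Hz; pose proof (f_equal Re (CR z Hz)) as E.
  change (dy (fun w => Re (g w)) z) with (Re (dyC g z)); rewrite E.
  assert (P : has_partials (fun z => - Im (g z)) z (- dx (fun z => Im (g z)) z)
    (- dy (fun z => Im (g z)) z)).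
  { destruct (smooth_partials _ _ _ S2 Hz).
    split; apply (is_derive_opp (K := R_AbsRing) (V := R_NormedModule)); auto. }
  apply has_partials_unique in P; destruct P as [-> _].
  unfold dxC, Re, Im; simpl; ring. }
destruct (square_poincare p e (fun z => Im (g z)) (fun z => Re (g z))) as [u2 H2]; auto.
{ intros z Hz; pose proof (f_equal Im (CR z Hz)) as E.
  change (dy (fun w => Im (g w)) z) with (Im (dyC g z)); rewrite E.
  unfold dxC, Re, Im; simpl; ring. }
exists (fun z => (u1 z, u2 z)); split.
- split; simpl.
  + apply smooth_intro with (fun z => Re (g z)) (fun z => - Im (g z)); auto.
    apply smooth_opp; auto.
  + apply smooth_intro with (fun z => Im (g z)) (fun z => Re (g z)); auto.
- intros z Hz; split; simpl.
  + eapply has_partials_eq; [exact (H1 z Hz)| |]; unfold Re, Im; simpl; ring.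
  + eapply has_partials_eq; [exact (H2 z Hz)| |]; unfold Re, Im; simpl; ring.
Qed.

(** * Nil in the left-invariant frame *)

(** The coordinates of a tangent vector in the orthonormal frame generated by
    [e1], [e2], [e3]. *)
Definition frame (p u : R3) : R3 := (x1 u, x2 u, x3 u - x1 p * x2 u).
Definition dot (u v : R3) : R := x1 u * x1 v + x2 u * x2 v + x3 u * x3 v.
Definition cross (u v : R3) : R3 :=
  (x2 u * x3 v - x3 u * x2 v, x3 u * x1 v - x1 u * x3 v, x1 u * x2 v - x2 u * x1 v).
Definition lapR (u : C -> R) (z : C) : R := dx (dx u) z + dy (dy u) z.

Lemma metric_dot p u v : metric p u v = dot (frame p u) (frame p v).
Proof. reflexivity. Qed.

Lemma R3_eq (u v : R3) : x1 u = x1 v -> x2 u = x2 v -> x3 u = x3 v -> u = v.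
Proof. destruct u as [[]], v as [[]]; unfold x1, x2, x3; simpl; congruence. Qed.

Lemma left_fieldE a p : left_field a p = (x1 a, x2 a, x3 a + x1 p * x2 a).
Proof.
destruct a as [[a1 a2] a3], p as [[p1 p2] p3].
unfold left_field, nil_mul, x1, x2, x3; simpl.
change (fun t => p1 + scal t a1) with (fun t => p1 + t * a1).
change (fun t => p2 + scal t a2) with (fun t => p2 + t * a2).
change (fun t => p3 + scal t a3 + p1 * scal t a2) with
  (fun t => p3 + t * a3 + p1 * (t * a2)).
rewrite (is_derive_unique _ _ a1) by (auto_derive; auto; ring).
rewrite (is_derive_unique _ _ a2) by (auto_derive; auto; ring).
rewrite (is_derive_unique _ _ (a3 + p1 * a2)) by (auto_derive; auto; ring).
reflexivity.
Qed.

Lemma frame_detE p u v w :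
  frame_det p u v w = dot (cross (frame p u) (frame p v)) (frame p w).
Proof.
unfold frame_det; rewrite !left_fieldE; destruct p as [[]], u as [[]], v as [[]], w as [[]].
unfold metric, dot, cross, frame, e1, e2, e3, x1, x2, x3; simpl; ring.
Qed.

Lemma dmetricE p u v w : dmetric p u v w =
  - x1 u * (x2 v * x3 (frame p w) + x3 (frame p v) * x2 w).
Proof.
destruct p as [[p1 p2] p3], u as [[u1 u2] u3], v as [[v1 v2] v3], w as [[w1 w2] w3].
unfold dmetric, frame, x1, x2, x3; simpl; apply is_derive_unique.
change (is_derive (fun t => v1 * w1 + v2 * w2
  + (v3 - (p1 + t * u1) * v2) * (w3 - (p1 + t * u1) * w2)) 0
  (- u1 * (v2 * (w3 - p1 * w2) + (v3 - p1 * v2) * w2))).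
auto_derive; auto; ring.
Qed.

Lemma christoffel_same p u w : christoffel p u u w =
  x1 w * (x2 u * x3 (frame p u))
  - x1 u * (x2 u * x3 (frame p w) + x3 (frame p u) * x2 w).
Proof. unfold christoffel; rewrite !dmetricE; field. Qed.

(** Frame coordinates of nabla_x f_x + nabla_y f_y; the quadratic terms are the
    Christoffel symbols of the left-invariant metric. *)
Definition tension (f : C -> R3) (z : C) : R3 :=
  let X := frame (f z) (dx3 f z) in
  let Y := frame (f z) (dy3 f z) in
  let L := frame (f z) (lapR (fun w => x1 (f w)) z, lapR (fun w => x2 (f w)) z,
                        lapR (fun w => x3 (f w)) z) in
  (x1 L + (x2 X * x3 X + x2 Y * x3 Y),
   x2 L - (x1 X * x3 X + x1 Y * x3 Y),
   x3 L - (x1 X * x2 X + x1 Y * x2 Y)).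

Lemma mean_curvature_tension f n z (X := dx3 f z) (Y := dy3 f z) :
  metric (f z) X X = metric (f z) Y Y -> metric (f z) X Y = 0 ->
  metric (f z) X X <> 0 ->
  mean_curvature f n z =
    dot (tension f z) (frame (f z) (n z)) / (2 * metric (f z) X X).
Proof.
intros EG F0 E0; unfold mean_curvature; fold X Y; rewrite F0, <- EG.
assert (Hs : second_form (f z) (n z) X X (dx3 (dx3 f) z) +
  second_form (f z) (n z) Y Y (dy3 (dy3 f) z) = dot (tension f z) (frame (f z) (n z))).
{ unfold second_form, tension, lapR; rewrite !christoffel_same; fold X Y.
  unfold metric.
  change (x1 (dx3 (dx3 f) z)) with (dx (dx (fun w => x1 (f w))) z).
  change (x2 (dx3 (dx3 f) z)) with (dx (dx (fun w => x2 (f w))) z).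
  change (x3 (dx3 (dx3 f) z)) with (dx (dx (fun w => x3 (f w))) z).
  change (x1 (dy3 (dy3 f) z)) with (dy (dy (fun w => x1 (f w))) z).
  change (x2 (dy3 (dy3 f) z)) with (dy (dy (fun w => x2 (f w))) z).
  change (x3 (dy3 (dy3 f) z)) with (dy (dy (fun w => x3 (f w))) z).
  generalize (dx (dx (fun w => x1 (f w))) z) (dx (dx (fun w => x2 (f w))) z)
    (dx (dx (fun w => x3 (f w))) z) (dy (dy (fun w => x1 (f w))) z)
    (dy (dy (fun w => x2 (f w))) z) (dy (dy (fun w => x3 (f w))) z).
  intros; clearbody X Y; unfold dot, frame, x1, x2, x3; simpl; ring. }
rewrite <- Hs; field; auto.
Qed.

(** A vector orthogonal to X and Y is proportional to their cross product K: since
    v x K = 0, also K x (v x K) = v |K|^2 - K (v . K) = 0. *)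
Lemma dot_cross_eq X Y v : dot v X = 0 -> dot v Y = 0 ->
  forall x, (x = x1 \/ x = x2 \/ x = x3) ->
  x v * dot (cross X Y) (cross X Y) = dot v (cross X Y) * x (cross X Y).
Proof.
destruct X as [[a1 a2] a3], Y as [[b1 b2] b3], v as [[v1 v2] v3].
unfold dot, cross, x1, x2, x3; simpl; intros HX HY x Hx.
set (k1 := a2 * b3 - a3 * b2); set (k2 := a3 * b1 - a1 * b3); set (k3 := a1 * b2 - a2 * b1).
assert (E1 : v2 * k3 - v3 * k2 = 0).
{ transitivity (a1 * (v1 * b1 + v2 * b2 + v3 * b3) - b1 * (v1 * a1 + v2 * a2 + v3 * a3));
    [unfold k2, k3; ring | rewrite HX, HY; ring]. }
assert (E2 : v3 * k1 - v1 * k3 = 0).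
{ transitivity (a2 * (v1 * b1 + v2 * b2 + v3 * b3) - b2 * (v1 * a1 + v2 * a2 + v3 * a3));
    [unfold k1, k3; ring | rewrite HX, HY; ring]. }
assert (E3 : v1 * k2 - v2 * k1 = 0).
{ transitivity (a3 * (v1 * b1 + v2 * b2 + v3 * b3) - b3 * (v1 * a1 + v2 * a2 + v3 * a3));
    [unfold k1, k2; ring | rewrite HX, HY; ring]. }
destruct Hx as [-> | [-> | ->]]; simpl; fold k1 k2 k3.
- transitivity ((v1 * k1 + v2 * k2 + v3 * k3) * k1
    + k2 * (v1 * k2 - v2 * k1) - k3 * (v3 * k1 - v1 * k3)); [ring|].
  rewrite E3, E2; ring.
- transitivity ((v1 * k1 + v2 * k2 + v3 * k3) * k2
    + k3 * (v2 * k3 - v3 * k2) - k1 * (v1 * k2 - v2 * k1)); [ring|].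
  rewrite E3, E1; ring.
- transitivity ((v1 * k1 + v2 * k2 + v3 * k3) * k3
    + k1 * (v3 * k1 - v1 * k3) - k2 * (v2 * k3 - v3 * k2)); [ring|].
  rewrite E2, E1; ring.
Qed.

(** The unit normal of the frame is X x Y / l, and a vector T orthogonal to X and Y
    is determined by its product with it. *)
Lemma normal_vector_eq X Y N T H l :
  0 < l -> dot X X = l -> dot Y Y = l -> dot X Y = 0 ->
  dot N N = 1 -> dot N X = 0 -> dot N Y = 0 -> 0 < dot (cross X Y) N ->
  dot T X = 0 -> dot T Y = 0 -> dot T N = 2 * H * l ->
  x1 T = 2 * H * x1 (cross X Y) /\ x2 T = 2 * H * x2 (cross X Y) /\
  x3 T = 2 * H * x3 (cross X Y).
Proof.
intros Hl EX EY EXY EN NX NY Hd TX TY TN.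
assert (EK : dot (cross X Y) (cross X Y) = l * l).
{ transitivity (dot X X * dot Y Y - dot X Y * dot X Y);
    [unfold dot, cross, x1, x2, x3; simpl; ring | rewrite EX, EY, EXY; ring]. }
pose proof (dot_cross_eq X Y N NX NY) as HN; rewrite EK in HN.
pose proof (dot_cross_eq X Y T TX TY) as HT; rewrite EK in HT.
assert (Ed : dot N (cross X Y) = dot (cross X Y) N) by (unfold dot; ring).
rewrite Ed in HN; set (d := dot (cross X Y) N) in *; set (K := cross X Y) in *.
set (t := dot T K) in *.
assert (N1 := HN x1 (or_introl eq_refl)); assert (N2 := HN x2 (or_intror (or_introl eq_refl))).
assert (N3 := HN x3 (or_intror (or_intror eq_refl))).
assert (T1 := HT x1 (or_introl eq_refl)); assert (T2 := HT x2 (or_intror (or_introl eq_refl))).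
assert (T3 := HT x3 (or_intror (or_intror eq_refl))).
assert (Hdl : d = l).
{ assert (E : d * d * (l * l) = l * l * (l * l)).
  { transitivity ((d * x1 K) * (d * x1 K) + (d * x2 K) * (d * x2 K) + (d * x3 K) * (d * x3 K)).
    - rewrite <- EK; unfold dot; ring.
    - rewrite <- N1, <- N2, <- N3.
      transitivity (dot N N * (l * l * (l * l))); [unfold dot; ring | rewrite EN; ring]. }
  apply Rmult_eq_reg_r in E; [|nra]; nra. }
assert (Ht : t = 2 * H * (l * l)).
{ assert (E : l * l * dot T N = d * t).
  { transitivity (x1 T * (x1 N * (l * l)) + x2 T * (x2 N * (l * l)) + x3 T * (x3 N * (l * l)));
      [unfold dot; ring|].
    rewrite N1, N2, N3; unfold t, dot; ring. }
  rewrite TN, Hdl in E; apply Rmult_eq_reg_l with l; lra. }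
rewrite Ht in T1, T2, T3.
assert (l * l <> 0) by nra.
repeat split; apply Rmult_eq_reg_r with (l * l); auto.
- rewrite T1; ring.
- rewrite T2; ring.
- rewrite T3; ring.
Qed.

Lemma dz_RtoC (u : C -> R) z : dz (fun w => RtoC (u w)) z = (/ 2 * dx u z, - / 2 * dy u z).
Proof.
unfold dz, dxC, dyC.
assert (E1 : dx (fun w => Im (RtoC (u w))) z = 0) by exact (Derive_const 0 (Re z)).
assert (E2 : dy (fun w => Im (RtoC (u w))) z = 0) by exact (Derive_const 0 (Im z)).
rewrite E1, E2.
change (dx (fun w => Re (RtoC (u w))) z) with (dx u z).
change (dy (fun w => Re (RtoC (u w))) z) with (dy u z).
apply C_eq; unfold Re, Im; simpl; field.
Qed.

Lemma laplacian_RtoC (D : C -> Prop) (u : C -> R) z : open D -> smooth D u -> D z ->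
  dzb (dz (fun w => RtoC (u w))) z = RtoC (/ 4 * lapR u z).
Proof.
intros HD Hu Hz.
pose proof (laplacian_wirt D _ z HD (smoothC_RtoC D u HD Hu) Hz) as E.
assert (El : laplacian (fun w => RtoC (u w)) z = RtoC (lapR u z)).
{ unfold laplacian; apply C_eq; [reflexivity|].
  assert (E0 : dx (fun w => Im (dxC (fun w => RtoC (u w)) w)) z = 0).
  { unfold dx; rewrite (Derive_ext _ (fun _ => 0)); [apply Derive_const|].
    intros t; exact (Derive_const 0 t). }
  assert (E1 : dy (fun w => Im (dyC (fun w => RtoC (u w)) w)) z = 0).
  { unfold dy; rewrite (Derive_ext _ (fun _ => 0)); [apply Derive_const|].
    intros t; exact (Derive_const 0 t). }
  change (dx (fun w => Im (dxC (fun w => RtoC (u w)) w)) z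
    + dy (fun w => Im (dyC (fun w => RtoC (u w)) w)) z = 0).
  rewrite E0, E1; ring. }
rewrite El in E.
transitivity (/ 4 * RtoC (lapR u z))%C; [rewrite E; field | ].
  apply C_eq; unfold Re, Im; simpl; field.
Qed.

(** * The Dirac equation *)

Lemma Ci2 : (Ci * Ci = -1)%C.
Proof. apply C_eq; unfold Re, Im; simpl; ring. Qed.

Lemma Ci_conj : Cconj Ci = (- Ci)%C.
Proof. apply C_eq; unfold Re, Im; simpl; ring. Qed.

Lemma RtoC_conj (x : R) : Cconj x = x.
Proof. apply C_eq; unfold Re, Im; simpl; ring. Qed.

Lemma Cmult_eq0_l (a b : C) : (a * b = 0)%C -> a <> 0 -> b = 0.
Proof. intros E Ha; apply Cmult_cancel_l with a; auto; rewrite E; ring. Qed.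

(** The component of f^{-1} df/dz along a frame vector along which f_x and f_y have
    the components X and Y. *)
Definition half_dz (X Y : R) : C := (/ 2 * X, - / 2 * Y).

(** The potential as a function of the values of psi1 and of the conjugate of
    psi2; with this convention both spinors enter f^{-1} df/dz without conjugation. *)
Definition pot (H : R) (psi q : C) : C :=
  (RtoC H / 2 * (psi * Cconj psi + q * Cconj q)
   + Ci / 4 * (q * Cconj q - psi * Cconj psi))%C.

Lemma potential_pot H psi1 psi2 z :
  potential H psi1 psi2 z = pot H (psi1 z) (Cconj (psi2 z)).
Proof.
unfold potential, pot.
rewrite !Cmod2_alt; apply C_eq; unfold Re, Im; simpl; field.
Qed.

Lemma pot_conj H psi q : Cconj (pot H psi q) =
  (RtoC H / 2 * (psi * Cconj psi + q * Cconj q)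
   - Ci / 4 * (q * Cconj q - psi * Cconj psi))%C.
Proof. apply C_eq; unfold pot, Re, Im; simpl; field. Qed.

(** Here b1 and b2 stand for dbar psi and dbar q, and L for the frame
    coordinates of the Laplacian of f.
    Differentiating the formulas for Z = f^{-1} df/dz expresses L through b1 and b2.
    Since Z is null the tension T is orthogonal to the surface, hence T = 2H X x Y.
    Comparing the three components gives, for the two defects al and be of the Dirac
    equation, q be = psi al = 0 and q al + psi be = 0; this forces al = be = 0 even
    where one of the spinors vanishes. *)
Lemma dirac_pointwise (H : R) (psi q b1 b2 : C) (X Y L N T : R3)
  (Z := fun x : R3 -> R => half_dz (x X) (x Y)) :
  (Z x1 = Ci / 2 * (q ^ 2 + psi ^ 2))%C ->
  (Z x2 = 1 / 2 * (q ^ 2 - psi ^ 2))%C ->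
  (Z x3 = psi * q)%C ->
  (RtoC (/ 4 * x1 L) = Ci / 2 * (2 * q * b2 + 2 * psi * b1))%C ->
  (RtoC (/ 4 * x2 L) = 1 / 2 * (2 * q * b2 - 2 * psi * b1))%C ->
  (RtoC (/ 4 * x3 L) = Cconj (Z x1) * Z x2 + (b1 * q + psi * b2))%C ->
  T = (x1 L + (x2 X * x3 X + x2 Y * x3 Y), x2 L - (x1 X * x3 X + x1 Y * x3 Y),
       x3 L - (x1 X * x2 X + x1 Y * x2 Y)) ->
  0 < dot X X -> dot X X = dot Y Y -> dot X Y = 0 ->
  dot N N = 1 -> dot N X = 0 -> dot N Y = 0 -> 0 < dot (cross X Y) N ->
  dot T N = 2 * H * dot X X -> ~ (psi = 0 /\ q = 0) ->
  (b1 = pot H psi q * Cconj q)%C /\ (b2 = - Cconj (pot H psi q) * Cconj psi)%C.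
Proof.
intros HZ1 HZ2 HZ3 E1 E2 E3 ET Hl EG F0 NN NX NY Hdet TN Hne.
assert (cZ1 : (Cconj (Z x1) = - Ci / 2 * (Cconj q ^ 2 + Cconj psi ^ 2))%C).
{ rewrite HZ1, Cmult_conj, Cplus_conj, !Cpow_conj; unfold Cdiv.
  rewrite Cmult_conj, Ci_conj; f_equal; f_equal; apply C_eq; unfold Re, Im; simpl; field. }
assert (cZ2 : (Cconj (Z x2) = 1 / 2 * (Cconj q ^ 2 - Cconj psi ^ 2))%C).
{ rewrite HZ2, Cmult_conj, Cminus_conj, !Cpow_conj; f_equal.
  apply C_eq; unfold Re, Im; simpl; field. }
assert (cZ3 : (Cconj (Z x3) = Cconj psi * Cconj q)%C)
  by (rewrite HZ3, Cmult_conj; reflexivity).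
assert (ET1 : RtoC (x1 T) =
  (4 * RtoC (/ 4 * x1 L) + 2 * (Z x2 * Cconj (Z x3) + Cconj (Z x2) * Z x3))%C)
  by (rewrite ET; unfold Z; clear; apply C_eq;
      unfold half_dz, cross, Re, Im, x1, x2, x3; simpl; field).
assert (ET2 : RtoC (x2 T) =
  (4 * RtoC (/ 4 * x2 L) - 2 * (Z x1 * Cconj (Z x3) + Cconj (Z x1) * Z x3))%C)
  by (rewrite ET; unfold Z; clear; apply C_eq;
      unfold half_dz, cross, Re, Im, x1, x2, x3; simpl; field).
assert (ET3 : RtoC (x3 T) =
  (4 * RtoC (/ 4 * x3 L) - 2 * (Z x1 * Cconj (Z x2) + Cconj (Z x1) * Z x2))%C)
  by (rewrite ET; unfold Z; clear; apply C_eq;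
      unfold half_dz, cross, Re, Im, x1, x2, x3; simpl; field).
(* T and Z are orthogonal for the complex bilinear product; T is real, so its
   products with X and Y vanish separately. *)
assert (Ht : (x1 T * Z x1 + x2 T * Z x2 + x3 T * Z x3)%C = 0).
{ rewrite ET1, ET2, ET3, E1, E2, E3, cZ1, cZ2, cZ3, HZ1, HZ2, HZ3.
  clear; generalize (Cconj psi) (Cconj q); intros; field [Ci2]. }
assert (TX : dot T X = 0).
{ pose proof (f_equal Re Ht) as Er; unfold Z, half_dz, Re, Im, x1, x2, x3 in Er; simpl in Er.
  unfold dot, x1, x2, x3; simpl; lra. }
assert (TY : dot T Y = 0).
{ pose proof (f_equal Im Ht) as Er; unfold Z, half_dz, Re, Im, x1, x2, x3 in Er; simpl in Er.
  unfold dot, x1, x2, x3; simpl; lra. }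
destruct (normal_vector_eq _ _ N T H _ Hl eq_refl (eq_sym EG)) as (K1 & K2 & K3); auto.
assert (C1 : RtoC (x1 T) = (- 4 * Ci * H * (Z x2 * Cconj (Z x3) - Z x3 * Cconj (Z x2)))%C)
  by (rewrite K1; unfold Z; clear; apply C_eq;
      unfold half_dz, cross, Re, Im, x1, x2, x3; simpl; field).
assert (C2 : RtoC (x2 T) = (- 4 * Ci * H * (Z x3 * Cconj (Z x1) - Z x1 * Cconj (Z x3)))%C)
  by (rewrite K2; unfold Z; clear; apply C_eq;
      unfold half_dz, cross, Re, Im, x1, x2, x3; simpl; field).
assert (C3 : RtoC (x3 T) = (- 4 * Ci * H * (Z x1 * Cconj (Z x2) - Z x2 * Cconj (Z x1)))%C)
  by (rewrite K3; unfold Z; clear; apply C_eq;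
      unfold half_dz, cross, Re, Im, x1, x2, x3; simpl; field).
rewrite ET1 in C1; rewrite ET2 in C2; rewrite ET3 in C3.
set (al := (b1 - pot H psi q * Cconj q)%C).
set (be := (b2 + Cconj (pot H psi q) * Cconj psi)%C).
rewrite E1, cZ2, cZ3, HZ2, HZ3 in C1.
rewrite E2, cZ1, cZ3, HZ1, HZ3 in C2.
rewrite E3, cZ1, cZ2, HZ1, HZ2 in C3.
assert (D1 : (q * be + psi * al)%C = 0).
{ apply Cmult_cancel_l with (4 * Ci)%C.
  - intros E0; injection E0; intros; lra.
  - transitivity ((4 * (Ci / 2 * (2 * q * b2 + 2 * psi * b1)) +
      2 * (1 / 2 * (q ^ 2 - psi ^ 2) * (Cconj psi * Cconj q) +
        1 / 2 * (Cconj q ^ 2 - Cconj psi ^ 2) * (psi * q))) -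
      - (4) * Ci * H * (1 / 2 * (q ^ 2 - psi ^ 2) * (Cconj psi * Cconj q) -
        psi * q * (1 / 2 * (Cconj q ^ 2 - Cconj psi ^ 2))))%C.
    + unfold al, be; rewrite pot_conj; unfold pot; clear.
      generalize (Cconj psi) (Cconj q); intros; field [Ci2].
    + rewrite C1; ring. }
assert (D2 : (q * be - psi * al)%C = 0).
{ apply Cmult_cancel_l with (RtoC 4).
  - intros E0; injection E0; intros; lra.
  - transitivity ((4 * (1 / 2 * (2 * q * b2 - 2 * psi * b1)) -
      2 * (Ci / 2 * (q ^ 2 + psi ^ 2) * (Cconj psi * Cconj q) +
        - Ci / 2 * (Cconj q ^ 2 + Cconj psi ^ 2) * (psi * q))) -
      - (4) * Ci * H * (psi * q * (- Ci / 2 * (Cconj q ^ 2 + Cconj psi ^ 2)) -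
        Ci / 2 * (q ^ 2 + psi ^ 2) * (Cconj psi * Cconj q)))%C.
    + unfold al, be; rewrite pot_conj; unfold pot; clear.
      generalize (Cconj psi) (Cconj q); intros; field [Ci2].
    + rewrite C2; ring. }
assert (D3 : (q * al + psi * be)%C = 0).
{ apply Cmult_cancel_l with (RtoC 4).
  - intros E0; injection E0; intros; lra.
  - set (k1 := (1 / 2 * (q ^ 2 - psi ^ 2))%C) in *.
    set (k2 := (1 / 2 * (Cconj q ^ 2 - Cconj psi ^ 2))%C) in *.
    set (k3 := (Ci / 2 * (q ^ 2 + psi ^ 2))%C) in *.
    set (k4 := (- Ci / 2 * (Cconj q ^ 2 + Cconj psi ^ 2))%C) in *.
    transitivity ((4 * (k4 * k1 + (b1 * q + psi * b2)) - 2 * (k3 * k2 + k4 * k1)) -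
      - (4) * Ci * H * (k3 * k2 - k1 * k4))%C.
    + unfold al, be, k1, k2, k3, k4; rewrite pot_conj; unfold pot; clear.
      generalize (Cconj psi) (Cconj q); intros; field [Ci2].
    + rewrite C3; ring. }
assert (Q1 : (q * be)%C = 0).
{ replace (q * be)%C with (/ 2 * ((q * be + psi * al) + (q * be - psi * al)))%C by field.
  rewrite D1, D2; ring. }
assert (Q2 : (psi * al)%C = 0).
{ replace (psi * al)%C with (/ 2 * ((q * be + psi * al) - (q * be - psi * al)))%C by field.
  rewrite D1, D2; ring. }
assert (Hal : al = 0 /\ be = 0).
{ destruct (classic (q = 0)) as [-> | Hq].
  - assert (Hp : psi <> 0) by (intros ->; apply Hne; auto).
    split; [apply Cmult_eq0_l with psi; auto|].
    apply Cmult_eq0_l with psi; auto; rewrite <- D3; ring.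
  - assert (Hb : be = 0) by (apply Cmult_eq0_l with q; auto).
    split; auto; apply Cmult_eq0_l with q; auto.
    rewrite Hb in D3; rewrite <- D3; ring. }
destruct Hal as [Ha Hb]; split.
- replace b1 with (al + pot H psi q * Cconj q)%C by (unfold al; ring); rewrite Ha; ring.
- replace b2 with (be - Cconj (pot H psi q) * Cconj psi)%C by (unfold be; ring).
  rewrite Hb; ring.
Qed.

Lemma wirt_RtoC (D : C -> Prop) (x : C -> R) z : open D -> smooth D x -> D z ->
  wirt (fun w => RtoC (x w)) z (half_dz (dx x z) (dy x z))
    (Cconj (half_dz (dx x z) (dy x z))).
Proof.
intros HD Hx Hz; pose proof (smooth_partials _ _ _ Hx Hz) as P; split.
- eapply has_partials_eq; [exact P| |]; unfold half_dz, Re, Im; simpl; field.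
- eapply has_partials_eq; [split; [exact (is_derive_const (K := R_AbsRing)
    (V := R_NormedModule) 0 (Re z)) | exact (is_derive_const (K := R_AbsRing)
    (V := R_NormedModule) 0 (Im z))]| |]; unfold zero, half_dz, Re, Im; simpl; field.
Qed.

Lemma left_dz_frame (D : C -> Prop) (f : C -> R3) z (X := frame (f z) (dx3 f z))
  (Y := frame (f z) (dy3 f z)) : open D -> smooth3 D f -> D z ->
  left_dz x1 f z = half_dz (x1 X) (x1 Y) /\
  left_dz x2 f z = half_dz (x2 X) (x2 Y) /\
  left_dz x3 f z = half_dz (x3 X) (x3 Y).
Proof.
intros HD (S1 & S2 & S3) Hz.
pose proof (wirt_RtoC D _ z HD S1 Hz) as W1.
pose proof (wirt_RtoC D _ z HD S2 Hz) as W2.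
pose proof (wirt_RtoC D _ z HD S3 Hz) as W3.
assert (Hc : forall (c : R) u a b, wirt u z a b -> wirt (fun w => RtoC c + u w)%C z a b).
{ intros c u a b Hu; eapply wirt_eq; [apply (wirt_plus _ _ _ _ _ _ _ (wirt_const c z) Hu)| |];
    ring. }
split; [|split]; unfold left_dz.
- apply (Hc (- x1 (f z))) in W1.
  assert (W : wirt (fun w => RtoC (x1 (nil_mul (nil_inv (f z)) (f w)))) z
    (half_dz (x1 X) (x1 Y)) (Cconj (half_dz (x1 X) (x1 Y)))).
  { apply wirt_ext_loc with (4 := W1) (D := fun _ => True); auto using open_true.
    intros w _; rewrite <- RtoC_plus; reflexivity. }
  apply wirt_unique in W; apply W.
- apply (Hc (- x2 (f z))) in W2.
  assert (W : wirt (fun w => RtoC (x2 (nil_mul (nil_inv (f z)) (f w)))) z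
    (half_dz (x2 X) (x2 Y)) (Cconj (half_dz (x2 X) (x2 Y)))).
  { apply wirt_ext_loc with (4 := W2) (D := fun _ => True); auto using open_true.
    intros w _; rewrite <- RtoC_plus; reflexivity. }
  apply wirt_unique in W; apply W.
- pose proof (Hc (x1 (f z) * x2 (f z) - x3 (f z)) _ _ _
    (wirt_minus _ _ _ _ _ _ _ W3 (wirt_scal (x1 (f z)) _ _ _ _ W2))) as W4.
  assert (W : wirt (fun w => RtoC (x3 (nil_mul (nil_inv (f z)) (f w)))) z
    (half_dz (x3 X) (x3 Y)) (Cconj (half_dz (x3 X) (x3 Y)))).
  { eapply wirt_eq.
    - eapply wirt_ext_loc; [apply open_true | exact I | | exact W4].
      intros w _; cbv beta; rewrite <- RtoC_mult, <- RtoC_minus, <- RtoC_plus; f_equal.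
      unfold nil_mul, nil_inv, x1, x2, x3; simpl; ring.
    - change (x3 X) with (dx (fun w => x3 (f w)) z - x1 (f z) * dx (fun w => x2 (f w)) z).
      change (x3 Y) with (dy (fun w => x3 (f w)) z - x1 (f z) * dy (fun w => x2 (f w)) z).
      unfold half_dz; apply C_eq; unfold Re, Im; simpl; ring.
    - change (x3 X) with (dx (fun w => x3 (f w)) z - x1 (f z) * dx (fun w => x2 (f w)) z).
      change (x3 Y) with (dy (fun w => x3 (f w)) z - x1 (f z) * dy (fun w => x2 (f w)) z).
      unfold half_dz; apply C_eq; unfold Re, Im; simpl; ring. }
  apply wirt_unique in W; apply W.
Qed.

Lemma wirt_eq_on_open (D : C -> Prop) u v z a b a' b' : open D -> D z ->
  (forall w, D w -> u w = v w) -> wirt u z a b -> wirt v z a' b' -> a = a' /\ b = b'.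
Proof.
intros HD Hz Huv Hu Hv; apply wirt_ext_loc with (v := v) (D := D) in Hu; auto.
apply wirt_unique in Hu, Hv; destruct Hu as [<- <-], Hv as [<- <-]; auto.
Qed.

Lemma cmc_frame_relations (D : C -> Prop) (f n : C -> R3) H z
  (X := frame (f z) (dx3 f z)) (Y := frame (f z) (dy3 f z)) (N := frame (f z) (n z)) :
  cmc_surface H D f n -> D z ->
  0 < dot X X /\ dot X X = dot Y Y /\ dot X Y = 0 /\ dot N N = 1 /\ dot N X = 0 /\
  dot N Y = 0 /\ 0 < dot (cross X Y) N /\ dot (tension f z) N = 2 * H * dot X X.
Proof.
intros (Sf & Im & Co & Un & Hm) Hz.
destruct (Co z Hz) as [EG F0]; destruct (Un z Hz) as (NN & NX & NY & Hd).
rewrite frame_detE in Hd; rewrite !metric_dot in *; fold X Y N in EG, F0, NN, NX, NY, Hd.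
assert (Hl : 0 < dot X X).
{ destruct (Req_dec (dot X X) 0) as [E0 | Hn].
  - exfalso; assert (Hz0 : x1 X = 0 /\ x2 X = 0 /\ x3 X = 0)
      by (unfold dot in E0; repeat split; nra).
    destruct Hz0 as (a1 & a2 & a3); revert Hd; unfold dot, cross; rewrite a1, a2, a3.
    unfold x1, x2, x3; simpl; lra.
  - assert (0 <= dot X X) by (unfold dot; nra); lra. }
repeat split; auto.
assert (E := Hm z Hz); rewrite mean_curvature_tension in E.
- rewrite metric_dot in E; fold X N in E; rewrite <- E; field; lra.
- exact EG.
- exact F0.
- rewrite metric_dot; fold X; lra.
Qed.

Lemma dirac (D : C -> Prop) (f n : C -> R3) H psi1 psi2 z :
  open D -> cmc_surface H D f n -> weierstrass D f psi1 psi2 -> D z ->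
  (dzb psi1 z = pot H (psi1 z) (Cconj (psi2 z)) * psi2 z)%C /\
  (dzb (fun w => Cconj (psi2 w)) z =
    - Cconj (pot H (psi1 z) (Cconj (psi2 z))) * Cconj (psi1 z))%C.
Proof.
intros HD Hcmc (S1 & S2 & HW) Hz.
assert (Hcmc' := Hcmc); destruct Hcmc' as (Sf & _).
assert (Sf' := Sf); destruct Sf' as (F1 & F2 & F3).
set (q := fun w => Cconj (psi2 w)).
assert (Sq : smoothC D q) by (apply smoothC_conj; auto).
pose proof (smoothC_wirt _ _ _ S1 Hz) as Wp.
pose proof (smoothC_wirt _ _ _ Sq Hz) as Wq.
destruct (cmc_frame_relations D f n H z Hcmc Hz) as (G1 & G2 & G3 & G4 & G5 & G6 & G7 & G8).
assert (HZ : forall w, D w ->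
  (dz (fun w => RtoC (x1 (f w))) w = Ci / 2 * (q w ^ 2 + psi1 w ^ 2))%C /\
  (dz (fun w => RtoC (x2 (f w))) w = 1 / 2 * (q w ^ 2 - psi1 w ^ 2))%C /\
  (dz (fun w => RtoC (x3 (f w))) w =
     RtoC (x1 (f w)) * dz (fun w => RtoC (x2 (f w))) w + psi1 w * q w)%C).
{ intros w Hw; destruct (HW w Hw) as (_ & E1 & E2 & E3).
  destruct (left_dz_frame D f w HD Sf Hw) as (L1 & L2 & L3).
  rewrite L1 in E1; rewrite L2 in E2; rewrite L3 in E3; unfold q.
  rewrite <- E1, <- E2, <- E3, !dz_RtoC; split; [|split]; try reflexivity.
  change (x3 (frame (f w) (dx3 f w))) with
    (dx (fun w => x3 (f w)) w - x1 (f w) * dx (fun w => x2 (f w)) w).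
  change (x3 (frame (f w) (dy3 f w))) with
    (dy (fun w => x3 (f w)) w - x1 (f w) * dy (fun w => x2 (f w)) w).
  unfold half_dz; apply C_eq; unfold Re, Im; simpl; ring. }
assert (Wz : forall x, smooth D x -> wirt (dz (fun w => RtoC (x w))) z
  (dz (dz (fun w => RtoC (x w))) z) (RtoC (/ 4 * lapR x z))).
{ intros x Sx; rewrite <- (laplacian_RtoC D x z HD Sx Hz).
  apply smoothC_wirt with D; auto; apply smoothC_dz; auto; apply smoothC_RtoC; auto. }
assert (E1 := proj2 (wirt_eq_on_open D _ _ z _ _ _ _ HD Hz (fun w Hw => proj1 (HZ w Hw))
  (Wz _ F1) (wirt_scal (Ci / 2)%C _ _ _ _
    (wirt_plus _ _ _ _ _ _ _ (wirt_sqr _ _ _ _ Wq) (wirt_sqr _ _ _ _ Wp))))).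
assert (E2 := proj2 (wirt_eq_on_open D _ _ z _ _ _ _ HD Hz (fun w Hw => proj1 (proj2 (HZ w Hw)))
  (Wz _ F2) (wirt_scal (1 / 2)%C _ _ _ _
    (wirt_minus _ _ _ _ _ _ _ (wirt_sqr _ _ _ _ Wq) (wirt_sqr _ _ _ _ Wp))))).
assert (E3 := proj2 (wirt_eq_on_open D _ _ z _ _ _ _ HD Hz (fun w Hw => proj2 (proj2 (HZ w Hw)))
  (Wz _ F3) (wirt_plus _ _ _ _ _ _ _
    (wirt_mult _ _ _ _ _ _ _ (wirt_RtoC D _ z HD F1 Hz) (Wz _ F2))
    (wirt_mult _ _ _ _ _ _ _ Wp Wq)))).
destruct (HZ z Hz) as (Z1 & Z2 & Z3).
pose proof (HW z Hz) as (Hne & _).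
destruct (left_dz_frame D f z HD Sf Hz) as (L1 & L2 & L3).
destruct (HW z Hz) as (_ & K1 & K2 & K3); rewrite L1 in K1; rewrite L2 in K2; rewrite L3 in K3.
destruct (dirac_pointwise H (psi1 z) (q z) (dzb psi1 z) (dzb q z)
  (frame (f z) (dx3 f z)) (frame (f z) (dy3 f z))
  (frame (f z) (lapR (fun w => x1 (f w)) z, lapR (fun w => x2 (f w)) z,
                        lapR (fun w => x3 (f w)) z))
  (frame (f z) (n z)) (tension f z)) as [R1 R2]; auto.
- cbv beta in E3.
  change (x3 (frame (f z) (lapR (fun w => x1 (f w)) z, lapR (fun w => x2 (f w)) z,
    lapR (fun w => x3 (f w)) z))) with
    (lapR (fun w => x3 (f w)) z - x1 (f z) * lapR (fun w => x2 (f w)) z).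
  transitivity (RtoC (/ 4 * lapR (fun w => x3 (f w)) z)
    - RtoC (x1 (f z)) * RtoC (/ 4 * lapR (fun w => x2 (f w)) z))%C.
  + rewrite <- RtoC_mult, <- RtoC_minus; f_equal; ring.
  + rewrite E3, dz_RtoC.
    change (half_dz (x1 (frame (f z) (dx3 f z))) (x1 (frame (f z) (dy3 f z)))) with
      (half_dz (dx (fun w => x1 (f w)) z) (dy (fun w => x1 (f w)) z)).
    change (half_dz (x2 (frame (f z) (dx3 f z))) (x2 (frame (f z) (dy3 f z)))) with
      (/ 2 * dx (fun w => x2 (f w)) z, - / 2 * dy (fun w => x2 (f w)) z).
    ring.
- intros [Hp Hq]; apply Hne; split; auto.
  rewrite <- (Cconj_conj (psi2 z)); change (Cconj (psi2 z)) with (q z); rewrite Hq.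
  apply RtoC_conj.
- split; [rewrite R1; unfold q; rewrite Cconj_conj; reflexivity | exact R2].
Qed.

(** * Consequences of the Dirac equation *)

Definition dirac_system (H : R) (D : C -> Prop) (psi q : C -> C) : Prop :=
  open D /\ smoothC D psi /\ smoothC D q /\ forall z, D z ->
    (dzb psi z = pot H (psi z) (q z) * Cconj (q z))%C /\
    (dzb q z = - Cconj (pot H (psi z) (q z)) * Cconj (psi z))%C.

(** [AR_coeff] with the conjugate of psi2 as second spinor; the factor a = 2H + i
    is distributed, so that no division remains. *)
Definition ar_coeff (H : R) (psi q : C -> C) (z : C) : C :=
  (/ 4 * ((2 * H + Ci) * (q z * dz psi z - psi z * dz q z)
          + 2 * H * Ci * psi z ^ 2 * q z ^ 2))%C.

Definition pot_fun (H : R) (psi q : C -> C) (z : C) : C := pot H (psi z) (q z).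

(** The derivative of U with respect to z that the product rule and the Dirac
    equation give, for p = d psi and s = d q. *)
Definition pot_z (H : R) (psi q p s : C) : C :=
  let U := pot H psi q in
  (RtoC H / 2 * (p * Cconj psi + psi * (Cconj U * q) + (s * Cconj q + q * (- U * psi)))
   + Ci / 4 * (s * Cconj q + q * (- U * psi) - (p * Cconj psi + psi * (Cconj U * q))))%C.

(** The derivative of U with respect to the conjugate of z, as for [pot_z]. *)
Definition pot_zb (H : R) (psi q p s : C) : C :=
  let U := pot H psi q in
  (RtoC H / 2 * (U * Cconj q * Cconj psi + psi * Cconj p
                 + (- Cconj U * Cconj psi * Cconj q + q * Cconj s))
   + Ci / 4 * (- Cconj U * Cconj psi * Cconj q + q * Cconj s
                 - (U * Cconj q * Cconj psi + psi * Cconj p)))%C.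

Section Consequences.
Variables (H : R) (D : C -> Prop) (psi q : C -> C).
Hypothesis Hd : dirac_system H D psi q.
Let HD : open D := proj1 Hd.
Let S1 : smoothC D psi := proj1 (proj2 Hd).
Let S2 : smoothC D q := proj1 (proj2 (proj2 Hd)).
Let U := pot_fun H psi q.

Lemma wirt_psi z : D z -> wirt psi z (dz psi z) (U z * Cconj (q z)).
Proof.
intros Hz; destruct (proj2 (proj2 (proj2 Hd)) z Hz) as [E _].
unfold U, pot_fun; rewrite <- E; apply smoothC_wirt with D; auto.
Qed.

Lemma wirt_q z : D z -> wirt q z (dz q z) (- Cconj (U z) * Cconj (psi z)).
Proof.
intros Hz; destruct (proj2 (proj2 (proj2 Hd)) z Hz) as [_ E].
unfold U, pot_fun; rewrite <- E; apply smoothC_wirt with D; auto.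
Qed.

Lemma wirt_psib z : D z ->
  wirt (fun w => Cconj (psi w)) z (Cconj (U z) * q z) (Cconj (dz psi z)).
Proof.
intros Hz; eapply wirt_eq; [exact (wirt_conj _ _ _ _ (wirt_psi z Hz))| |]; auto.
rewrite Cmult_conj, Cconj_conj; reflexivity.
Qed.

Lemma wirt_qb z : D z ->
  wirt (fun w => Cconj (q w)) z (- U z * psi z) (Cconj (dz q z)).
Proof.
intros Hz; eapply wirt_eq; [exact (wirt_conj _ _ _ _ (wirt_q z Hz))| |]; auto.
rewrite Cmult_conj, Copp_conj, !Cconj_conj; reflexivity.
Qed.

Lemma wirt_U z : D z -> wirt U z (pot_z H (psi z) (q z) (dz psi z) (dz q z))
  (pot_zb H (psi z) (q z) (dz psi z) (dz q z)).
Proof.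
intros Hz.
pose proof (wirt_mult _ _ _ _ _ _ _ (wirt_psi z Hz) (wirt_psib z Hz)) as WP.
pose proof (wirt_mult _ _ _ _ _ _ _ (wirt_q z Hz) (wirt_qb z Hz)) as WQ.
exact (wirt_plus _ _ _ _ _ _ _
  (wirt_scal (RtoC H / 2)%C _ _ _ _ (wirt_plus _ _ _ _ _ _ _ WP WQ))
  (wirt_scal (Ci / 4)%C _ _ _ _ (wirt_minus _ _ _ _ _ _ _ WQ WP))).
Qed.

Lemma smoothC_U : smoothC D U.
Proof.
assert (SP : smoothC D (fun w => psi w * Cconj (psi w))%C)
  by (apply smoothC_mult; auto; apply smoothC_conj; auto).
assert (SQ : smoothC D (fun w => q w * Cconj (q w))%C)
  by (apply smoothC_mult; auto; apply smoothC_conj; auto).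
unfold U, pot_fun, pot.
apply (smoothC_plus D (fun w => RtoC H / 2 * (psi w * Cconj (psi w) + q w * Cconj (q w)))%C
  (fun w => Ci / 4 * (q w * Cconj (q w) - psi w * Cconj (psi w)))%C); auto.
- apply (smoothC_mult D (fun _ => RtoC H / 2)%C); auto; [apply smoothC_const; auto|].
  apply smoothC_plus; auto.
- apply (smoothC_mult D (fun _ => Ci / 4)%C); auto; [apply smoothC_const; auto|].
  apply smoothC_minus; auto.
Qed.

(** dbar (d psi) = d (dbar psi) = d (U conj q), where no second derivative is left. *)
Lemma wirt_dpsi z : D z -> wirt (dz psi) z (dz (dz psi) z)
  (pot_z H (psi z) (q z) (dz psi z) (dz q z) * Cconj (q z) + U z * (- U z * psi z)).
Proof.
intros Hz; eapply wirt_eq; [apply (smoothC_wirt D); auto; apply smoothC_dz; auto| auto|].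
rewrite (dzb_dz_comm D) by auto.
assert (W := wirt_mult _ _ _ _ _ _ _ (wirt_U z Hz) (wirt_qb z Hz)).
apply wirt_ext_loc with (v := dzb psi) (D := D) in W; auto.
- apply wirt_unique in W; apply W.
- intros w Hw; symmetry; apply (proj2 (proj2 (proj2 Hd)) w Hw).
Qed.

Lemma wirt_dq z : D z -> wirt (dz q) z (dz (dz q) z)
  (- Cconj (pot_zb H (psi z) (q z) (dz psi z) (dz q z)) * Cconj (psi z)
   - Cconj (U z) * (Cconj (U z) * q z)).
Proof.
intros Hz; eapply wirt_eq; [apply (smoothC_wirt D); auto; apply smoothC_dz; auto| auto|].
rewrite (dzb_dz_comm D) by auto.
assert (W := wirt_scal (-1)%C _ _ _ _ (wirt_mult _ _ _ _ _ _ _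
  (wirt_conj _ _ _ _ (wirt_U z Hz)) (wirt_psib z Hz))).
apply wirt_ext_loc with (v := dzb q) (D := D) in W; auto.
- apply wirt_unique in W; destruct W as [-> _]; ring.
- intros w Hw; destruct (proj2 (proj2 (proj2 Hd)) w Hw) as [_ ->].
  unfold U, pot_fun; ring.
Qed.

Ltac conj_push := rewrite ?Cplus_conj, ?Cminus_conj, ?Cmult_conj, ?Copp_conj,
  ?Cconj_conj, ?Ci_conj, ?RtoC_conj.

Lemma half_conj (x : C) : Cconj (x / 2) = (Cconj x / 2)%C.
Proof. apply C_eq; unfold Re, Im; simpl; field. Qed.
Lemma quarter_conj (x : C) : Cconj (x / 4) = (Cconj x / 4)%C.
Proof. apply C_eq; unfold Re, Im; simpl; field. Qed.

(** After substitution of all derivatives, a polynomial identity in the spinors,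
    their z-derivatives and the conjugates of these. *)
Lemma ar_holomorphic z : D z -> dzb (ar_coeff H psi q) z = 0.
Proof.
intros Hz.
assert (W := wirt_scal (/ 4)%C _ _ _ _ (wirt_plus _ _ _ _ _ _ _
  (wirt_scal (2 * H + Ci)%C _ _ _ _ (wirt_minus _ _ _ _ _ _ _
     (wirt_mult _ _ _ _ _ _ _ (wirt_q z Hz) (wirt_dpsi z Hz))
     (wirt_mult _ _ _ _ _ _ _ (wirt_psi z Hz) (wirt_dq z Hz))))
  (wirt_mult _ _ _ _ _ _ _
     (wirt_scal (2 * H * Ci)%C _ _ _ _ (wirt_sqr _ _ _ _ (wirt_psi z Hz)))
     (wirt_sqr _ _ _ _ (wirt_q z Hz))))).
change (ar_coeff H psi q) with (fun w => / 4 * ((2 * H + Ci) *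
  (q w * dz psi w - psi w * dz q w) + 2 * H * Ci * psi w ^ 2 * q w ^ 2))%C.
apply wirt_unique in W; destruct W as [_ ->].
unfold pot_z, pot_zb, U, pot_fun; conj_push; unfold pot; rewrite ?half_conj, ?quarter_conj.
repeat (progress (conj_push; rewrite ?half_conj, ?quarter_conj)).
generalize (Cconj (psi z)) (Cconj (q z)) (Cconj (dz psi z)) (Cconj (dz q z)) (psi z) (q z)
  (dz psi z) (dz q z) (RtoC H); intros; field [Ci2].
Qed.
(** U^2 times the equation for the logarithm of U; in this form it is a polynomial
    identity, by the same substitution. *)
Lemma pot_sinh_gordon z : D z ->
  (U z * dzb (dz U) z - dz U z * dzb U z + U z ^ 4
   - ar_coeff H psi q z * Cconj (ar_coeff H psi q z))%C = 0.
Proof.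
intros Hz.
assert (Wp := wirt_psi z Hz); assert (Wq := wirt_q z Hz).
assert (Wpb := wirt_psib z Hz); assert (Wqb := wirt_qb z Hz).
assert (WU := wirt_U z Hz); assert (WUb := wirt_conj _ _ _ _ WU).
assert (WP := wirt_plus _ _ _ _ _ _ _
  (wirt_mult _ _ _ _ _ _ _ (wirt_dpsi z Hz) Wpb)
  (wirt_mult _ _ _ _ _ _ _ Wp (wirt_mult _ _ _ _ _ _ _ WUb Wq))).
assert (WQ := wirt_plus _ _ _ _ _ _ _
  (wirt_mult _ _ _ _ _ _ _ (wirt_dq z Hz) Wqb)
  (wirt_mult _ _ _ _ _ _ _ Wq (wirt_mult _ _ _ _ _ _ _ (wirt_opp _ _ _ _ WU) Wp))).
assert (W := wirt_plus _ _ _ _ _ _ _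
  (wirt_scal (RtoC H / 2)%C _ _ _ _ (wirt_plus _ _ _ _ _ _ _ WP WQ))
  (wirt_scal (Ci / 4)%C _ _ _ _ (wirt_minus _ _ _ _ _ _ _ WQ WP))).
apply wirt_ext_loc with (v := dz U) (D := D) in W; auto.
2: { intros w Hw; symmetry; exact (proj1 (wirt_unique _ _ _ _ (wirt_U w Hw))). }
apply wirt_unique in W; destruct W as [_ ->].
apply wirt_unique in WU; destruct WU as [-> ->].
unfold ar_coeff, pot_z, pot_zb, U, pot_fun; conj_push; unfold pot.
repeat (progress (conj_push; rewrite ?half_conj, ?quarter_conj, ?Cpow_conj)).
replace (Cconj (/ 4)) with (/ 4)%C by (apply C_eq; unfold Re, Im; simpl; field).
clear; generalize (Cconj (psi z)) (Cconj (q z)) (Cconj (dz psi z)) (Cconj (dz q z))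
  (psi z) (q z) (dz psi z) (dz q z) (RtoC H); intros; field [Ci2].
Qed.

(** For U = exp v the left-hand side is - a |U|^2 (v_z - conj v_zbar), that is,
    - 2i a |U|^2 times the derivative of the phase Im v. *)
Lemma pot_phase z : D z ->
  ((2 * H + Ci) * (U z * Cconj (dzb U z) - Cconj (U z) * dz U z))%C =
  (2 * H * Ci * (psi z * q z * (U z * Cconj (U z))
     + ar_coeff H psi q z * Cconj (psi z * q z)))%C.
Proof.
intros Hz; assert (WU := wirt_U z Hz).
apply wirt_unique in WU; destruct WU as [-> ->].
unfold ar_coeff, pot_z, pot_zb, U, pot_fun; conj_push; unfold pot.
repeat (progress (conj_push; rewrite ?half_conj, ?quarter_conj, ?Cpow_conj)).
clear; generalize (Cconj (psi z)) (Cconj (q z)) (Cconj (dz psi z)) (Cconj (dz q z))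
  (psi z) (q z) (dz psi z) (dz q z) (RtoC H); intros; field [Ci2].
Qed.
End Consequences.

(** * The logarithm of the potential *)

Lemma wirt_Cexp v z a b : wirt v z a b ->
  wirt (fun w => Cexp (v w)) z (a * Cexp (v z)) (b * Cexp (v z)).
Proof.
intros [H1 H2].
assert (He : is_derive exp (Re (v z)) (exp (Re (v z)))) by (auto_derive; auto; ring).
assert (Hc : is_derive cos (Im (v z)) (- sin (Im (v z)))) by (auto_derive; auto; ring).
assert (Hs : is_derive sin (Im (v z)) (cos (Im (v z)))) by (auto_derive; auto; ring).
pose proof (has_partials_comp1 exp (fun w => Re (v w)) z _ _ _ He H1) as Pe.
pose proof (has_partials_comp1 cos (fun w => Im (v w)) z _ _ _ Hc H2) as Pc.
pose proof (has_partials_comp1 sin (fun w => Im (v w)) z _ _ _ Hs H2) as Ps.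
split.
- eapply has_partials_eq; [exact (has_partials_mult _ _ _ _ _ _ _ Pe Pc)| |];
    unfold Cexp, Re, Im; simpl; ring.
- eapply has_partials_eq; [exact (has_partials_mult _ _ _ _ _ _ _ Pe Ps)| |];
    unfold Cexp, Re, Im; simpl; ring.
Qed.

Lemma Cexp_plus v w : Cexp (v + w) = (Cexp v * Cexp w)%C.
Proof.
unfold Cexp; apply C_eq; unfold Re, Im; simpl;
  rewrite exp_plus, ?cos_plus, ?sin_plus; ring.
Qed.

Lemma Cexp_neq0 v : Cexp v <> 0.
Proof.
intros E.
assert (Cexp (v + - v)%C = 1).
{ replace (v + - v)%C with (RtoC 0) by ring.
  unfold Cexp; simpl; rewrite exp_0, cos_0, sin_0; apply C_eq; unfold Re, Im; simpl; ring. }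
rewrite Cexp_plus, E, Cmult_0_l in H; injection H; lra.
Qed.

Lemma Cexp_opp v : Cexp (- v) = (/ Cexp v)%C.
Proof.
apply Cmult_cancel_l with (Cexp v); [apply Cexp_neq0|].
rewrite <- Cexp_plus; replace (v + - v)%C with (RtoC 0) by ring.
replace (Cexp v * / Cexp v)%C with (RtoC 1) by (field; apply Cexp_neq0).
unfold Cexp; simpl; rewrite exp_0, cos_0, sin_0; apply C_eq; unfold Re, Im; simpl; ring.
Qed.

Lemma Csinh_double v : Csinh (2 * v) = ((Cexp v ^ 2 - / Cexp v ^ 2) / 2)%C.
Proof.
unfold Csinh; rewrite Cexp_opp; replace (2 * v)%C with (v + v)%C by ring.
rewrite Cexp_plus; f_equal; simpl; f_equal; [ring | f_equal; f_equal; ring].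
Qed.

Lemma two_H_pm_i_neq0 (H : R) : (2 * H + Ci)%C <> 0 /\ (2 * H - Ci)%C <> 0.
Proof. split; intros E; injection E; intros; lra. Qed.

Lemma conj_two_H_plus_i (H : R) : Cconj (2 * H + Ci) = (2 * H - Ci)%C.
Proof. apply C_eq; unfold Re, Im; simpl; ring. Qed.

Lemma conj_two_H_minus_i (H : R) : Cconj (2 * H - Ci) = (2 * H + Ci)%C.
Proof. apply C_eq; unfold Re, Im; simpl; ring. Qed.

Lemma AR_coeff_ar H psi1 psi2 z :
  AR_coeff H psi1 psi2 z = ar_coeff H psi1 (fun w => Cconj (psi2 w)) z.
Proof.
unfold AR_coeff, Atilde, ar_coeff; pose proof (proj1 (two_H_pm_i_neq0 H)).
generalize (dz (fun w => Cconj (psi2 w)) z) (Cconj (psi2 z)); intros; field; auto.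
Qed.

Section Log.
Variables (H : R) (D : C -> Prop) (psi q v : C -> C).
Hypothesis Hd : dirac_system H D psi q.
Hypothesis HB : forall z, D z -> ar_coeff H psi q z = ((2 * H + Ci) / (2 * H - Ci))%C.
Hypothesis Sv : smoothC D v.
Hypothesis Ev : forall z, D z -> Cexp (v z) = pot_fun H psi q z.
Let HD : open D := proj1 Hd.
Let U := pot_fun H psi q.

Lemma dU_log z : D z -> dz U z = (dz v z * U z)%C /\ dzb U z = (dzb v z * U z)%C.
Proof.
intros Hz; pose proof (wirt_Cexp _ _ _ _ (smoothC_wirt _ _ _ Sv Hz)) as W.
rewrite (Ev z Hz) in W; apply wirt_ext_loc with (v := U) (D := D) in W; auto.
apply wirt_unique in W; exact W.
Qed.

Lemma U_neq0 z : D z -> U z <> 0.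
Proof. intros Hz; unfold U; rewrite <- Ev; auto; apply Cexp_neq0. Qed.

Lemma B_norm z : D z -> (ar_coeff H psi q z * Cconj (ar_coeff H psi q z))%C = 1.
Proof.
intros Hz; destruct (two_H_pm_i_neq0 H); rewrite HB, Cdiv_conj by auto.
rewrite conj_two_H_plus_i, conj_two_H_minus_i; field; auto.
Qed.

Lemma log_sinh_gordon z : D z -> (laplacian v z + 8 * Csinh (2 * v z) = 0)%C.
Proof.
intros Hz.
rewrite (laplacian_wirt D v z HD Sv Hz), Csinh_double, (Ev z Hz).
change (pot_fun H psi q z) with (U z).
pose proof (pot_sinh_gordon H D psi q Hd z Hz) as E; rewrite B_norm in E by auto.
fold U in E.
assert (W := wirt_mult _ _ _ _ _ _ _
  (smoothC_wirt _ _ _ (smoothC_dz _ _ HD Sv) Hz)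
  (smoothC_wirt _ _ _ (smoothC_U H D psi q Hd) Hz)).
apply wirt_ext_loc with (v := dz U) (D := D) in W; auto.
2: { intros w Hw; symmetry; apply dU_log; auto. }
apply wirt_unique in W; destruct W as [_ W]; rewrite W in E.
fold U in E; destruct (dU_log z Hz) as [E1 E2]; rewrite E1, E2 in E.
pose proof (U_neq0 z Hz) as Hu.
apply Cmult_cancel_l with (U z ^ 2)%C; [apply Cpow_nz; auto|].
transitivity (4 * (U z * (dzb (dz v) z * U z + dz v z * (dzb v z * U z))
  - dz v z * U z * (dzb v z * U z) + U z ^ 4 - 1))%C; [field; auto | rewrite E; ring].
Qed.

(** The derivative of the phase for B = a / conj a: the two terms on the right are
    om and its conjugate over |U|^2, with om = H psi q / a. *)
Lemma log_phase z : D z ->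
  (dz v z - Cconj (dzb v z))%C = (- (2 * Ci) * (RtoC H / (2 * H + Ci) * (psi z * q z)
   + Cconj (RtoC H / (2 * H + Ci) * (psi z * q z)) / (U z * Cconj (U z))))%C.
Proof.
intros Hz; pose proof (pot_phase H D psi q Hd z Hz) as E.
rewrite HB in E by auto; change (pot_fun H psi q z) with (U z) in E.
change (dz (pot_fun H psi q) z) with (dz U z) in E.
change (dzb (pot_fun H psi q) z) with (dzb U z) in E.
destruct (dU_log z Hz) as [E1 E2]; rewrite E1, E2, Cmult_conj in E.
pose proof (U_neq0 z Hz) as Hu.
assert (Hub : Cconj (U z) <> 0).
{ intros E0; apply Hu; rewrite <- (Cconj_conj (U z)), E0; apply RtoC_conj. }
destruct (two_H_pm_i_neq0 H) as [Ha Hab].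
rewrite (Cmult_conj (RtoC H / (2 * H + Ci))%C), Cdiv_conj, conj_two_H_plus_i, RtoC_conj by auto.
apply Cmult_cancel_l with ((2 * H + Ci) * (U z * Cconj (U z)))%C.
{ apply Cmult_neq_0; [|apply Cmult_neq_0]; auto. }
transitivity (- ((2 * H + Ci) * (U z * (Cconj (dzb v z) * Cconj (U z)) - Cconj (U z) * (dz v z * U z))))%C;
  [ring|].
rewrite E; field; auto.
Qed.
(** With e = exp rho and om = H psi q / a, the partial derivatives of the phase are
    - 4 Re om cosh rho / e and 4 Im om sinh rho / e, so the left-hand side is
    16 |om|^2 / e^2.  The right-hand side has the same value because
    Re U = H (P + Q) / 2, Im U = (Q - P) / 4 and |om|^2 = H^2 P Q / |a|^2, where P, Q
    are the squared moduli of the spinors. *)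
Lemma log_phase_equation z : D z -> Re (v z) <> 0 ->
  dx (fun w => Im (v w)) z ^ 2 / cosh (Re (v z)) ^ 2
  + dy (fun w => Im (v w)) z ^ 2 / sinh (Re (v z)) ^ 2
  = 8 * (cos (2 * Im (v z)) - Re ((2 * H + Ci) / (2 * H - Ci))%C).
Proof.
intros Hz Hr; pose proof (log_phase z Hz) as E.
destruct (dxC_wirt _ _ _ _ (smoothC_wirt _ _ _ Sv Hz)) as [Ex Ey].
apply (f_equal Im) in Ex, Ey.
change (dx (fun w => Im (v w)) z = Im (dz v z + dzb v z)%C) in Ex.
change (dy (fun w => Im (v w)) z = Im (Ci * (dz v z - dzb v z))%C) in Ey.
rewrite Ex, Ey; clear Ex Ey.
pose proof (Ev z Hz) as EU; change (pot_fun H psi q z) with (U z) in EU.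
set (r := Re (v z)) in *; set (ph := Im (v z)).
set (P := Re (psi z) ^ 2 + Im (psi z) ^ 2); set (Q := Re (q z) ^ 2 + Im (q z) ^ 2).
assert (Ux : exp r * cos ph = H * (P + Q) / 2).
{ pose proof (f_equal Re EU) as K; unfold U, pot_fun, pot, Cexp in K; fold r ph in K.
  unfold Re, Im in K; simpl in K; fold r in K.
  unfold P, Q, Re, Im; rewrite K; field. }
assert (Uy : exp r * sin ph = (Q - P) / 4).
{ pose proof (f_equal Im EU) as K; unfold U, pot_fun, pot, Cexp in K; fold r ph in K.
  unfold Re, Im in K; simpl in K; fold r in K.
  unfold P, Q, Re, Im; rewrite K; field. }
set (om := (RtoC H / (2 * H + Ci) * (psi z * q z))%C) in E.
assert (Hom : Re om ^ 2 + Im om ^ 2 = H ^ 2 * P * Q / (4 * H ^ 2 + 1)).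
{ unfold om, P, Q, Re, Im; simpl; field; repeat split; nra. }
assert (Hm : (U z * Cconj (U z))%C = RtoC (exp r * exp r)).
{ rewrite <- EU; unfold Cexp; fold r ph; apply C_eq; unfold Re, Im; simpl; [|ring].
  pose proof (sin2_cos2 ph) as Hsc; unfold Rsqr in Hsc.
  transitivity (exp r * exp r * (sin ph * sin ph + cos ph * cos ph)); [ring|].
  rewrite Hsc; ring. }
rewrite Hm in E; set (e := exp r) in *.
revert E; generalize (dz v z) (dzb v z) om Hom; clear om Hom; intros vz vb om Hom E.
assert (He : 0 < e) by apply exp_pos.
assert (Hx : Im (vz + vb)%C = - 2 * Re om * (1 + / (e * e))).
{ pose proof (f_equal Im E) as K; unfold Re, Im in *; simpl in *.
  transitivity (snd vz + - - snd vb); [ring|]; rewrite K; field; lra. }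
assert (Hy : Im (Ci * (vz - vb))%C = 2 * Im om * (1 - / (e * e))).
{ pose proof (f_equal Re E) as K; unfold Re, Im in *; simpl in *.
  transitivity (fst vz + - fst vb); [ring|]; rewrite K; field; lra. }
assert (Hch : cosh r = (e + / e) / 2) by (unfold cosh; rewrite exp_Ropp; reflexivity).
assert (Hsh : sinh r = (e - / e) / 2) by (unfold sinh; rewrite exp_Ropp; reflexivity).
assert (He1 : e * e - 1 <> 0).
{ intros E1; assert (e = 1) by nra; apply Hr; apply exp_inv; rewrite exp_0; auto. }
rewrite Hx, Hy, Hch, Hsh, cos_2a.
assert (Hc : cos ph * cos ph - sin ph * sin ph =
  ((H * (P + Q) / 2) ^ 2 - ((Q - P) / 4) ^ 2) / (e * e)).
{ rewrite <- Ux, <- Uy; field; lra. }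
assert (Hee : e * e = (H * (P + Q) / 2) ^ 2 + ((Q - P) / 4) ^ 2).
{ rewrite <- Ux, <- Uy; pose proof (sin2_cos2 ph) as Hsc; unfold Rsqr in Hsc.
  transitivity (e * e * (sin ph * sin ph + cos ph * cos ph)); [rewrite Hsc; ring|ring]. }
assert (Hre : Re ((2 * H + Ci) / (2 * H - Ci))%C = (4 * H ^ 2 - 1) / (4 * H ^ 2 + 1)).
{ unfold Re; simpl; field; repeat split; nra. }
rewrite Hre, Hc.
transitivity (16 * (Re om ^ 2 + Im om ^ 2) / (e * e)).
- field; repeat split; nra.
- rewrite Hom.
  transitivity (8 * (((H * (P + Q) / 2) ^ 2 - ((Q - P) / 4) ^ 2)
    - (4 * H ^ 2 - 1) / (4 * H ^ 2 + 1) * (e * e)) / (e * e)).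
  + rewrite Hee at 2; field; repeat split; nra.
  + field; repeat split; nra.
Qed.
End Log.

(** The half plane s Re > 0 avoids the cut of a branch of the argument; the two
    signs of s account for the two branches. *)
Lemma smooth_log_halfplane (D : C -> Prop) (U : C -> C) (s : R) : open D -> smoothC D U ->
  s <> 0 -> (forall z, D z -> 0 < s * Re (U z)) ->
  exists v, smoothC D v /\ forall z, D z -> Cexp (v z) = U z.
Proof.
intros HD [S1 S2] Hs HU.
assert (Hn : forall z, D z -> Re (U z) <> 0).
{ intros z Hz E; pose proof (HU z Hz); rewrite E in H; lra. }
set (N z := Re (U z) * Re (U z) + Im (U z) * Im (U z)).
assert (HN : forall z, D z -> 0 < N z).
{ intros z Hz; pose proof (Hn z Hz); unfold N.
  pose proof (Rle_0_sqr (Im (U z))); pose proof (Rsqr_pos_lt _ H); unfold Rsqr in *; lra. }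
assert (SN : smooth D N) by (apply smooth_plus; auto; apply smooth_mult; auto).
set (c := if Rlt_dec 0 s then 0 else PI).
exists (fun z => (/ 2 * ln (N z), atan (Im (U z) * / Re (U z)) + c)); split.
- split; simpl.
  + apply smooth_mult; auto; [apply smooth_const; auto | apply smooth_ln; auto].
  + apply smooth_plus; auto; [|apply smooth_const; auto].
    apply smooth_atan; auto; apply smooth_mult; auto; apply smooth_inv; auto.
- intros z Hz; set (t := Im (U z) * / Re (U z)).
  transitivity ((exp (/ 2 * ln (N z)) * cos (atan t + c),
    exp (/ 2 * ln (N z)) * sin (atan t + c)) : C); [reflexivity|].
  assert (En : exp (/ 2 * ln (N z)) = sqrt (N z)).
  { rewrite <- (exp_ln (sqrt (N z))) by (apply sqrt_lt_R0; auto); f_equal.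
    rewrite <- (sqrt_sqrt (N z)) at 1 by (pose proof (HN z Hz); lra).
    rewrite ln_mult by (apply sqrt_lt_R0; auto); field. }
  assert (Et : sqrt (N z) = Rabs (Re (U z)) * sqrt (1 + Rsqr t)).
  { rewrite <- sqrt_Rsqr_abs, <- sqrt_mult;
      [f_equal; unfold N, t, Rsqr; field; auto | apply Rle_0_sqr |].
    pose proof (Rle_0_sqr t); lra. }
  assert (Hst : 0 < sqrt (1 + Rsqr t))
    by (apply sqrt_lt_R0; pose proof (Rle_0_sqr t); lra).
  pose proof (HU z Hz) as Hsz; pose proof (Hn z Hz) as Hrz.
  rewrite En, Et; unfold c; destruct (Rlt_dec 0 s) as [Hs' | Hs'].
  + assert (0 < Re (U z)) by (apply Rmult_lt_reg_l with s; lra).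
    rewrite Rplus_0_r, cos_atan, sin_atan, Rabs_pos_eq by lra.
    apply C_eq; simpl; unfold t in *; field; repeat split; auto; lra.
  + assert (Re (U z) < 0).
    { apply Rnot_le_lt; intros Hle; assert (s < 0) by lra; nra. }
    rewrite neg_cos, neg_sin, cos_atan, sin_atan, Rabs_left by lra.
    apply C_eq; simpl; unfold t in *; field; repeat split; auto; lra.
Qed.

(** * Local spinors *)

Lemma open_nonzero (D : C -> Prop) (F : C -> C) : open D -> smoothC D F ->
  open (fun z => D z /\ F z <> 0).
Proof.
intros HD HF z [Hz Hn].
assert (He : 0 < nrm (F z)).
{ destruct (nrm_ge0 (F z)) as [|E]; auto; elim Hn; apply nrm_0; lra. }
destruct (smoothC_nrm D F z _ HD HF Hz He) as (d & Hd & H).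
apply locally_nrm with d; auto; intros w Hw; destruct (H w Hw) as [Dw Hlt].
split; auto; intros E; rewrite E in Hlt.
replace (0 - F z)%C with (- F z)%C in Hlt by ring; rewrite nrm_opp in Hlt; lra.
Qed.

Lemma left_dz_dz (D : C -> Prop) (f : C -> R3) z : open D -> smooth3 D f -> D z ->
  left_dz x1 f z = dz (fun w => RtoC (x1 (f w))) z /\
  left_dz x2 f z = dz (fun w => RtoC (x2 (f w))) z /\
  left_dz x3 f z = (dz (fun w => RtoC (x3 (f w))) z
    - RtoC (x1 (f z)) * dz (fun w => RtoC (x2 (f w))) z)%C.
Proof.
intros HD Hf Hz; destruct (left_dz_frame D f z HD Hf Hz) as (E1 & E2 & E3).
rewrite E1, E2, E3, !dz_RtoC; split; [|split]; try reflexivity.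
change (x3 (frame (f z) (dx3 f z))) with
  (dx (fun w => x3 (f w)) z - x1 (f z) * dx (fun w => x2 (f w)) z).
change (x3 (frame (f z) (dy3 f z))) with
  (dy (fun w => x3 (f w)) z - x1 (f z) * dy (fun w => x2 (f w)) z).
unfold half_dz; apply C_eq; unfold Re, Im; simpl; ring.
Qed.

(** The squares of the spinors must be - i Z1 - Z2 and Z2 - i Z1, and their product
    Z3.  Since Z is null and nonzero, one of these two squares does not vanish at p:
    take a smooth root of it, and divide Z3 by this root to get the other spinor. *)
Lemma local_spinors (D : C -> Prop) (f n : C -> R3) H p : open D ->
  cmc_surface H D f n -> D p ->
  exists e psi1 psi2, 0 < e /\ (forall z, square p e z -> D z) /\
    weierstrass (square p e) f psi1 psi2.
Proof.
intros HD Hcmc Hp; assert (Hcmc' := Hcmc); destruct Hcmc' as (Sf & _).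
assert (Sf' := Sf); destruct Sf' as (F1 & F2 & F3).
set (Z1 := dz (fun w => RtoC (x1 (f w)))).
set (Z2 := dz (fun w => RtoC (x2 (f w)))).
set (Z3 := fun z => (dz (fun w => RtoC (x3 (f w))) z - RtoC (x1 (f z)) * Z2 z)%C).
assert (SZ1 : smoothC D Z1) by (apply smoothC_dz; auto; apply smoothC_RtoC; auto).
assert (SZ2 : smoothC D Z2) by (apply smoothC_dz; auto; apply smoothC_RtoC; auto).
assert (SZ3 : smoothC D Z3).
{ apply (smoothC_minus D (dz (fun w => RtoC (x3 (f w))))
    (fun z => RtoC (x1 (f z)) * Z2 z)%C); auto.
  - apply smoothC_dz; auto; apply smoothC_RtoC; auto.
  - apply smoothC_mult; auto; apply smoothC_RtoC; auto. }
assert (Hnull : forall z, D z -> (Z1 z ^ 2 + Z2 z ^ 2 + Z3 z ^ 2)%C = 0 /\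
  ~ (Z1 z = 0 /\ Z2 z = 0 /\ Z3 z = 0)).
{ intros z Hz.
  destruct (cmc_frame_relations D f n H z Hcmc Hz) as (G1 & G2 & G3 & _).
  destruct (left_dz_frame D f z HD Sf Hz) as (E1 & E2 & E3).
  destruct (left_dz_dz D f z HD Sf Hz) as (K1 & K2 & K3).
  rewrite K1 in E1; rewrite K2 in E2; rewrite K3 in E3; fold Z1 Z2 in E1, E2, E3.
  change (Z3 z = half_dz (x3 (frame (f z) (dx3 f z))) (x3 (frame (f z) (dy3 f z)))) in E3.
  rewrite E1, E2, E3; revert G1 G2 G3.
  generalize (frame (f z) (dx3 f z)) (frame (f z) (dy3 f z)); intros X Y G1 G2 G3.
  split.
  - unfold dot in *; unfold half_dz; apply C_eq; unfold Re, Im; simpl; lra.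
  - unfold half_dz; intros (A1 & A2 & A3); injection A1; injection A2; injection A3.
    intros; assert (x1 X = 0 /\ x2 X = 0 /\ x3 X = 0) as (B1 & B2 & B3) by lra.
    unfold dot in G1; rewrite B1, B2, B3 in G1; lra. }
assert (Hfin : forall e psi q, 0 < e -> (forall z, square p e z -> D z) ->
  smoothC (square p e) psi -> smoothC (square p e) q ->
  (forall z, square p e z -> (psi z ^ 2)%C = (- Ci * Z1 z - Z2 z)%C /\
     (q z ^ 2)%C = (Z2 z - Ci * Z1 z)%C /\ (psi z * q z)%C = Z3 z) ->
  exists e psi1 psi2, 0 < e /\ (forall z, square p e z -> D z) /\
    weierstrass (square p e) f psi1 psi2).
{ intros e psi q He HeD Sp Sq Hsq; exists e, psi, (fun z => Cconj (q z)).
  split; [exact He|]; split; [exact HeD|]; split; [exact Sp|].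
  split; [apply smoothC_conj; auto using open_square|].
  intros z Hz; destruct (Hsq z Hz) as (E1 & E2 & E3).
  destruct (Hnull z (HeD z Hz)) as [_ Hne].
  destruct (left_dz_dz D f z HD Sf (HeD z Hz)) as (K1 & K2 & K3).
  rewrite K1, K2, K3, Cconj_conj, E1, E2, E3; fold Z1 Z2.
  split; [|split; [|split]].
  - intros [P0 Q0].
    assert (q0 : q z = 0) by (rewrite <- (Cconj_conj (q z)), Q0; apply RtoC_conj).
    rewrite P0 in E1, E3; rewrite q0 in E2, E3; apply Hne; split; [|split].
    + apply Cmult_cancel_l with (- Ci)%C; [intros E; injection E; intros; lra|].
      transitivity (/ 2 * ((- Ci * Z1 z - Z2 z) + (Z2 z - Ci * Z1 z)))%C; [field|].
      rewrite <- E1, <- E2; ring.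
    + transitivity (/ 2 * ((Z2 z - Ci * Z1 z) - (- Ci * Z1 z - Z2 z)))%C; [field|].
      rewrite <- E1, <- E2; ring.
    + rewrite <- E3; ring.
  - field [Ci2].
  - field.
  - reflexivity. }
set (Gq := fun z => (Z2 z - Ci * Z1 z)%C); set (Gp := fun z => (- Ci * Z1 z - Z2 z)%C).
assert (SiZ : forall c : C, smoothC D (fun z => c * Z1 z)%C)
  by (intros; apply smoothC_mult; auto; apply smoothC_const; auto).
assert (SGq : smoothC D Gq) by (apply smoothC_minus; auto).
assert (SGp : smoothC D Gp)
  by (apply (smoothC_minus D (fun z => - Ci * Z1 z)%C Z2); auto).
(* Z is null: this is what makes the product of the two squares a square. *)
assert (Hprod : forall z, D z -> (Gq z * Gp z)%C = (Z3 z ^ 2)%C).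
{ intros z Hz; destruct (Hnull z Hz) as [E _]; unfold Gq, Gp.
  transitivity ((Z1 z ^ 2 + Z2 z ^ 2 + Z3 z ^ 2) - Z1 z ^ 2 - Z2 z ^ 2)%C.
  - rewrite E; ring [Ci2].
  - ring. }
assert (Hroot : forall G G' : C -> C, smoothC D G ->
  (forall z, D z -> (G z * G' z)%C = (Z3 z ^ 2)%C) -> G p <> 0 ->
  exists e r, 0 < e /\ (forall z, square p e z -> D z) /\ smoothC (square p e) r /\
    smoothC (square p e) (fun z => Z3 z * / r z)%C /\
    forall z, square p e z -> (r z ^ 2)%C = G z /\ ((Z3 z * / r z) ^ 2)%C = G' z /\
      (Z3 z * / r z * r z)%C = Z3 z).
{ intros G G' SG HG Gne.
  assert (SG0 : smoothC (fun z => D z /\ G z <> 0) G)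
    by (apply smoothC_mono with D; [intros z []|]; auto).
  destruct (smooth_sqrt_local (fun z => D z /\ G z <> 0) G p) as (e & r & He & Hs & Sr & Er);
    auto using open_nonzero.
  assert (Hr0 : forall z, square p e z -> r z <> 0).
  { intros z Hz E0; destruct (Hs z Hz) as [_ Hn]; apply Hn.
    rewrite <- (Er z Hz), E0; ring. }
  exists e, r; split; [exact He|]; split; [intros z Hz; apply Hs; auto|].
  split; [exact Sr|]; split.
  - apply smoothC_mult; auto using open_square.
    + apply smoothC_mono with D; auto; intros z Hz; apply Hs; auto.
    + apply smoothC_inv; auto using open_square.
  - intros z Hz; destruct (Hs z Hz) as [Dz Gz]; split; [auto|split].
    + apply Cmult_cancel_l with (G z); auto.
      rewrite (HG z Dz), <- (Er z Hz); field; auto.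
    + field; auto. }
destruct (classic (Gq p = 0)) as [E0 | Hn].
- assert (Hn : Gp p <> 0).
  { intros E1; destruct (Hnull p Hp) as [E Hne]; apply Hne.
    assert (A1 : Z1 p = 0).
    { apply Cmult_cancel_l with (- Ci)%C; [intros E2; injection E2; intros; lra|].
      transitivity (/ 2 * (Gq p + Gp p))%C; [unfold Gq, Gp; field|].
      rewrite E0, E1; ring. }
    assert (A2 : Z2 p = 0).
    { transitivity (/ 2 * (Gq p - Gp p))%C; [unfold Gq, Gp; field|].
      rewrite E0, E1; ring. }
    split; [exact A1|]; split; [exact A2|].
    rewrite A1, A2 in E.
    destruct (classic (Z3 p = 0)) as [|H3]; auto.
    apply Cmult_eq0_l with (Z3 p); auto; rewrite <- E; ring. }
  destruct (Hroot Gp Gq) as (e & r & He & Hs & Sr & Sr' & Er); auto.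
  { intros z Hz; rewrite Cmult_comm; auto. }
  apply (Hfin e r (fun z => Z3 z * / r z)%C); auto.
  intros z Hz; destruct (Er z Hz) as (A1 & A2 & A3); repeat split; auto.
  rewrite Cmult_comm; auto.
- destruct (Hroot Gq Gp) as (e & r & He & Hs & Sr & Sr' & Er); auto.
  apply (Hfin e (fun z => Z3 z * / r z)%C r); auto.
  intros z Hz; destruct (Er z Hz) as (A1 & A2 & A3); repeat split; auto.
Qed.

(** * Holomorphic changes of parameter *)

Lemma cmc_surface_mono H (D D' : C -> Prop) f n : (forall z, D' z -> D z) ->
  cmc_surface H D f n -> cmc_surface H D' f n.
Proof.
intros HD ((S1 & S2 & S3) & Im & Co & Un & Hm).
split; [split; [|split]; eapply smooth_mono; eauto|].
split; [intros z Hz; apply Im; auto|].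
split; [intros z Hz; apply Co; auto|].
split; [intros z Hz; apply Un; auto | intros z Hz; apply Hm; auto].
Qed.

Section Reparam.
Variables (D S : C -> Prop) (h : C -> C).
Hypotheses (HD : open D) (HS : open S) (Sh : smoothC S h)
  (Hh : forall w, S w -> D (h w)) (Hdh : forall w, S w -> dzb h w = 0).

Lemma wirt_h w : S w -> wirt h w (dz h w) 0.
Proof. intros Hw; rewrite <- (Hdh w Hw); apply smoothC_wirt with S; auto. Qed.

Lemma dz_comp_holo u w : smoothC D u -> S w ->
  dz (fun w => u (h w)) w = (dz u (h w) * dz h w)%C.
Proof.
intros Su Hw; apply (wirt_unique _ _ _ _
  (wirt_comp D u h w (dz h w) HD (Hh w Hw) Su (wirt_h w Hw))).
Qed.

Lemma smooth_comp_holo u : smooth D u -> smooth S (fun w => u (h w)).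
Proof.
intros Su; destruct (smoothC_comp S D (fun z => RtoC (u z)) h) as [K _]; auto.
apply smoothC_RtoC; auto.
Qed.

Lemma partials_comp_holo u w : smooth D u -> S w ->
  dx (fun w => u (h w)) w = Re (dz h w) * dx u (h w) + Im (dz h w) * dy u (h w) /\
  dy (fun w => u (h w)) w = Re (dz h w) * dy u (h w) - Im (dz h w) * dx u (h w).
Proof.
intros Su Hw.
pose proof (dz_comp_holo (fun z => RtoC (u z)) w (smoothC_RtoC _ _ HD Su) Hw) as E.
rewrite (dz_RtoC (fun w => u (h w))), dz_RtoC in E.
revert E; generalize (dz h w); intros c E.
pose proof (f_equal Re E) as E1; pose proof (f_equal Im E) as E2.
unfold Re, Im in *; simpl in E1, E2; split; lra.
Qed.

(** The Laplacian is 4 ddbar, and ddbar (u o h) = |h'|^2 (ddbar u) o h for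
    holomorphic h. *)
Lemma lapR_comp_holo u w : smooth D u -> S w ->
  lapR (fun w => u (h w)) w = (Re (dz h w) ^ 2 + Im (dz h w) ^ 2) * lapR u (h w).
Proof.
intros Su Hw.
assert (SuC := smoothC_RtoC _ _ HD Su).
pose proof (laplacian_RtoC S _ w HS (smooth_comp_holo u Su) Hw) as E.
pose proof (laplacian_RtoC D u (h w) HD Su (Hh w Hw)) as E'.
assert (Wh : wirt (dz h) w (dz (dz h) w) 0).
{ eapply wirt_eq; [apply (smoothC_wirt S); auto; apply smoothC_dz; auto | auto |].
  rewrite (dzb_dz_comm S) by auto.
  assert (W : wirt (dzb h) w 0 0).
  { apply wirt_ext_loc with (D := S) (u := fun _ => RtoC 0); auto using wirt_const.
    intros; symmetry; auto. }
  apply (wirt_unique _ _ _ _ W). }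
assert (W := wirt_mult _ _ _ _ _ _ _
  (wirt_comp D _ h w (dz h w) HD (Hh w Hw) (smoothC_dz _ _ HD SuC) (wirt_h w Hw)) Wh).
apply wirt_ext_loc with (D := S) (v := dz (fun w => RtoC (u (h w)))) in W; auto.
2: { intros t Ht; symmetry; apply (dz_comp_holo (fun z => RtoC (u z))); auto. }
apply wirt_unique in W; destruct W as [_ W]; cbv beta in E; rewrite W, E' in E.
revert E; generalize (dz h w); intros c E.
apply (f_equal Re) in E; unfold Re, Im in *; simpl in E; lra.
Qed.

(** Tension and metric are both multiplied by |h'|^2, and the orientation is
    preserved. *)
Lemma cmc_surface_reparam H f n : (forall w, S w -> dz h w <> 0) ->
  cmc_surface H D f n -> cmc_surface H S (fun w => f (h w)) (fun w => n (h w)).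
Proof.
intros Hc Hcmc; assert (Hcmc' := Hcmc); destruct Hcmc' as (Sf & Imm & Co & Un & Hm).
destruct Sf as (F1 & F2 & F3).
assert (Hxy : forall w, S w ->
  let a := Re (dz h w) in let b := Im (dz h w) in
  0 < a ^ 2 + b ^ 2 /\
  dx3 (fun w => f (h w)) w = plus (scal a (dx3 f (h w))) (scal b (dy3 f (h w))) /\
  dy3 (fun w => f (h w)) w = plus (scal (- b) (dx3 f (h w))) (scal a (dy3 f (h w)))).
{ intros w Hw a b; split; [|split].
  - pose proof (C_norm2_pos _ (Hc w Hw)); unfold a, b; lra.
  - apply R3_eq; [apply (partials_comp_holo (fun z => x1 (f z)))
      | apply (partials_comp_holo (fun z => x2 (f z)))
      | apply (partials_comp_holo (fun z => x3 (f z)))]; auto.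
  - destruct (partials_comp_holo (fun z => x1 (f z)) w F1 Hw) as [_ K1].
    destruct (partials_comp_holo (fun z => x2 (f z)) w F2 Hw) as [_ K2].
    destruct (partials_comp_holo (fun z => x3 (f z)) w F3 Hw) as [_ K3].
    apply R3_eq; [transitivity (dy (fun w => x1 (f (h w))) w)
      | transitivity (dy (fun w => x2 (f (h w))) w)
      | transitivity (dy (fun w => x3 (f (h w))) w)]; try reflexivity;
      rewrite ?K1, ?K2, ?K3; fold a b;
      [change (a * dy (fun z => x1 (f z)) (h w) - b * dx (fun z => x1 (f z)) (h w) =
         - b * dx (fun z => x1 (f z)) (h w) + a * dy (fun z => x1 (f z)) (h w))
      |change (a * dy (fun z => x2 (f z)) (h w) - b * dx (fun z => x2 (f z)) (h w) =
         - b * dx (fun z => x2 (f z)) (h w) + a * dy (fun z => x2 (f z)) (h w))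
      |change (a * dy (fun z => x3 (f z)) (h w) - b * dx (fun z => x3 (f z)) (h w) =
         - b * dx (fun z => x3 (f z)) (h w) + a * dy (fun z => x3 (f z)) (h w))]; ring. }
set (k w := Re (dz h w) ^ 2 + Im (dz h w) ^ 2).
assert (Hten : forall w, S w -> forall N, 
  dot (tension (fun w => f (h w)) w) N = k w * dot (tension f (h w)) N).
{ intros w Hw N; destruct (Hxy w Hw) as (_ & EX & EY).
  unfold tension; rewrite EX, EY.
  rewrite (lapR_comp_holo (fun z => x1 (f z)) w F1 Hw).
  rewrite (lapR_comp_holo (fun z => x2 (f z)) w F2 Hw).
  rewrite (lapR_comp_holo (fun z => x3 (f z)) w F3 Hw).
  unfold k; generalize (lapR (fun z => x1 (f z)) (h w)) (lapR (fun z => x2 (f z)) (h w))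
    (lapR (fun z => x3 (f z)) (h w)) (dx3 f (h w)) (dy3 f (h w)) (Re (dz h w)) (Im (dz h w))
    (f (h w)).
  intros l1 l2 l3 [[X1 X2] X3] [[Y1 Y2] Y3] a b [[p1 p2] p3]; destruct N as [[N1 N2] N3].
  unfold dot, frame, x1, x2, x3; simpl; unfold plus, scal; simpl; unfold mult; simpl; ring. }
assert (Hmet : forall w u v, S w -> 
  metric (f (h w)) (dx3 (fun w => f (h w)) w) (dx3 (fun w => f (h w)) w) =
    k w * metric (f (h w)) (dx3 f (h w)) (dx3 f (h w)) /\
  metric (f (h w)) (dy3 (fun w => f (h w)) w) (dy3 (fun w => f (h w)) w) =
    k w * metric (f (h w)) (dx3 f (h w)) (dx3 f (h w)) /\
  metric (f (h w)) (dx3 (fun w => f (h w)) w) (dy3 (fun w => f (h w)) w) = 0 /\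
  metric (f (h w)) u (dx3 (fun w => f (h w)) w) =
    Re (dz h w) * metric (f (h w)) u (dx3 f (h w))
    + Im (dz h w) * metric (f (h w)) u (dy3 f (h w)) /\
  metric (f (h w)) u (dy3 (fun w => f (h w)) w) =
    - Im (dz h w) * metric (f (h w)) u (dx3 f (h w))
    + Re (dz h w) * metric (f (h w)) u (dy3 f (h w)) /\
  frame_det (f (h w)) (dx3 (fun w => f (h w)) w) (dy3 (fun w => f (h w)) w) v =
    k w * frame_det (f (h w)) (dx3 f (h w)) (dy3 f (h w)) v).
{ intros w u v Hw; destruct (Hxy w Hw) as (_ & EX & EY); rewrite EX, EY, !frame_detE.
  destruct (Co (h w) (Hh w Hw)) as [EG F0]; revert EG F0.
  unfold k; generalize (dx3 f (h w)) (dy3 f (h w)) (Re (dz h w)) (Im (dz h w)) (f (h w)).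
  intros X Y a b pt EG F0.
  assert (Hl : forall c d, forall v1 v2 v3, metric pt (plus (scal c v1) (scal d v2)) v3 =
    c * metric pt v1 v3 + d * metric pt v2 v3).
  { intros c d [[]] [[]] [[]]; destruct pt as [[]].
    unfold metric, x1, x2, x3; simpl; unfold plus, scal; simpl; unfold mult; simpl; ring. }
  assert (Hc' : forall v1 v2, metric pt v1 v2 = metric pt v2 v1)
    by (intros; unfold metric; ring).
  split; [|split; [|split; [|split; [|split]]]].
  - rewrite Hl, !(Hc' _ (plus _ _)), !Hl, (Hc' Y X), <- EG, F0; ring.
  - rewrite Hl, !(Hc' _ (plus _ _)), !Hl, (Hc' Y X), <- EG, F0; ring.
  - rewrite Hl, !(Hc' _ (plus _ _)), !Hl, (Hc' Y X), <- EG, F0; ring.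
  - rewrite (Hc' u), Hl, (Hc' u), (Hc' u); ring.
  - rewrite (Hc' u), Hl, (Hc' u), (Hc' u); ring.
  - destruct X as [[]], Y as [[]], v as [[]], pt as [[]].
    unfold dot, cross, frame, x1, x2, x3; simpl; unfold plus, scal; simpl;
      unfold mult; simpl; ring. }
assert (Hk : forall w, S w -> 0 < k w) by (intros w Hw; apply (Hxy w Hw)).
split; [split; [|split]; apply smooth_comp_holo with (u := fun z => _ (f z)); auto|].
split; [|split; [|split]].
- intros w Hw a b E; destruct (Hxy w Hw) as (Hp & EX & EY); rewrite EX, EY in E.
  destruct (Imm (h w) (Hh w Hw) (a * Re (dz h w) - b * Im (dz h w))
    (a * Im (dz h w) + b * Re (dz h w))) as [A1 A2].
  + rewrite <- E; generalize (dx3 f (h w)) (dy3 f (h w)); intros [[]] [[]].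
    apply R3_eq; unfold x1, x2, x3; simpl; unfold plus, scal; simpl;
      unfold mult; simpl; ring.
  + revert Hp A1 A2; generalize (Re (dz h w)) (Im (dz h w)); intros c d Hp A1 A2.
    assert (B1 : a * (c ^ 2 + d ^ 2) = 0).
    { transitivity ((a * c - b * d) * c + (a * d + b * c) * d); [ring|].
      rewrite A1, A2; ring. }
    assert (B2 : b * (c ^ 2 + d ^ 2) = 0).
    { transitivity ((a * d + b * c) * c - (a * c - b * d) * d); [ring|].
      rewrite A1, A2; ring. }
    apply Rmult_integral in B1, B2; destruct B1, B2; split; lra.
- intros w Hw; destruct (Hmet w (n (h w)) (n (h w)) Hw) as (A1 & A2 & A3 & _).
  rewrite A1, A2, A3; auto.
- intros w Hw; destruct (Hmet w (n (h w)) (n (h w)) Hw) as (_ & _ & _ & A4 & A5 & A6).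
  destruct (Un (h w) (Hh w Hw)) as (N1 & N2 & N3 & N4).
  rewrite A4, A5, A6, N2, N3; repeat split; try ring; auto.
  apply Rmult_lt_0_compat; auto.
- intros w Hw; destruct (Hmet w (n (h w)) (n (h w)) Hw) as (A1 & A2 & A3 & _).
  destruct (cmc_frame_relations D f n H (h w) Hcmc (Hh w Hw)) as (G1 & _ & _ & _ & _ & _ & _ & G8).
  change (dot (frame (f (h w)) (dx3 f (h w))) (frame (f (h w)) (dx3 f (h w)))) with
    (metric (f (h w)) (dx3 f (h w)) (dx3 f (h w))) in G1, G8.
  pose proof (Hk w Hw).
  rewrite mean_curvature_tension; rewrite ?A1, ?A2, ?A3; auto.
  + rewrite Hten, G8 by auto; field; lra.
  + apply Rmult_integral_contrapositive; split; lra.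
Qed.
End Reparam.

(** * The normalized parameter *)

(** Differentiate r^2 = F. *)
Lemma holo_sqrt (D : C -> Prop) (r F : C -> C) z : open D -> D z -> smoothC D r ->
  (forall w, D w -> (r w ^ 2)%C = F w) -> r z <> 0 -> dzb F z = 0 -> dzb r z = 0.
Proof.
intros HD Hz Sr Er Hr HF.
assert (W := wirt_sqr _ _ _ _ (smoothC_wirt _ _ _ Sr Hz)).
apply wirt_ext_loc with (v := F) (D := D) in W; auto.
apply wirt_unique in W; destruct W as [_ E]; rewrite HF in E.
apply Cmult_eq0_l with (2 * r z)%C; auto.
apply Cmult_neq_0; auto; intros E0; injection E0; lra.
Qed.

Lemma dirac_system_of_surface (D : C -> Prop) f n H psi1 psi2 : open D ->
  cmc_surface H D f n -> weierstrass D f psi1 psi2 ->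
  dirac_system H D psi1 (fun w => Cconj (psi2 w)).
Proof.
intros HD Hc Hw; assert (Hw' := Hw); destruct Hw' as (S1 & S2 & _).
split; [exact HD|]; split; [exact S1|]; split; [apply smoothC_conj; auto|].
intros z Hz; rewrite Cconj_conj; apply dirac with D f n; auto.
Qed.

Lemma smoothC_ar (D : C -> Prop) H psi q : dirac_system H D psi q ->
  smoothC D (ar_coeff H psi q).
Proof.
intros (HD & S1 & S2 & _); unfold ar_coeff.
apply (smoothC_mult D (fun _ => / 4)%C (fun z => (2 * H + Ci) * (q z * dz psi z - psi z * dz q z)
  + 2 * H * Ci * psi z ^ 2 * q z ^ 2)%C); auto; [apply smoothC_const; auto|].
apply (smoothC_plus D (fun z => (2 * H + Ci) * (q z * dz psi z - psi z * dz q z))%C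
  (fun z => 2 * H * Ci * psi z ^ 2 * q z ^ 2)%C); auto.
- apply (smoothC_mult D (fun _ => 2 * H + Ci)%C); auto; [apply smoothC_const; auto|].
  apply (smoothC_minus D (fun z => q z * dz psi z)%C (fun z => psi z * dz q z)%C); auto;
    apply smoothC_mult; auto; apply smoothC_dz; auto.
- apply (smoothC_mult D (fun z => 2 * H * Ci * psi z ^ 2)%C); auto;
    [|apply smoothC_sqr; auto].
  apply (smoothC_mult D (fun _ => 2 * H * Ci)%C); auto; [apply smoothC_const; auto|].
  apply smoothC_sqr; auto.
Qed.

Lemma ar_coeff_ext H psi q q' z : (forall w, q w = q' w) ->
  ar_coeff H psi q z = ar_coeff H psi q' z.
Proof.
intros E; unfold ar_coeff; rewrite E.
replace (dz q z) with (dz q' z); auto.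
assert (Ex : dxC q z = dxC q' z)
  by (apply C_eq; apply Derive_ext; intros; rewrite E; reflexivity).
assert (Ey : dyC q z = dyC q' z)
  by (apply C_eq; apply Derive_ext; intros; rewrite E; reflexivity).
unfold dz; rewrite Ex, Ey; reflexivity.
Qed.

(** In q d psi - psi d q the terms with the derivative of the factor s cancel, so
    B is multiplied by s^2 h' = h'^2. *)
Lemma ar_coeff_reparam (D S : C -> Prop) (h s psi q : C -> C) H w :
  open D -> open S -> smoothC D psi -> smoothC D q -> smoothC S s -> smoothC S h ->
  S w -> (forall w, S w -> D (h w)) ->
  (forall w, S w -> dzb h w = 0) -> (s w ^ 2)%C = dz h w ->
  ar_coeff H (fun w => s w * psi (h w))%C (fun w => s w * q (h w))%C w =
  (dz h w ^ 2 * ar_coeff H psi q (h w))%C.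
Proof.
intros HD HS S1 S2 Ss Sh Hw Hh Hdh Hs.
assert (K : forall u, smoothC D u -> dz (fun w => s w * u (h w))%C w =
  (dz s w * u (h w) + s w * (dz u (h w) * dz h w))%C).
{ intros u Su; apply (wirt_unique _ _ _ _ (wirt_mult _ _ _ _ _ _ _
    (smoothC_wirt _ _ _ Ss Hw)
    (wirt_comp D u h w _ HD (Hh w Hw) Su (wirt_h S h Sh Hdh w Hw)))). }
unfold ar_coeff; rewrite !K by auto; rewrite <- Hs; ring.
Qed.

Lemma weierstrass_reparam (D S : C -> Prop) (h s psi q : C -> C) f :
  open D -> open S -> smooth3 D f -> smoothC S s -> smoothC S h ->
  (forall w, S w -> D (h w)) -> (forall w, S w -> dzb h w = 0) ->
  (forall w, S w -> (s w ^ 2)%C = dz h w /\ s w <> 0) ->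
  weierstrass D f psi (fun z => Cconj (q z)) -> smoothC D q ->
  weierstrass S (fun w => f (h w)) (fun w => s w * psi (h w))%C
    (fun w => Cconj (s w * q (h w)))%C.
Proof.
intros HD HS Sf Ss Sh Hh Hdh Hs (S1 & _ & HW) S2.
assert (Sf' := Sf); destruct Sf' as (F1 & F2 & F3).
split; [|split].
- apply smoothC_mult; auto; apply smoothC_comp with D; auto.
- apply smoothC_conj; auto; apply smoothC_mult; auto; apply smoothC_comp with D; auto.
- intros w Hw; destruct (HW (h w) (Hh w Hw)) as (Hne & E1 & E2 & E3).
  destruct (Hs w Hw) as [Es Hs0].
  destruct (left_dz_dz D f (h w) HD Sf (Hh w Hw)) as (K1 & K2 & K3).
  destruct (left_dz_dz S (fun w => f (h w)) w HS) as (L1 & L2 & L3); auto.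
  { split; [|split]; eapply smooth_comp_holo with (D := D) (u := fun z => _ (f z)); eauto. }
  assert (Hc : forall x : C -> R, smooth D x ->
    dz (fun w => RtoC (x (h w))) w = (dz (fun z => RtoC (x z)) (h w) * dz h w)%C).
  { intros x Sx; apply (dz_comp_holo D S h HD Sh Hh Hdh (fun z => RtoC (x z))); auto.
    apply smoothC_RtoC; auto. }
  rewrite K1 in E1; rewrite K2 in E2; rewrite K3 in E3; rewrite L1, L2, L3.
  rewrite (Hc (fun z => x1 (f z))), (Hc (fun z => x2 (f z))), (Hc (fun z => x3 (f z))) by auto.
  rewrite Cconj_conj in E1, E2, E3; rewrite Cconj_conj.
  split; [|split; [|split]].
  + intros [P Q]; apply Hne; split.
    * apply Cmult_eq0_l with (s w); auto.
    * assert (Q0 : q (h w) = 0).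
      { apply Cmult_eq0_l with (s w); auto.
        rewrite <- (Cconj_conj (s w * q (h w))), Q; apply RtoC_conj. }
      rewrite Q0; apply RtoC_conj.
  + rewrite E1, <- Es; ring.
  + rewrite E2, <- Es; ring.
  + transitivity ((dz (fun w => RtoC (x3 (f w))) (h w) -
      RtoC (x1 (f (h w))) * dz (fun w => RtoC (x2 (f w))) (h w)) * dz h w)%C; [ring|].
    rewrite E3, <- Es; ring.
Qed.

(** The real part of U is H / 2 times a positive number, so U stays in a half
    plane that depends on the sign of H. *)
Lemma log_potential_exists H (D : C -> Prop) f psi1 psi2 : open D -> H <> 0 ->
  weierstrass D f psi1 psi2 ->
  exists v, log_potential H D psi1 psi2 v.
Proof.
intros HD HH (S1 & S2 & HW).
set (U := potential H psi1 psi2).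
assert (SU : smoothC D U).
{ apply smoothC_ext with (fun z => RtoC H / 2 * (psi1 z * Cconj (psi1 z) + psi2 z * Cconj (psi2 z))
    + Ci / 4 * (psi2 z * Cconj (psi2 z) - psi1 z * Cconj (psi1 z)))%C; auto.
  { intros z _; unfold U; rewrite potential_pot; unfold pot; rewrite Cconj_conj; ring. }
  assert (N1 : smoothC D (fun z => psi1 z * Cconj (psi1 z))%C)
    by (apply smoothC_mult; auto; apply smoothC_conj; auto).
  assert (N2 : smoothC D (fun z => psi2 z * Cconj (psi2 z))%C)
    by (apply smoothC_mult; auto; apply smoothC_conj; auto).
  apply (smoothC_plus D (fun z => RtoC H / 2 * (psi1 z * Cconj (psi1 z) + psi2 z * Cconj (psi2 z)))%C
    (fun z => Ci / 4 * (psi2 z * Cconj (psi2 z) - psi1 z * Cconj (psi1 z)))%C); auto.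
  - apply (smoothC_mult D (fun _ => RtoC H / 2)%C); auto; [apply smoothC_const; auto|].
    apply smoothC_plus; auto.
  - apply (smoothC_mult D (fun _ => Ci / 4)%C); auto; [apply smoothC_const; auto|].
    apply smoothC_minus; auto. }
destruct (smooth_log_halfplane D U H HD SU HH) as (v & Sv & Ev).
- intros z Hz; destruct (HW z Hz) as [Hne _].
  assert (E : Re (U z) = H / 2 * (Cmod (psi1 z) ^ 2 + Cmod (psi2 z) ^ 2)).
  { unfold U, potential; generalize (Cmod (psi1 z)) (Cmod (psi2 z)); intros.
    unfold Re; simpl; field. }
  rewrite E.
  pose proof (pow2_ge_0 (Cmod (psi1 z))); pose proof (pow2_ge_0 (Cmod (psi2 z))).
  assert (0 < Cmod (psi1 z) ^ 2 + Cmod (psi2 z) ^ 2).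
  { destruct (classic (psi1 z = 0)) as [E1 | E1].
    - assert (E2 : psi2 z <> 0) by auto.
      apply Cmod_gt_0 in E2; pose proof (pow_lt _ 2 E2); lra.
    - apply Cmod_gt_0 in E1; pose proof (pow_lt _ 2 E1); lra. }
  replace (H * (H / 2 * (Cmod (psi1 z) ^ 2 + Cmod (psi2 z) ^ 2))) with
    (H * H * ((Cmod (psi1 z) ^ 2 + Cmod (psi2 z) ^ 2) / 2)) by field.
  apply Rmult_lt_0_compat; [nra | lra].
- exists v; split; auto.
Qed.

Theorem theorem1
  (H : R) (Sigma : C -> Prop) (f n : C -> R3) (p : C)
  (hH : H <> 0)
  (hSigma : plane_domain Sigma)
  (hS : cmc_surface H Sigma f n)
  (hp : Sigma p)
  (hnonumbilic : ~ umbilic H f p)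
  (hnormal : locally p (fun z =>
     n z <> left_field e3 (f z) /\
     n z <> opp (left_field e3 (f z)) /\
     dz (fun w => RtoC (angle f n w)) z <> RtoC 0)) :
  exists (Sigma' V : C -> Prop) (h : C -> C),
    plane_domain Sigma' /\ open V /\ V p /\ (forall z, V z -> Sigma z) /\
    diffeomorphism Sigma' V h /\
    cmc_surface H Sigma' (fun w => f (h w)) (fun w => n (h w)) /\
    exists psi1 psi2 : C -> C,
      weierstrass Sigma' (fun w => f (h w)) psi1 psi2 /\
      (forall w, Sigma' w ->
         AR_coeff H psi1 psi2 w = ((2 * H + Ci) / (2 * H - Ci))%C) /\
      (exists v : C -> C, log_potential H Sigma' psi1 psi2 v) /\
      (forall v : C -> C, log_potential H Sigma' psi1 psi2 v ->
         solves_system H Sigma' v).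
Proof.
destruct hSigma as [HSig _].
destruct (local_spinors Sigma f n H p HSig hS hp) as (e & psi1 & psi2 & He & Hsub & HW).
set (q := fun w => Cconj (psi2 w)).
assert (Hc0 : cmc_surface H (square p e) f n) by (apply cmc_surface_mono with Sigma; auto).
assert (O0 := open_square p e).
assert (Hdir := dirac_system_of_surface _ f n H psi1 psi2 O0 Hc0 HW).
fold q in Hdir; set (B := ar_coeff H psi1 q).
assert (SB : smoothC (square p e) B) by (apply smoothC_ar; auto).
destruct (two_H_pm_i_neq0 H) as [Ha Hab].
set (c := ((2 * H + Ci) / (2 * H - Ci))%C).
assert (Hc : c <> 0).
{ intros E; apply Ha; transitivity (c * (2 * H - Ci))%C; [unfold c; field; auto|].
  rewrite E; ring. }
(* h' = 1 / G with G^2 = F, and h' needs a square root itself: hence a square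
   root G of F and a square root r of G. *)
set (F := fun z => (/ c * B z)%C).
assert (SF : smoothC (square p e) F)
  by (apply smoothC_mult; auto; apply smoothC_const; auto).
assert (HFp : F p <> 0).
{ intros E; apply hnonumbilic; exists (square p e), psi1, psi2.
  split; [auto|]; split; [apply square_center; auto|]; split; [exact HW|].
  assert (EB : B p = 0) by (transitivity (c * F p)%C; [unfold F; field; auto | rewrite E; ring]).
  unfold B in EB; unfold q in EB; rewrite <- AR_coeff_ar in EB; unfold AR_coeff in EB.
  apply Cmult_eq0_l with (1 / 4 * (2 * H + Ci))%C; auto.
  apply Cmult_neq_0; auto; intros E1; injection E1; lra. }
assert (HF : forall z, square p e z -> dzb F z = 0).
{ intros z Hz; assert (W := wirt_scal (/ c)%C _ _ _ _ (smoothC_wirt _ _ _ SB Hz)).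
  apply wirt_unique in W; destruct W as [_ W]; unfold F; rewrite W.
  unfold B; rewrite (ar_holomorphic H _ psi1 q Hdir z Hz); ring. }
destruct (smooth_sqrt_local (fun z => square p e z /\ F z <> 0) F p)
  as (e1 & G & He1 & Hs1 & SG & EG); auto using open_nonzero, square_center.
{ apply smoothC_mono with (square p e); [intros z []|]; auto. }
assert (HG0 : forall z, square p e1 z -> G z <> 0).
{ intros z Hz E; destruct (Hs1 z Hz) as [_ Hn]; apply Hn; rewrite <- EG, E by auto; ring. }
assert (HG : forall z, square p e1 z -> dzb G z = 0).
{ intros z Hz; apply holo_sqrt with (square p e1) F; auto using open_square.
  apply HF; apply Hs1; auto. }
destruct (smooth_sqrt_local (square p e1) G p) as (e2 & r & He2 & Hs2 & Sr & Er);
  auto using open_square, square_center.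
assert (Hr0 : forall z, square p e2 z -> r z <> 0).
{ intros z Hz E; apply (HG0 z); auto; rewrite <- Er, E by auto; ring. }
assert (Hr : forall z, square p e2 z -> dzb r z = 0).
{ intros z Hz; apply holo_sqrt with (square p e2) G; auto using open_square. }
assert (SG2 : smoothC (square p e2) G) by (apply smoothC_mono with (square p e1); auto).
destruct (holo_primitive p e2 G SG2) as (W & SW & HWz); auto.
destruct (holo_local_inverse (square p e2) W G p) as (S & V & h & HS & HV & Vp & HVs & Hdif & Hh);
  auto using open_square, square_center.
assert (HSo := proj1 HS).
assert (Sh : smoothC S h) by apply Hdif.
assert (HhV : forall w, S w -> V (h w)) by apply Hdif.
assert (Hin : forall z, square p e2 z -> square p e z)
  by (intros z Hz; apply Hs1; auto).
assert (Hh2 : forall w, S w -> square p e2 (h w)) by auto.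
assert (Hh0 : forall w, S w -> square p e (h w)) by auto.
assert (Edz : forall w, S w -> dz h w = (/ G (h w))%C)
  by (intros w Hw; apply (wirt_unique _ _ _ _ (Hh w Hw))).
assert (Edzb : forall w, S w -> dzb h w = 0)
  by (intros w Hw; apply (wirt_unique _ _ _ _ (Hh w Hw))).
set (s := fun w => (/ r (h w))%C).
assert (Ss : smoothC S s).
{ apply smoothC_inv; auto; apply smoothC_comp with (square p e2); auto using open_square. }
assert (Es : forall w, S w -> (s w ^ 2)%C = dz h w /\ s w <> 0).
{ intros w Hw; unfold s; split.
  - rewrite Edz, <- (Er (h w)) by auto; field; auto.
  - intros E; assert (E1 : (r (h w) * / r (h w))%C = 1) by (field; auto).
    rewrite E, Cmult_0_r in E1; injection E1; lra. }
assert (Hcmc : cmc_surface H S (fun w => f (h w)) (fun w => n (h w))).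
{ apply cmc_surface_reparam with (square p e); auto.
  intros w Hw; rewrite <- (proj1 (Es w Hw)); apply Cpow_nz, Es; auto. }
assert (Sq : smoothC (square p e) q) by apply Hdir.
assert (HW' : weierstrass S (fun w => f (h w)) (fun w => s w * psi1 (h w))%C
    (fun w => Cconj (s w * q (h w)))%C).
{ apply weierstrass_reparam with (square p e); auto.
  - apply Hc0.
  - destruct HW as (S1 & S2 & HW); split; [exact S1|]; split.
    + apply smoothC_conj; auto.
    + intros z Hz; unfold q; rewrite Cconj_conj; apply HW; auto. }
exists S, V, h; split; [exact HS|]; split; [exact HV|]; split; [exact Vp|].
split; [auto|]; split; [exact Hdif|]; split; [exact Hcmc|].
exists (fun w => s w * psi1 (h w))%C, (fun w => Cconj (s w * q (h w)))%C.
assert (Hdir' := dirac_system_of_surface _ _ _ _ _ _ HSo Hcmc HW').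
assert (HAR : forall w, S w -> AR_coeff H (fun w => s w * psi1 (h w))%C
  (fun w => Cconj (s w * q (h w)))%C w = c).
{ intros w Hw; rewrite AR_coeff_ar.
  rewrite (ar_coeff_ext H _ _ (fun w => s w * q (h w))%C w)
    by (intros; apply Cconj_conj).
  rewrite (ar_coeff_reparam (square p e) S) with (1 := O0); auto; [|apply Hdir|apply Es; auto].
  fold B; rewrite Edz by auto.
  replace (B (h w)) with (c * F (h w))%C by (unfold F; field; auto).
  rewrite <- EG by auto; field; auto. }
split; [exact HW'|]; split; [exact HAR|]; split.
- apply log_potential_exists with (fun w => f (h w)); auto.
- intros v [Sv Ev]; unfold solves_system; cbv zeta; intros w Hw.
  assert (HB : forall z, S z -> ar_coeff H (fun w => s w * psi1 (h w))%C
    (fun w => Cconj (Cconj (s w * q (h w))))%C z = ((2 * H + Ci) / (2 * H - Ci))%C).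
  { intros z Hz; rewrite <- AR_coeff_ar; apply HAR; auto. }
  assert (Ev' : forall z, S z -> Cexp (v z) = pot_fun H (fun w => s w * psi1 (h w))%C
    (fun w => Cconj (Cconj (s w * q (h w))))%C z).
  { intros z Hz; rewrite Ev by auto; rewrite potential_pot; reflexivity. }
  split.
  + apply (log_sinh_gordon H S _ _ v Hdir' HB Sv Ev' w Hw).
  + intros Hrho; apply (log_phase_equation H S _ _ v Hdir' HB Sv Ev' w Hw Hrho).
Qed.
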